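(* Let $G$ be a Lie group (in Milnor's sense, modeled over a Hausdorff locally convex vector space) that is $k$-continuous and $C^k$-semiregular for some $k\in\mathbb N\sqcup\{\mathrm{lip},\infty\}$. Let $[r,r']$ be a compact interval ($r<r'$), $I\subseteq\mathbb R$ an open interval, and $\Phi:I\times[r,r']\to\mathfrak g$ a map with $\Phi(z,\cdot)\in C^k([r,r'],\mathfrak g)$ for each $z\in I$. Let $x\in I$, and suppose that (a) for each $t\in[r,r']$ the map $z\mapsto\Phi(z,t)$ is differentiable at $z=x$ with derivative $\partial_1\Phi(x,t)\in\mathfrak g$, and $\partial_1\Phi(x,\cdot)\in C^k([r,r'],\mathfrak g)$; (b) for each $\mathfrak p\in\mathfrak P$ and each $s\preceq k$ there exist $L_{\mathfrak p,s}\ge0$ and an open interval $I_{\mathfrak p,s}\subseteq I$ with $x\in I_{\mathfrak p,s}$ such that $$\tfrac1{|h|}\,\dot{\mathfrak p}^s_\infty\big(\Phi(x+h,\cdot)-\Phi(x,\cdot)\big)\le L_{\mathfrak p,s}\qquad\text{for all } h\in\mathbb R\setminus\{0\}\text{ with }x+h\in I_{\mathfrak p,s}.$$ Then $$\frac{d}{dh}\Big|_{h=0}\Big([\Pi\,\Phi(x,\cdot)]^{-1}\,[\Pi\,\Phi(x+h,\cdot)]\Big)=\int_r^{r'}\mathrm{Ad}_{[\Pi_r^s\Phi(x,\cdot)]^{-1}}\big(\partial_1\Phi(x,s)\big)\,ds\ \in\ \overline{\mathfrak g}.$$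
   Context: Calculus: for Hausdorff locally convex vector spaces $F,E$ and $U\subseteq F$ open, a map $f:U\to E$ is differentiable at $x$ if $D_vf(x)=\lim_{t\to 0}\frac1t(f(x+tv)-f(x))$ exists in $E$ for every $v\in F$; it is $C^0$ if continuous, $C^k$ ($k\ge 1$) if all iterated directional derivatives $D_{v_p}\cdots D_{v_1}f$ ($p\le k$) exist and $(x,v_1,\dots,v_p)\mapsto D_{v_p}\cdots D_{v_1}f(x)$ is continuous on $U\times F^p$ for $0\le p\le k$; $C^\infty$ (smooth) if $C^k$ for all $k$. $G$ is a Lie group in Milnor's sense: a group that is a smooth Hausdorff manifold (in this calculus) modeled on a Hausdorff locally convex vector space $E$, with smooth multiplication and inversion. $e$ is the unit, $\mathfrak g=T_eG$ the Lie algebra, $\mathrm R_g(h)=hg$, $\mathrm{Ad}_g=d_e(h\mapsto ghg^{-1})$. $\mathfrak P$ is the set of continuous seminorms on $E$. $\Xi:G\supseteq\mathcal U\to\mathcal V\subseteq E$ is a fixed chart with $e\in\mathcal U$, $\Xi(e)=0$, $\mathcal V$ convex. For $\mathfrak p\in\mathfrak P$ put $\dot{\mathfrak p}:=\mathfrak p\circ d_e\Xi$; these seminorms define the topology of $\mathfrak g$. $\overline{\mathfrak g},\overline E$ denote completions; $d_e\Xi$ extends to an isomorphism $\overline{d_e\Xi}:\overline{\mathfrak g}\to\overline E$. Riemann integrals of continuous $\mathfrak g$-valued curves are taken in $\overline{\mathfrak g}$. For a $G$-valued map $h\mapsto g(h)$ defined near $0$ with $g(0)=e$, the formula $\frac{d}{dh}|_{h=0}g(h)=Z\in\overline{\mathfrak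 g}$ means that $\lim_{h\to0}\frac1h\Xi(g(h))$ exists in $\overline E$ and equals $\overline{d_e\Xi}(Z)$. A curve on $[r,r']$ is $C^k$, $k\in\mathbb N\sqcup\{\infty\}$, if it is the restriction of a $C^k$-curve on an open interval containing $[r,r']$; $C^{\mathrm{lip}}([r,r'],\mathfrak g)$ is the set of curves $\phi$ such that for each $\mathfrak p\in\mathfrak P$ there is $L_{\mathfrak p}\ge0$ with $\dot{\mathfrak p}(\phi(t)-\phi(t'))\le L_{\mathfrak p}|t-t'|$ for all $t,t'$. For $s\in\mathbb N$ write $s\preceq k$ if: $s\le k$ when $k\in\mathbb N$; $s=0$ when $k=\mathrm{lip}$; $s$ arbitrary when $k=\infty$. Put $\dot{\mathfrak p}^s_\infty(\phi):=\sup\{\dot{\mathfrak p}(\phi^{(m)}(t)):0\le m\le s,\ t\in[r,r']\}$; the $C^k$-topology on $C^k([r,r'],\mathfrak g)$ is generated by the seminorms $\dot{\mathfrak p}^s_\infty$ with $\mathfrak p\in\mathfrak P$, $s\preceq k$. The right logarithmic derivative of $\mu\in C^1([r,r'],G)$ is $\delta^r(\mu)(t)=d_{\mu(t)}\mathrm R_{\mu(t)^{-1}}(\dot\mu(t))$. Put $\mathfrak D_{[r,r']}:=\delta^r(C^1([r,r'],G))$, $\mathfrak D^k_{[r,r']}:=\mathfrak D_{[r,r']}\cap C^k([r,r'],\mathfrak g)$. For $\phi=\delta^r(\mu)\in\mathfrak D_{[r,r']}$ the product integral is $\Pi_r^t\phi:=\mu(t)\mu(r)^{-1}$ (well defined),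 and $\Pi\,\phi:=\Pi_r^{r'}\phi$; $\mathrm{evol}^k_{[r,r']}:\mathfrak D^k_{[r,r']}\to G$, $\phi\mapsto\Pi\,\phi$. $G$ is $C^k$-semiregular if $\mathfrak D^k_{[0,1]}=C^k([0,1],\mathfrak g)$ (then $\mathfrak D^k_{[r,r']}=C^k([r,r'],\mathfrak g)$ for all $[r,r']$). $G$ is $k$-continuous if $\mathrm{evol}^k_{[r,r']}$ is continuous with respect to the subspace $C^k$-topology on $\mathfrak D^k_{[r,r']}$ for every compact interval $[r,r']$. *)

(* Defs.v *)
From HB Require Import structures.
From mathcomp Require Import all_boot all_order all_algebra.
From mathcomp Require Import all_classical all_reals all_analysis.
Set Implicit Arguments.
Unset Strict Implicit.
Unset Printing Implicit Defensive.
Import Order.TTheory GRing.Theory Num.Theory.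
Import numFieldNormedType.Exports.
Local Open Scope classical_set_scope.
Local Open Scope ring_scope.

Section Calculus.
Context {R : realType} {F E : tvsType R}.
Implicit Types (f : F -> E) (U : set F).

(* The library's [derive] is restricted to normed modules. *)
Definition is_dderiv f (x v : F) (l : E) : Prop :=
  h^-1 *: (f (x + h *: v) - f x) @[h --> (0 : R)^'] --> l.

Definition dderivable f (x v : F) : Prop := exists l, is_dderiv f x v l.

Definition dderiv f (x v : F) : E := xget 0 [set l | is_dderiv f x v l].

(* [iter_dderiv f [:: v1; ..; vp] x] is D_{vp} ... D_{v1} f (x). *)
Definition iter_dderiv f (vs : seq F) : F -> E :=
  foldl (fun g v => dderiv g ^~ v) f vs.

(* To be used for open U only: maps on U are represented by total functions,
   whose values outside U are then irrelevant. *)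
Definition Ck_on (k : nat) U f : Prop :=
  (forall (vs : seq F) (v x : F), (size vs < k)%N -> U x ->
     dderivable (iter_dderiv f vs) x v) /\
  (forall p, (p <= k)%N ->
     {within U `*` [set: {ptws 'I_p -> F}], continuous
       (fun xv : F * {ptws 'I_p -> F} =>
          iter_dderiv f [seq xv.2 i | i <- enum 'I_p] xv.1)}).

Definition smooth_on U f : Prop := forall k, Ck_on k U f.

End Calculus.

Definition continuous_seminorm {R : realType} {E : tvsType R} (p : E -> R) :=
  [/\ forall x y, p (x + y) <= p x + p y,
      forall (a : R) x, p (a *: x) = `|a| * p x &
      continuous (p : E -> R)].

(* [tvsType] does not tie its uniform structure to the translations, so that
   Cauchy filters have to be those of the additive topological group. *)
Definition tvs_cauchy {R : realType} {E : tvsType R} (A : set_system E) :=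
  forall U : set E, nbhs 0 U ->
    exists2 B, A B & forall x y, B x -> B y -> U (x - y).

Record completion {R : realType} (E : tvsType R) := Completion {
  compl_space :> tvsType R;
  compl_inj : {linear E -> compl_space};
  compl_hausdorff : hausdorff_space compl_space;
  compl_complete : forall A : set_system compl_space,
    ProperFilter A -> tvs_cauchy A -> exists l : compl_space, A --> l;
  compl_embedding : forall (x : E) (A : set E),
    nbhs x A <-> exists2 B, nbhs (compl_inj x) B & compl_inj @^-1` B `<=` A;
  compl_dense : dense (range compl_inj) }.

(* The extension of f : E -> F to the completions, by continuity. *)
Definition compl_ext {R : realType} {E F : tvsType R}
    (cE : completion E) (cF : completion F) (f : E -> F) (Z : cE) : cF :=
  xget 0 [set W : cF |
    compl_inj cF (f v) @[v --> filter_from (nbhs Z)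
                                 (fun B => compl_inj cE @^-1` B)] --> W].

(* Z is the limit of the Riemann sums of f over the tagged subdivisions
   a = s 0 <= s 1 <= ... <= s n = b, as the mesh goes to 0. *)
Definition is_Riemann_integral {R : realType} {V : tvsType R}
    (f : R -> V) (a b : R) (Z : V) : Prop :=
  forall U : set V, nbhs Z U -> exists2 d : R, 0 < d &
    forall (n : nat) (s tau : nat -> R), s 0%N = a -> s n = b ->
      (forall i, (i < n)%N ->
         [/\ s i <= tau i, tau i <= s i.+1 & s i.+1 - s i < d]) ->
      U (\sum_(i < n) (s i.+1 - s i) *: f (tau i)).

Record chart {R : realType} (E : tvsType R) (G : topologicalType) := Chart {
  chart_fun :> G -> E;
  chart_inv : E -> G;
  chart_dom : set G;
  chart_cod : set E;
  chart_dom_open : open chart_dom;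
  chart_cod_open : open chart_cod;
  chart_funP : forall g, chart_dom g -> chart_cod (chart_fun g);
  chart_invP : forall u, chart_cod u -> chart_dom (chart_inv u);
  chart_funK : forall g, chart_dom g -> chart_inv (chart_fun g) = g;
  chart_invK : forall u, chart_cod u -> chart_fun (chart_inv u) = u;
  chart_fun_cont : {within chart_dom, continuous chart_fun};
  chart_inv_cont : {within chart_cod, continuous chart_inv} }.

Definition smooth_transition {R : realType} {E : tvsType R}
    {G : topologicalType} (c1 c2 : chart E G) : Prop :=
  smooth_on (c1 @` (chart_dom c1 `&` chart_dom c2)) (c2 \o chart_inv c1).

#[short(type="groupTopologicalType")]
HB.structure Definition GroupTopological := {G of Group G & Topological G}.

(* Smoothness of multiplication and inversion is expressed in charts, where it
   presupposes continuity. [chart_at x] is a chart around x singled out once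
   and for all, through which the tangent space at x is represented below. *)
HB.mixin Record isLieGroup (R : realType) (E : tvsType R) (G : Type)
    of GroupTopological G := {
  atlas : set (chart E G);
  chart_at : G -> chart E G;
  model_hausdorff : hausdorff_space E;
  lie_hausdorff : hausdorff_space G;
  chart_at_atlas : forall x : G, atlas (chart_at x);
  chart_at_dom : forall x : G, chart_dom (chart_at x) x;
  atlas_smooth : forall c1 c2, atlas c1 -> atlas c2 -> smooth_transition c1 c2;
  lie_mul_cont : continuous (fun x : G * G => (x.1 * x.2)%g);
  lie_mul_smooth : forall a b c, atlas a -> atlas b -> atlas c ->
    smooth_on
      [set u : E * E | [/\ chart_cod a u.1, chart_cod b u.2 &
         chart_dom c (chart_inv a u.1 * chart_inv b u.2)%g]]
      (fun u : E * E => c (chart_inv a u.1 * chart_inv b u.2)%g);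
  lie_inv_cont : continuous (fun x : G => x^-1%g);
  lie_inv_smooth : forall a c, atlas a -> atlas c ->
    smooth_on
      [set u : E | chart_cod a u /\ chart_dom c (chart_inv a u)^-1%g]
      (fun u : E => c (chart_inv a u)^-1%g) }.

#[short(type="lieGroupType")]
HB.structure Definition LieGroup (R : realType) (E : tvsType R) :=
  {G of GroupTopological G & isLieGroup R E G}.

Section LieGroupTheory.
Context {R : realType} {E : tvsType R} {G : lieGroupType E}.

(* Members of the maximal atlas. *)
Definition is_chart (c : chart E G) : Prop :=
  forall c', atlas c' -> smooth_transition c c' /\ smooth_transition c' c.

(* The tangent space at x is E, a tangent vector being represented by its
   coordinates in [chart_at x]. *)
Definition tangent (x : G) : tvsType R := E.
Definition lie_algebra : tvsType R := tangent 1%g.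

(* The differential at x of a map from (an open subset of) G to E. *)
Definition tdiff (f : G -> E) (x : G) (v : tangent x) : E :=
  dderiv (f \o chart_inv (chart_at x)) (chart_at x x) v.

Definition mdiff (f : G -> G) (x : G) (v : tangent x) : tangent (f x) :=
  tdiff (chart_at (f x) \o f) v.

(* [g 1 g^-1] is provably but not definitionally 1, hence the conversion
   between tangent spaces, all of which are E. *)
Definition Ad (g : G) (v : lie_algebra) : lie_algebra :=
  @mdiff (fun h => g * h * g^-1)%g 1%g v : E.

Definition open_interval (J : set R) : Prop := open J /\ is_interval J.

Definition velocity (mu : R -> G) (t : R) : tangent (mu t) :=
  dderiv (chart_at (mu t) \o mu : R^o -> E) t 1.

Definition rlogderiv (mu : R -> G) (t : R) : lie_algebra :=
  @mdiff (fun h => h * (mu t)^-1)%g (mu t) (velocity mu t) : E.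

(* C^1 curves on [r, r'] are represented by their C^1 extensions to an open
   interval. *)
Definition C1_curve (r r' : R) (mu : R -> G) : Prop :=
  exists J : set R, [/\ open_interval J, `[r, r'] `<=` J,
    {within J, continuous mu} &
    forall c : chart E G, atlas c ->
      Ck_on 1 (J `&` mu @^-1` chart_dom c : set R^o) (c \o mu : R^o -> E)].

Definition solutions (r r' : R) (phi : R -> lie_algebra) : set (R -> G) :=
  [set mu | C1_curve r r' mu /\
            forall t, `[r, r']%classic t -> phi t = rlogderiv mu t].

Definition integrable_curves (r r' : R) : set (R -> lie_algebra) :=
  [set phi | exists mu, solutions r r' phi mu].

(* Product integral from r to t of phi on [r, r']: the value does not depend on
   the solution chosen, solutions being unique up to right translation. *)
Definition prodint (r r' : R) (phi : R -> lie_algebra) (t : R) : G :=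
  let mu := xget (fun=> 1%g) (solutions r r' phi) in (mu t * (mu r)^-1)%g.

Inductive regularity := RegNat of nat | RegLip | RegInf.

Definition reg_le (s : nat) (k : regularity) : Prop :=
  match k with
  | RegNat n => (s <= n)%N
  | RegLip => s = 0%N
  | RegInf => True
  end.

(* Derivative of a curve on the interval [r, r'], one-sided at r and r'; for a
   restriction to [r, r'] it is the derivative of any C^1 extension. *)
Definition cderiv (r r' : R) (phi : R -> lie_algebra) (t : R) : lie_algebra :=
  xget 0 [set l : lie_algebra | h^-1 *: (phi (t + h) - phi t)
    @[h --> within [set h | `[r, r']%classic (t + h)] (0 : R)^'] --> l].

Section WithChart.
Variable Xi : chart E G.

Definition dotted (p : E -> R) (v : lie_algebra) : R :=
  p (@tdiff Xi 1%g v).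

Definition Ck_curves (k : regularity) (r r' : R) : set (R -> lie_algebra) :=
  match k with
  | RegNat n => [set phi | exists J (psi : R -> lie_algebra),
      [/\ open_interval J, `[r, r'] `<=` J,
          @Ck_on R R^o lie_algebra n J psi &
          forall t, `[r, r']%classic t -> phi t = psi t]]
  | RegInf => [set phi | exists J (psi : R -> lie_algebra),
      [/\ open_interval J, `[r, r'] `<=` J,
          @smooth_on R R^o lie_algebra J psi &
          forall t, `[r, r']%classic t -> phi t = psi t]]
  | RegLip => [set phi | forall p : E -> R, continuous_seminorm p ->
      exists2 L : R, 0 <= L & forall t t',
        `[r, r']%classic t -> `[r, r']%classic t' ->
        dotted p (phi t - phi t') <= L * `|t - t'|]
  end.

Definition sup_seminorm (p : E -> R) (s : nat) (r r' : R)
    (phi : R -> lie_algebra) : \bar R :=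
  ereal_sup [set y | exists m t, [/\ (m <= s)%N, `[r, r']%classic t &
    y = (dotted p (iter m (cderiv r r') phi t))%:E]].

(* Neighbourhoods of phi for the topology generated by the seminorms
   [sup_seminorm p s] with s below k. *)
Definition Ck_nbhs (k : regularity) (r r' : R) (phi : R -> lie_algebra)
    : set_system (R -> lie_algebra) :=
  [set A | exists (n : nat) (p : 'I_n -> E -> R) (s : 'I_n -> nat) (eps : R),
    [/\ forall i, continuous_seminorm (p i) /\ reg_le (s i) k, 0 < eps &
        [set psi | forall i, (sup_seminorm (p i) (s i) r r'
                                (fun t => (psi t - phi t)%R) < eps%:E)%E] `<=` A]].

Definition Ck_integrable (k : regularity) (r r' : R) : set (R -> lie_algebra) :=
  integrable_curves r r' `&` Ck_curves k r r'.

Definition semiregular (k : regularity) : Prop :=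
  Ck_integrable k 0 1 = Ck_curves k 0 1.

Definition k_continuous (k : regularity) : Prop :=
  forall r r' : R, r < r' -> forall phi, Ck_integrable k r r' phi ->
    prodint r r' psi r'
      @[psi --> within (Ck_integrable k r r') (Ck_nbhs k r r' phi)]
      --> prodint r r' phi r'.

(* d/dh|_{h=0} g(h) = Z. As [Xi] is only meaningful on its domain, g(h) has to
   belong to it for small h. *)
Definition is_deriv_at_unit (cg : completion lie_algebra) (cE : completion E)
    (g : R -> G) (Z : cg) : Prop :=
  (\forall h \near (0 : R), chart_dom Xi (g h)) /\
  h^-1 *: compl_inj cE (Xi (g h)) @[h --> (0 : R)^']
    --> compl_ext cE (@tdiff Xi 1%g : lie_algebra -> E) Z.

End WithChart.

End LieGroupTheory.

Arguments tangent {R E G} x.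
Arguments lie_algebra {R E} G.

(* Main.v *)
Require Import Defs.
From HB Require Import structures.
From mathcomp Require Import all_boot all_order all_algebra.
From mathcomp Require Import all_classical all_reals all_analysis.
From mathcomp Require Import ring lra.
Set Implicit Arguments.
Unset Strict Implicit.
Unset Printing Implicit Defensive.
Import Order.TTheory GRing.Theory Num.Theory.
Import numFieldNormedType.Exports.
Local Open Scope classical_set_scope.
Local Open Scope ring_scope.

(** Let mu and mu_h be the product integrals of Phi x and Phi (x + h) up to the
    time t, and nu_h = mu^-1 mu_h, so that the claim is about Xi (nu_h r') / h.
    In the chart Xi the curve nu_h satisfies (logder_quot)

      (Xi o nu_h)' = K (mu, nu_h) [Phi (x + h) - Phi x],

    where K (g, n), called dconj_trans, is the differential at 1 of the map
    u |-> Xi (g^-1 u g n).  It is jointly continuous and linear in the bracket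
    (dconj_trans_cont), and K (g, 1) is the differential of Xi at 1 composed with
    Ad g^-1 (dconj_trans_Ad).  Thus Xi (nu_h r') / h is the integral of
    K (mu, nu_h) [(Phi (x + h) - Phi x) / h], and it has to be shown that it tends
    to the integral of K (mu, 1) [dPhi].  Two facts make this work.

    First, nu_h tends to 1 uniformly on [r, r'] (near_quot_unif).  The value of
    mu_h at t is the product integral, over all of [r, r'], of the restriction of
    Phi (x + h) to [r, t], rescaled to [r, r'].  By the bound on the difference
    quotients these rescaled curves converge in the C^k-topology as
    (t, h) -> (t0, 0), and k-continuity gives the convergence of mu_h t to mu t0
    (cvg_prodint), which is uniform because [r, r'] is compact.

    Secondly, the difference quotients converge only pointwise, but they are
    bounded in every seminorm.  For a continuous seminorm q, the q-distance
    between the two integrands is therefore a bounded real function of t that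
    tends to 0 pointwise; by bounded convergence its primitive tends to 0
    (gap_primitive).  The mean value inequality for seminorms turns this into an
    estimate of the distance between Xi (nu_h r') / h and the Riemann sums of the
    limit integrand (mean_value, increment_riemann_sum).

    Vector-valued integrals occur only as limits of Riemann sums in the
    completions (Riemann_integral_exists, compl_ext_Riemann_integral).  The
    differential calculus is based on a strict form of directional
    differentiability with parameters (sdiff), which follows from C^1 by the mean
    value inequality (C1_sdiff), is stable under composition, and contains the
    linearity and the continuity of differentials. *)

(** * Seminorms and local convexity *)

Lemma subrACA (V : zmodType) (a b c d : V) : (a - b) - (c - d) = (a - c) - (b - d).
Proof. by rewrite (opprD c) (opprD b) addrACA. Qed.

Section TvsLimits.
Context {R : realType} {E : tvsType R}.

Lemma tvs_cvgD {T} {F : set_system T} {FF : Filter F} (f g : T -> E) (a b : E) :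
  f @ F --> a -> g @ F --> b -> (fun x => f x + g x) @ F --> a + b.
Proof.
move=> fa gb.
exact: (cvg_comp2 fa gb (@add_continuous E (a, b))).
Qed.

Lemma tvs_cvgN {T} {F : set_system T} {FF : Filter F} (f : T -> E) (a : E) :
  f @ F --> a -> (fun x => - f x) @ F --> - a.
Proof. by move=> fa; exact: (cvg_comp _ _ fa (@opp_continuous E a)). Qed.

Lemma tvs_cvgB {T} {F : set_system T} {FF : Filter F} (f g : T -> E) (a b : E) :
  f @ F --> a -> g @ F --> b -> (fun x => f x - g x) @ F --> a - b.
Proof. by move=> fa gb; apply: tvs_cvgD => //; exact: tvs_cvgN. Qed.

Lemma tvs_cvgZ {T} {F : set_system T} {FF : Filter F}
    (k : T -> R) (f : T -> E) (c : R) (a : E) :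
  k @ F --> c -> f @ F --> a -> (fun x => k x *: f x) @ F --> c *: a.
Proof.
move=> kc fa.
exact: (cvg_comp2 (kc : (k : T -> R^o) @ F --> (c : R^o)) fa
  (@scale_continuous R E (c, a))).
Qed.

Lemma tvs_cvg_unique {T} {F : set_system T} {FF : ProperFilter F}
    (f : T -> E) (a b : E) : hausdorff_space E ->
  f @ F --> a -> f @ F --> b -> a = b.
Proof.
by move=> hE fa fb; exact: (@cvg_unique _ hE (f @ F) _ a b).
Qed.

End TvsLimits.

Section Seminorms.
Context {R : realType} {E : tvsType R}.
Implicit Types (p : E -> R) (U : set E).

Section theory.
Variable p : E -> R.
Hypothesis sp : continuous_seminorm p.

Lemma snormD x y : p (x + y) <= p x + p y. Proof. by case: sp. Qed.
Lemma snormZ a x : p (a *: x) = `|a| * p x. Proof. by case: sp. Qed.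
Lemma snorm_cont : continuous (p : E -> R). Proof. by case: sp. Qed.
Lemma snorm0 : p 0 = 0.
Proof. by rewrite -(scale0r 0) snormZ normr0 mul0r. Qed.
Lemma snormN x : p (- x) = p x.
Proof. by rewrite -scaleN1r snormZ normrN normr1 mul1r. Qed.
Lemma snorm_ge0 x : 0 <= p x.
Proof. have := snormD x (- x); rewrite subrr snorm0 snormN; lra. Qed.
Lemma snormB x y : p (x - y) <= p x + p y.
Proof. by rewrite -(snormN y); exact: snormD. Qed.
Lemma snormBC x y : p (x - y) = p (y - x).
Proof. by rewrite -snormN opprB. Qed.
Lemma snorm_sum n (F : nat -> E) :
  p (\sum_(i < n) F i) <= \sum_(i < n) p (F i).
Proof.
elim: n => [|n IH]; first by rewrite !big_ord0 snorm0.
by rewrite !big_ord_recr /= (le_trans (snormD _ _))// lerD2r.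
Qed.

Lemma nbhs_snorm_lt e : 0 < e -> nbhs 0 [set x | p x < e].
Proof.
move=> e0; have /(_ [set r | r < e]) := @snorm_cont 0.
rewrite snorm0; apply; exact: lt_nbhsl.
Qed.

Lemma cvg_snorm_lt {T} {F : set_system T} {FF : Filter F} (f : T -> E) a e :
  0 < e -> f @ F --> a -> \forall x \near F, p (f x - a) < e.
Proof.
move=> e0 fa.
have fa0 : (fun x => f x - a) @ F --> (0 : E).
  by rewrite -(subrr a); apply: tvs_cvgB => //; exact: cvg_cst.
exact: (fa0 _ (nbhs_snorm_lt e0)).
Qed.

End theory.

Definition gauge U (x : E) : R := inf [set r | 0 < r /\ U (r^-1 *: x)].

Section gauge.
Variable W : set E.
Hypothesis Wconv : forall x y (t : R), W x -> W y -> 0 <= t <= 1 ->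
  W (t *: x + (1 - t) *: y).
Hypothesis Wsym : forall x, W x -> W (- x).
Hypothesis W0 : nbhs 0 W.

Let absorb x : exists r : R, 0 < r /\ W (r^-1 *: x).
Proof.
have : (fun r : R => r *: x) @ (0 : R) --> (0 : E).
  have := @tvs_cvgZ _ _ _ (nbhs (0:R)) _ idfun (fun=> x) 0 x.
  by rewrite scale0r; apply; [exact: cvg_id|exact: cvg_cst].
move=> /(_ _ W0)/= [e /= e0 H].
exists (e / 2)^-1; split; first by rewrite invr_gt0 divr_gt0.
by rewrite invrK; apply: H => /=; rewrite sub0r normrN gtr0_norm; lra.
Qed.

Let lbd x : has_lbound [set r | 0 < r /\ W (r^-1 *: x)].
Proof. by exists 0 => r [/ltW]. Qed.

Let hasinf x : has_inf [set r | 0 < r /\ W (r^-1 *: x)].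
Proof. by split; [exact: absorb|exact: lbd]. Qed.

Let W00 : W 0. Proof. exact: nbhs_singleton. Qed.

Lemma gauge_le x r : 0 < r -> W (r^-1 *: x) -> gauge W x <= r.
Proof. by move=> r0 Wr; apply: ge_inf; [exact: lbd|split]. Qed.

Lemma gauge_lt x e : gauge W x < e -> exists r, [/\ 0 < r, r < e & W (r^-1 *: x)].
Proof.
move=> xe; have e0 : 0 < e - gauge W x by lra.
have [r [r0 Wr] re] := inf_adherent e0 (hasinf x).
by exists r; split => //; move: re; rewrite -/(gauge W x); lra.
Qed.

Lemma gauge_sub : [set x | gauge W x < 1] `<=` W.
Proof.
move=> x /gauge_lt[r [r0 r1 Wr]].
have := @Wconv _ _ r Wr W00; rewrite scaler0 addr0 scalerA mulfV ?gt_eqF// scale1r.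
by apply; lra.
Qed.

Let gauge_ge0 x : 0 <= gauge W x.
Proof. by apply: lb_le_inf; [exact: absorb|move=> r [/ltW]]. Qed.

Let gaugeD x y : gauge W (x + y) <= gauge W x + gauge W y.
Proof.
apply/ler_addgt0Pr => e e0.
have [|r [r0 re Wr]] := @gauge_lt x (gauge W x + e / 2); first lra.
have [|s [s0 se Ws]] := @gauge_lt y (gauge W y + e / 2); first lra.
apply: (@le_trans _ _ (r + s)); last lra.
apply: gauge_le; first lra.
have rs0 : r + s != 0 by rewrite gt_eqF//; lra.
have := @Wconv _ _ (r / (r + s)) Wr Ws.
have -> : (r / (r + s)) *: (r^-1 *: x) = (r + s)^-1 *: x.
  by rewrite scalerA; congr (_ *: _); field; rewrite rs0 gt_eqF.
have -> : (1 - r / (r + s)) *: (s^-1 *: y) = (r + s)^-1 *: y.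
  by rewrite scalerA; congr (_ *: _); field; rewrite rs0 gt_eqF.
rewrite scalerDr; apply; apply/andP; split; first by rewrite divr_ge0; lra.
by rewrite ler_pdivrMr; lra.
Qed.

Let gaugeZ_le a x : a != 0 -> gauge W (a *: x) <= `|a| * gauge W x.
Proof.
move=> a0; apply/ler_addgt0Pr => e e0.
have na0 : 0 < `|a| by rewrite normr_gt0.
have [|r [r0 re Wr]] := @gauge_lt x (gauge W x + e / `|a|).
  by rewrite ltrDl divr_gt0.
apply: (@le_trans _ _ (`|a| * r)); last first.
  apply: le_trans (_ : `|a| * (gauge W x + e / `|a|) <= _).
    by rewrite ler_pM2l// ltW.
  by rewrite mulrDr mulrCA mulfV ?gt_eqF// mulr1.
apply: gauge_le; first exact: mulr_gt0.
rewrite scalerA; have [ap|an] := ltP 0 a.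
  rewrite gtr0_norm// (_ : (a * r)^-1 * a = r^-1)//.
  by field; rewrite !gt_eqF.
rewrite ler0_norm// (_ : (- a * r)^-1 * a = - r^-1); last by field; rewrite a0 gt_eqF.
by rewrite scaleNr; exact: Wsym.
Qed.

Lemma gauge_snorm : continuous_seminorm (gauge W).
Proof.
have g0 : gauge W 0 = 0.
  apply/eqP; rewrite eq_le gauge_ge0 andbT; apply/ler_addgt0Pr => e e0.
  by rewrite add0r; apply: gauge_le => //; rewrite scaler0.
have gZ a x : gauge W (a *: x) = `|a| * gauge W x.
  have [->|a0] := eqVneq a 0; first by rewrite scale0r g0 normr0 mul0r.
  apply/eqP; rewrite eq_le gaugeZ_le//=.
  have ai0 : a^-1 != 0 by rewrite invr_eq0.
  have := @gaugeZ_le a^-1 (a *: x) ai0.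
  rewrite scalerA mulVf// scale1r normfV => H.
  rewrite -(@ler_pM2l _ (`|a|^-1)) ?invr_gt0 ?normr_gt0//.
  by rewrite mulrA mulVf ?normr_eq0// mul1r.
have gN x : gauge W (- x) = gauge W x.
  by rewrite -scaleN1r gZ normrN normr1 mul1r.
split=> // x; apply/cvgrPdist_lt => e e0.
have e20 : 0 < e / 2 by rewrite divr_gt0.
have : (fun y => (e / 2)^-1 *: (x - y)) @ x --> (0 : E).
  rewrite [X in _ --> X](_ : _ = (e / 2)^-1 *: (x - x)); last first.
    by rewrite subrr scaler0.
  apply: tvs_cvgZ; first exact: cvg_cst.
  by apply: tvs_cvgB; [exact: cvg_cst|exact: cvg_id].
move=> xW; have : nbhs x [set y | W ((e / 2)^-1 *: (x - y))] := xW _ W0.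
rewrite nearE; apply: (@filterS _ (nbhs x)) => y /= Wy.
have le1 : gauge W (x - y) <= e / 2 by exact: gauge_le.
have := gaugeD (x - y) y; rewrite subrK.
have := gaugeD (y - x) x; rewrite subrK -[y - x]opprB gN.
by rewrite ltr_norml => *; apply/andP; split; lra.
Qed.

End gauge.

(** Local convexity in the form in which it is used throughout: the topology is
    defined by the continuous seminorms.  The seminorm is the gauge of a convex
    neighbourhood intersected with its opposite. *)
Lemma nbhs0_snorm U : nbhs 0 U ->
  exists2 p, continuous_seminorm p & [set x | p x < 1] `<=` U.
Proof.
move=> U0; have [B Bconv [Bo Bb]] := @locally_convex R E.
have [V [BV V0] VU] := Bb 0 _ U0.
have Vc x y (t : R) : V x -> V y -> 0 <= t <= 1 -> V (t *: x + (1 - t) *: y).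
  move=> Vx Vy t01.
  have := Bconv V (mem_set BV) x y (Itv01 (proj1 (andP t01)) (proj2 (andP t01)))
    (mem_set Vx) (mem_set Vy).
  by rewrite inE.
have nV : nbhs 0 V by exact: open_nbhs_nbhs (conj (Bo _ BV) V0).
pose W := V `&` [set x | V (- x)].
have Wc x y (t : R) : W x -> W y -> 0 <= t <= 1 -> W (t *: x + (1 - t) *: y).
  move=> [Vx VNx] [Vy VNy] t01; split; first exact: Vc.
  by rewrite /= opprD -!scalerN; exact: Vc.
have Ws x : W x -> W (- x) by move=> [Vx VNx]; split => //=; rewrite opprK.
have nW : nbhs 0 W.
  apply: filterI => //.
  by have /(_ V) := @opp_continuous E 0; rewrite oppr0; exact.
exists (gauge W); first exact: gauge_snorm.
by move=> x H; apply: VU; exact: (proj1 (gauge_sub Wc nW H)).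
Qed.

Lemma nbhs_snorm a U : nbhs a U ->
  exists2 p, continuous_seminorm p & [set x | p (x - a) < 1] `<=` U.
Proof.
move=> Ua; have : (fun y => y + a) @ (0 : E) --> a.
  have := @tvs_cvgD _ _ _ (nbhs (0 : E)) _ idfun (fun=> a) 0 a.
  by rewrite add0r; apply; [exact: cvg_id|exact: cvg_cst].
move=> /(_ _ Ua) /nbhs0_snorm[p sp pU]; exists p => // x /pU /=.
by rewrite subrK.
Qed.

Lemma cvg_snormP {T} {F : set_system T} {FF : Filter F} (f : T -> E) a :
  (forall p, continuous_seminorm p -> forall e, 0 < e ->
     \forall x \near F, p (f x - a) < e) <-> f @ F --> a.
Proof.
split=> [H U /nbhs_snorm[p sp pU]|fa p sp e e0]; last exact: cvg_snorm_lt.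
by have := H p sp 1 ltr01; rewrite /nbhs/=; apply: filterS => x /pU.
Qed.

Lemma snorm_eq0 x : hausdorff_space E ->
  (forall p, continuous_seminorm p -> p x = 0) -> x = 0.
Proof.
move=> hE px; apply: (@tvs_cvg_unique _ _ _ \oo _ (fun=> x)) => //; first exact: cvg_cst.
by apply/cvg_snormP => p sp e e0; near=> n; rewrite subr0 px.
Unshelve. all: by end_near.
Qed.

End Seminorms.

Lemma snorm_comp {R : realType} {E F : tvsType R} (p : F -> R) (f : E -> F) :
  continuous_seminorm p -> (forall x y, f (x + y) = f x + f y) ->
  (forall (a : R) x, f (a *: x) = a *: f x) -> continuous f ->
  continuous_seminorm (p \o f).
Proof.
move=> sp fD fZ fc; split=> [x y|a x|x] /=.
- by rewrite fD snormD.
- by rewrite fZ snormZ.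
- by apply: continuous_comp; [exact: fc|exact: snorm_cont].
Qed.

(** * The mean value inequality for curves *)

(** A form of compactness of [a, b], proved with the supremum of the points
    that are related to a.  It serves to add up local estimates of increments,
    and to pass from locally constant functions to constant ones. *)
Lemma interval_chain (R : realType) (P : R -> R -> Prop) (a b : R) : a <= b ->
  (forall s t u, P s t -> P t u -> P s u) ->
  (forall t, a <= t <= b -> exists2 d, 0 < d & forall s u,
     a <= s -> s <= t -> t <= u -> u <= b -> t - d < s -> u < t + d -> P s u) ->
  P a b.
Proof.
move=> ab Ptr Ploc; pose S := [set t | a <= t <= b /\ P a t].
have Sa : S a.
  split; first by rewrite lexx.
  have [|d d0] := Ploc a; first by rewrite lexx.
  by apply => //; lra.
have Sb : ubound S b by move=> t [/andP[]].
have hS : has_sup S by split; [exists a|exists b].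
have ac : a <= sup S by apply: ub_le_sup => //; exists b.
have cb : sup S <= b by apply: ge_sup => //; exists a.
have [|d d0 H] := Ploc (sup S); first by rewrite ac.
have [s [/andP[sa sb] Ps] cs] := sup_adherent d0 hS.
have sc : s <= sup S by apply: ub_le_sup; [exists b|split => //; rewrite sa].
pose u := Num.min b (sup S + d / 2).
have ub : u <= b by rewrite ge_min lexx.
have cu : sup S <= u by rewrite le_min cb; lra.
have ud : u < sup S + d by rewrite gt_min; apply/orP; right; lra.
have Pu : P a u by apply: Ptr Ps _; apply: H.
have uc : u <= sup S.
  by apply: ub_le_sup; [exists b|split => //; rewrite ub andbT; lra].
have -> : b = u; last by [].
by move: uc; rewrite /u /Num.min; case: ifP => // _; lra.
Qed.

Lemma normr_snorm (R : realType) : @continuous_seminorm R R^o (fun x : R => `|x|).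
Proof. by split=> [|a x|x]; [exact: ler_normD|exact: normrM|exact: norm_continuous]. Qed.

Section CurveDerivative.
Context {R : realType} {E : tvsType R}.

(** The derivative is_dderiv in the direction 1, for curves defined on R rather
    than on R^o. *)
Definition cder (f : R -> E) (t : R) (l : E) : Prop :=
  h^-1 *: (f (t + h) - f t) @[h --> (0 : R)^'] --> l.

Lemma cder_dderiv (f : R -> E) t l : is_dderiv (f : R^o -> E) t 1 l <-> cder f t l.
Proof.
rewrite /is_dderiv /cder.
suff -> : (fun h : R => h^-1 *: ((f : R^o -> E) (t + h *: (1 : R^o)) - f t)) =
          (fun h : R => h^-1 *: (f (t + h) - f t)) by [].
by apply/funext => h; rewrite (_ : h *: (1 : R^o) = h)//; exact: mulr1.
Qed.

Lemma cderD f g t l m : cder f t l -> cder g t m -> cder (fun u => f u + g u) t (l + m).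
Proof.
move=> fl gm.
have H : (fun h => h^-1 *: (f (t + h) - f t) + h^-1 *: (g (t + h) - g t))
    @ (0 : R)^' --> l + m by exact: tvs_cvgD.
move: H; apply: cvg_trans; apply: near_eq_cvg; near=> h.
by rewrite -scalerDr; congr (_ *: _); rewrite opprD addrACA.
Unshelve. all: by end_near. Qed.

Lemma cderZ f t l (a : R) : cder f t l -> cder (fun u => a *: f u) t (a *: l).
Proof.
move=> fl.
have H : (fun h => a *: (h^-1 *: (f (t + h) - f t))) @ (0 : R)^' --> a *: l.
  by apply: tvs_cvgZ => //; exact: cvg_cst.
move: H; apply: cvg_trans; apply: near_eq_cvg; near=> h.
by rewrite -scalerBr !scalerA mulrC.
Unshelve. all: by end_near. Qed.

Lemma cderB f g t l m : cder f t l -> cder g t m -> cder (fun u => f u - g u) t (l - m).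
Proof.
move=> fl gm.
have -> : (fun u => f u - g u) = (fun u => f u + -1 *: g u).
  by apply/funext => u; rewrite scaleN1r.
by rewrite -(scaleN1r m); apply: cderD => //; exact: cderZ.
Qed.

Lemma cder_line (x v : E) t : cder (fun h : R => x + h *: v) t v.
Proof.
apply: (@cvg_trans _ ((fun=> v) @ (0 : R)^')); last exact: cvg_cst.
apply: near_eq_cvg; near=> h; have h0 : h != 0 by near: h; exact: nbhs_dnbhs_neq.
by rewrite opprD addrACA subrr add0r -scalerBl [t + h]addrC addrK scalerA mulVf// scale1r.
Unshelve. all: by end_near. Qed.

Lemma cder_cst (x : E) t : cder (fun=> x) t 0.
Proof.
apply: (@cvg_trans _ ((fun=> 0) @ (0 : R)^')); last exact: cvg_cst.
by apply: near_eq_cvg; near=> h; rewrite subrr scaler0.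
Unshelve. all: by end_near. Qed.

Lemma cder_unique f t l l' : hausdorff_space E -> cder f t l -> cder f t l' -> l = l'.
Proof. by move=> hE; exact: tvs_cvg_unique. Qed.

(** Differentiability at t also controls the increments between two points on
    either side of t, and such increments can be added up. *)
Lemma cder_straddle (p : E -> R) f t l e : continuous_seminorm p -> 0 < e ->
  cder f t l -> exists2 d, 0 < d & forall s u, s <= t -> t <= u ->
    t - d < s -> u < t + d -> p (f u - f s - (u - s) *: l) <= e * (u - s).
Proof.
move=> sp e0 /(cvg_snorm_lt sp e0)[d /= d0 H].
have K v : `|v - t| < d -> p (f v - f t - (v - t) *: l) <= e * `|v - t|.
  move=> vd; have [->|vt] := eqVneq v t.
    by rewrite !subrr scale0r subrr snorm0// normr0 mulr0.
  have vt0 : v - t != 0 by rewrite subr_eq0.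
  have := H (v - t); rewrite /= sub0r normrN subr_eq0 => /(_ vd vt).
  rewrite (addrC t) subrK => /ltW; rewrite -(@ler_pM2r _ `|v - t|) ?normr_gt0//.
  by rewrite mulrC -snormZ// scalerBr scalerA mulfV// scale1r.
exists d => // s u st tu ts us.
have -> : f u - f s - (u - s) *: l =
    (f u - f t - (u - t) *: l) - (f s - f t - (s - t) *: l).
  rewrite [u - s](_ : _ = (u - t) - (s - t)); last by ring.
  have -> : f u - f s = (f u - f t) - (f s - f t) by rewrite opprB addrA subrK.
  by rewrite scalerBl; exact: subrACA.
apply: le_trans (snormB sp _ _) _.
have ut : `|u - t| = u - t by rewrite ger0_norm//; lra.
have ts' : `|s - t| = t - s by rewrite ler0_norm; lra.
have Ku : p (f u - f t - (u - t) *: l) <= e * (u - t).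
  by rewrite -[X in e * X]ut; apply: K; rewrite ut; lra.
have Ks : p (f s - f t - (s - t) *: l) <= e * (t - s).
  by rewrite -ts'; apply: K; rewrite ts'; lra.
rewrite (le_trans (lerD Ku Ks))//.
by rewrite -mulrDr ler_pM2l//; lra.
Qed.

End CurveDerivative.

(** A seminorm need not be differentiable along the curve, so that the
    increments are estimated by cder_straddle and added up by interval_chain. *)
Lemma mean_value {R : realType} {E : tvsType R} (p : E -> R)
    (f f' : R -> E) (g g' : R -> R) a b :
  continuous_seminorm p -> a <= b ->
  (forall t, a <= t <= b -> cder f t (f' t)) ->
  (forall t, a <= t <= b -> @cder R R^o g t (g' t)) ->
  (forall t, a <= t <= b -> p (f' t) <= g' t) ->
  p (f b - f a) <= g b - g a.
Proof.
move=> sp ab fd gd fg; apply/ler_addgt0Pr => e0 e0_gt0.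
have ba0 : 0 <= b - a by lra.
have [e e_gt0 ee0] : exists2 e, 0 < e & (e + e) * (b - a) <= e0.
  exists (e0 / (2 * (b - a + 1))); first by rewrite divr_gt0//; lra.
  rewrite -mulrDl -mulrA mulrC -mulrA ler_pdivrMl; nra.
apply: le_trans (_ : _ <= g b - g a + (e + e) * (b - a)) _; last by rewrite lerD2l.
move: b ab ba0 fd gd fg ee0 => /=.
pose P s u := p (f u - f s) <= g u - g s + (e + e) * (u - s).
move=> b ab _ fd gd fg _; apply: (@interval_chain _ P a b ab).
  move=> s t u; rewrite /P => st tu.
  rewrite (_ : f u - f s = (f u - f t) + (f t - f s)); last by rewrite addrA subrK.
  by apply: le_trans (snormD sp _ _) _; lra.
move=> t tab; have [d d0 H] := cder_straddle sp e_gt0 (fd _ tab).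
have [d' d'0 H'] := cder_straddle (@normr_snorm R) e_gt0 (gd _ tab).
exists (Num.min d d'); first by rewrite lt_min d0.
move=> s u sa st tu ub ts us.
have [dm d'm] : Num.min d d' <= d /\ Num.min d d' <= d'.
  by rewrite !ge_min !lexx orbT.
have {}H : p (f u - f s - (u - s) *: f' t) <= e * (u - s) by apply: H; lra.
have {H'} : `|g u - g s - (u - s) * g' t| <= e * (u - s) by apply: H'; lra.
rewrite ler_norml => /andP[H' _].
have := snormD sp (f u - f s - (u - s) *: f' t) ((u - s) *: f' t).
rewrite subrK snormZ// ger0_norm; last lra.
have : (u - s) * p (f' t) <= (u - s) * g' t by rewrite ler_wpM2l ?fg//; lra.
by rewrite /P; nra.
Qed.

(** * Strict differentiability *)

Lemma within_nbhsP {T U : topologicalType} (A : set T) (f : T -> U) x : nbhs x A ->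
  {within A, continuous f} -> {for x, continuous f}.
Proof.
move=> nA /subspace_continuousP fA B fB.
have := fA x (nbhs_singleton nA) B fB; rewrite /within /= /nbhs /= => H.
by apply: filterS2 nA H => y Ay; apply.
Qed.

Lemma pair_fst_cvg {T U : topologicalType} (x : T) (y : U) :
  (fun q : T * U => q.1) @ (x, y) --> x.
Proof. exact: cvg_fst. Qed.

Lemma pair_snd_cvg {T U : topologicalType} (x : T) (y : U) :
  (fun q : T * U => q.2) @ (x, y) --> y.
Proof. exact: cvg_snd. Qed.

Arguments pair_fst_cvg {T U} x y.
Arguments pair_snd_cvg {T U} x y.

Lemma cvg_prod1 {T U V : Type} {F : set_system T} {FF : Filter F}
    {G : set_system U} {H : set_system V} (f : T -> U * V) :
  fst \o f @ F --> G -> snd \o f @ F --> H -> f @ F --> filter_prod G H.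
Proof.
move=> fG fH A [[B C] /= [GB HC] BC].
have nB : F ((fst \o f) @^-1` B) := fG _ GB.
have nC : F ((snd \o f) @^-1` C) := fH _ HC.
apply: (@filterS2 _ F FF _ _ (f @^-1` A) _ nB nC) => x Bx Cx; exact: BC.
Qed.

Lemma cvg_dnbhs0_mulr {R : realType} (a : R) : a != 0 ->
  (fun h => h * a) @ (0 : R)^' --> (0 : R)^'.
Proof.
move=> a0 A [d /= d0 H]; have na : 0 < `|a| by rewrite normr_gt0.
exists (d / `|a|); first by rewrite /= divr_gt0.
move=> h /=; rewrite sub0r normrN ltr_pdivlMr// => hd h0.
by apply: H; rewrite /= ?sub0r ?normrN ?normrM// mulf_neq0.
Qed.

Section StrictDifferentiability.
Context {R : realType} {P : topologicalType} {E F : tvsType R}.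

Definition diffquot (f : P -> E -> F) (q : (P * E) * (R * E)) : F :=
  q.2.1^-1 *: (f q.1.1 (q.1.2 + q.2.1 *: q.2.2) - f q.1.1 q.1.2).

Definition diffnbhs (p : P) (x v : E) : set_system ((P * E) * (R * E)) :=
  filter_prod (filter_prod (nbhs p) (nbhs x)) (filter_prod (0 : R)^' (nbhs v)).

(** Strict differentiability of f p at x in the direction v, locally uniformly
    in the parameter p, the direction being allowed to vary as well.  It holds
    for C^1 maps and, in contrast to the existence of directional derivatives,
    is inherited by compositions without any further hypothesis. *)
Definition sdiff (f : P -> E -> F) (p : P) (x v : E) (l : F) : Prop :=
  diffquot f @ diffnbhs p x v --> l.

Global Instance diffnbhs_filter p x v : ProperFilter (diffnbhs p x v).
Proof. rewrite /diffnbhs; apply: filter_prod_proper. Qed.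

Lemma diffnbhs_param p x v : (fun q => q.1.1) @ diffnbhs p x v --> p.
Proof. exact: (cvg_comp _ _ cvg_fst cvg_fst). Qed.

Lemma diffnbhs_point p x v : (fun q => q.1.2) @ diffnbhs p x v --> x.
Proof. exact: (cvg_comp _ _ cvg_fst cvg_snd). Qed.

Lemma diffnbhs_step p x v : (fun q => q.2.1) @ diffnbhs p x v --> (0 : R)^'.
Proof. exact: (cvg_comp _ _ cvg_snd cvg_fst). Qed.

Lemma diffnbhs_step0 p x v : (fun q => q.2.1) @ diffnbhs p x v --> (0 : R).
Proof.
by apply: cvg_trans (@diffnbhs_step p x v) _; apply: cvg_within.
Qed.

Lemma diffnbhs_neq0 p x v : \forall q \near diffnbhs p x v, q.2.1 != 0.
Proof.
apply: (@diffnbhs_step p x v [set h | h != 0]).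
exact: (nbhs_dnbhs_neq (0 : R)).
Qed.

Lemma diffnbhs_dir p x v : (fun q => q.2.2) @ diffnbhs p x v --> v.
Proof. exact: (cvg_comp _ _ cvg_snd cvg_snd). Qed.

Lemma diffnbhs_move p x v : (fun q => q.1.2 + q.2.1 *: q.2.2) @ diffnbhs p x v --> x.
Proof.
rewrite -[X in _ --> X]addr0 -[X in _ --> _ + X](scale0r v).
apply: tvs_cvgD; first exact: diffnbhs_point.
by apply: tvs_cvgZ; [exact: diffnbhs_step0|exact: diffnbhs_dir].
Qed.

Lemma cvg_diffnbhs {T : Type} {G : set_system T} {GF : Filter G}
    (a : T -> P) (y : T -> E) (h : T -> R) (w : T -> E) p x v :
  a @ G --> p -> y @ G --> x -> h @ G --> (0 : R)^' -> w @ G --> v ->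
  (fun s => ((a s, y s), (h s, w s))) @ G --> diffnbhs p x v.
Proof. by move=> ap yx h0 wv; do 2 apply: cvg_prod1. Qed.

Lemma cvg_diffnbhs_cst p x v :
  (fun h : R => ((p, x), (h, v))) @ (0 : R)^' --> diffnbhs p x v.
Proof.
by apply: cvg_diffnbhs; [exact: cvg_cst|exact: cvg_cst|exact: cvg_id|exact: cvg_cst].
Qed.

Lemma sdiff_near (f f' : P -> E -> F) p x v l :
  (\forall q \near (p, x), f q.1 q.2 = f' q.1 q.2) -> sdiff f p x v l ->
  sdiff f' p x v l.
Proof.
move=> ff'; apply: cvg_trans; apply: near_eq_cvg.
have H0 : \forall q \near diffnbhs p x v, f q.1.1 q.1.2 = f' q.1.1 q.1.2.
  exact: (cvg_prod1 (@diffnbhs_param p x v) (@diffnbhs_point p x v) ff').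
have H1 : \forall q \near diffnbhs p x v,
    f q.1.1 (q.1.2 + q.2.1 *: q.2.2) = f' q.1.1 (q.1.2 + q.2.1 *: q.2.2).
  exact: (cvg_prod1 (f := fun q : (P * E) * (R * E) =>
    (q.1.1, q.1.2 + q.2.1 *: q.2.2)) (@diffnbhs_param p x v) (@diffnbhs_move p x v) ff').
by near=> q; rewrite /diffquot (near H0 q)// (near H1 q).
Unshelve. all: by end_near. Qed.

Lemma sdiff_curve (f : P -> E -> F) p x v l (c : R -> E) t :
  sdiff f p x v l -> c t = x -> cder c t v -> cder (f p \o c) t l.
Proof.
move=> fl ctx cv.
pose Th h : (P * E) * (R * E) := ((p, x), (h, h^-1 *: (c (t + h) - c t))).
have ThF : Th @ (0 : R)^' --> diffnbhs p x v.
  by apply: cvg_diffnbhs; [exact: cvg_cst|exact: cvg_cst|exact: cvg_id|exact: cv].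
apply: cvg_trans (cvg_comp _ _ ThF fl); apply: near_eq_cvg.
near=> h; have h0 : h != 0 by near: h; exact: nbhs_dnbhs_neq.
by rewrite /= /diffquot /= -ctx scalerA mulfV// scale1r [c t + _]addrC subrK.
Unshelve. all: by end_near. Qed.

Lemma sdiff_dderiv (f : P -> E -> F) p x v l : sdiff f p x v l -> is_dderiv (f p) x v l.
Proof.
move=> fl; have := sdiff_curve fl _ (@cder_line _ _ x v 0).
rewrite scale0r addr0 => /(_ erefl).
rewrite /cder /is_dderiv /= scale0r addr0.
by under eq_fun do rewrite add0r.
Qed.

Lemma dderivP (f : E -> F) x v l : hausdorff_space F -> is_dderiv f x v l ->
  dderiv f x v = l.
Proof.
move=> hF fl; rewrite /dderiv; case: xgetP => [y _ fy|/(_ l)//].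
exact: tvs_cvg_unique hF fy fl.
Qed.

Lemma sdiffE (f : P -> E -> F) p x v l : hausdorff_space F -> sdiff f p x v l ->
  dderiv (f p) x v = l.
Proof. by move=> hF /sdiff_dderiv; exact: dderivP. Qed.

(** The increment along v + w is split into the increments along w and, from
    the displaced point, along v; strictness is what makes the second one
    converge. *)
Lemma sdiffD (f : P -> E -> F) p x v w l m n : hausdorff_space F ->
  sdiff f p x v l -> sdiff f p x w m -> sdiff f p x (v + w) n -> n = l + m.
Proof.
move=> hF fl fm fn.
pose Th u h : (P * E) * (R * E) := ((p, x), (h, u)).
have ThF u : Th u @ (0 : R)^' --> diffnbhs p x u by exact: cvg_diffnbhs_cst.
pose Th2 h : (P * E) * (R * E) := ((p, x + h *: w), (h, v)).
have Th2F : Th2 @ (0 : R)^' --> diffnbhs p x v.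
  apply: cvg_diffnbhs; [exact: cvg_cst| |exact: cvg_id|exact: cvg_cst].
  exact: (cvg_comp _ _ (ThF w) (@diffnbhs_move p x w)).
have H1 := cvg_comp _ _ (ThF (v + w)) fn.
have H2 : (fun h => diffquot f (Th2 h) + diffquot f (Th w h)) @ (0 : R)^' --> l + m.
  by apply: tvs_cvgD; [exact: (cvg_comp _ _ Th2F fl)|exact: (cvg_comp _ _ (ThF w) fm)].
apply: (tvs_cvg_unique hF H1); move: H2; apply: cvg_trans.
apply: (@near_eq_cvg _ _ (0 : R)^').
near=> h; rewrite /= /diffquot /= -scalerDr; congr (_ *: _).
have -> : x + h *: w + h *: v = x + h *: (v + w).
  by rewrite -addrA -scalerDr (addrC w).
by rewrite addrA subrK.
Unshelve. all: by end_near. Qed.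

Lemma sdiffZ (f : P -> E -> F) p x v l a n : hausdorff_space F ->
  sdiff f p x v l -> sdiff f p x (a *: v) n -> n = a *: l.
Proof.
move=> hF fl fn.
pose Th u h : (P * E) * (R * E) := ((p, x), (h, u)).
have ThF u : Th u @ (0 : R)^' --> diffnbhs p x u by exact: cvg_diffnbhs_cst.
have H1 := cvg_comp _ _ (ThF (a *: v)) fn.
have [a0|a0] := eqVneq a 0.
  rewrite a0 scale0r; apply: (tvs_cvg_unique hF H1).
  apply: (@cvg_trans _ ((fun=> 0) @ (0 : R)^')); last exact: cvg_cst.
  apply: near_eq_cvg; near=> h.
  by rewrite /= /diffquot /= a0 scale0r scaler0 addr0 subrr scaler0.
have Th2F : (fun h => ((p, x), (h * a, v))) @ (0 : R)^' --> diffnbhs p x v.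
  apply: cvg_diffnbhs; [exact: cvg_cst|exact: cvg_cst| |exact: cvg_cst].
  exact: cvg_dnbhs0_mulr.
have H2 : (fun h => a *: diffquot f ((p, x), (h * a, v))) @ (0 : R)^' --> a *: l.
  by apply: tvs_cvgZ; [exact: cvg_cst|exact: (cvg_comp _ _ Th2F fl)].
apply: (tvs_cvg_unique hF H1); move: H2; apply: cvg_trans.
apply: (@near_eq_cvg _ _ (0 : R)^').
near=> h; rewrite /= /diffquot /= scalerA scalerA; congr (_ *: _).
by rewrite invfM mulrCA mulfV// mulr1.
Unshelve. all: by end_near. Qed.

(** The difference quotients near (p, x, v) are close to l; so are the
    derivatives, by letting the step tend to 0 while p and v stay fixed. *)
Lemma sdiff_cont (f : P -> E -> F) p x v (L : P -> E -> F) l : hausdorff_space F ->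
  sdiff f p x v l ->
  (\forall q \near (p, v), is_dderiv (f q.1) x q.2 (L q.1 q.2)) ->
  L q.1 q.2 @[q --> (p, v)] --> l.
Proof.
move=> hF fl fL; apply/cvg_snormP => s sn e e0.
have e20 : 0 < e / 2 by lra.
have [[A B] /= [[[A1 A2] /= [A1p A2x] A12] [[B1 B2] /= [B10 B2v] B12]] H] :=
  cvg_snorm_lt sn e20 fl.
have nA : \forall q \near (p, v), A1 q.1 /\ B2 q.2 by exists (A1, B2).
apply: filterS2 nA fL => -[p' v'] /= [Ap Bv] fL'.
apply: (@le_lt_trans _ _ (e / 2)); last lra.
have H1 : s (h^-1 *: (f p' (x + h *: v') - f p' x) - l) @[h --> 0^'] --> s (L p' v' - l).
  apply: (@cvg_comp _ _ _ _ (fun u => s (u - l)) _ (nbhs (L p' v'))) => //.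
  apply: continuous_comp; last exact: snorm_cont.
  by apply: tvs_cvgB; [exact: cvg_id|exact: cvg_cst].
apply: (cvgr_to_le H1).
have : \forall h \near (0 : R)^', B1 h by [].
apply: filterS => h Bh; apply: ltW.
apply: (H ((p', x), (h, v'))); split; last exact: B12.
by apply: A12; split => //=; exact: nbhs_singleton.
Qed.

End StrictDifferentiability.

(** The difference quotient of f is the varying direction in that of g, which is
    the reason why directions may vary in sdiff. *)
Lemma sdiff_comp {R : realType} {P : topologicalType} {E F H : tvsType R}
    (f : P -> E -> F) (g : P -> F -> H) p x z v l m :
  f q.1 q.2 @[q --> (p, x)] --> z -> sdiff f p x v l -> sdiff g p z l m ->
  sdiff (fun p x => g p (f p x)) p x v m.
Proof.
move=> fz fl gm.
pose Th (q : (P * E) * (R * E)) := ((q.1.1, f q.1.1 q.1.2), (q.2.1, diffquot f q)).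
have ThF : Th @ diffnbhs p x v --> diffnbhs p z l.
  apply: cvg_diffnbhs; [exact: diffnbhs_param| |exact: diffnbhs_step|exact: fl].
  exact: (cvg_comp _ _ cvg_fst fz).
move: (cvg_comp _ _ ThF gm); apply: cvg_trans.
apply: (@near_eq_cvg _ _ (diffnbhs p x v)).
near=> q; have q0 : q.2.1 != 0 by near: q; exact: diffnbhs_neq0.
rewrite /= /diffquot /= scalerA mulfV// scale1r.
by rewrite [f q.1.1 q.1.2 + _]addrC subrK.
Unshelve. all: by end_near. Qed.

(** The multiplication is differentiated in one factor, the other one becoming a
    parameter; the derivative is then continuous in both. *)
Lemma sdiff_partial1 {R : realType} {P : topologicalType} {E F H : tvsType R}
    (m : E * F -> H) (b : P -> F) p x v l :
  {for p, continuous b} -> sdiff (fun _ : P => m) p (x, b p) (v, 0) l ->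
  sdiff (fun p x => m (x, b p)) p x v l.
Proof.
move=> bp ml.
pose Th (q : (P * E) * (R * E)) : (P * (E * F)) * (R * (E * F)) :=
  ((q.1.1, (q.1.2, b q.1.1)), (q.2.1, (q.2.2, 0))).
have ThF : Th @ diffnbhs p x v --> diffnbhs p (x, b p) (v, 0).
  apply: cvg_diffnbhs; [exact: diffnbhs_param| |exact: diffnbhs_step|].
    apply: cvg_pair; first exact: diffnbhs_point.
    exact: (cvg_comp _ _ (@diffnbhs_param _ _ _ p x v) bp).
  by apply: cvg_pair; [exact: diffnbhs_dir|exact: cvg_cst].
move: (cvg_comp _ _ ThF ml); apply: cvg_trans.
apply: (@near_eq_cvg _ _ (diffnbhs p x v)).
near=> q; rewrite /= /diffquot /=; congr (_ *: (m _ - _)).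
by congr pair; rewrite /= scaler0 addr0.
Unshelve. all: by end_near. Qed.

Lemma sdiff_partial2 {R : realType} {P : topologicalType} {E F H : tvsType R}
    (m : E * F -> H) (b : P -> E) p x v l :
  {for p, continuous b} -> sdiff (fun _ : P => m) p (b p, x) (0, v) l ->
  sdiff (fun p x => m (b p, x)) p x v l.
Proof.
move=> bp ml.
pose Th (q : (P * F) * (R * F)) : (P * (E * F)) * (R * (E * F)) :=
  ((q.1.1, (b q.1.1, q.1.2)), (q.2.1, (0, q.2.2))).
have ThF : Th @ diffnbhs p x v --> diffnbhs p (b p, x) (0, v).
  apply: cvg_diffnbhs; [exact: diffnbhs_param| |exact: diffnbhs_step|].
    apply: cvg_pair; last exact: diffnbhs_point.
    exact: (cvg_comp _ _ (@diffnbhs_param _ _ _ p x v) bp).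
  by apply: cvg_pair; [exact: cvg_cst|exact: diffnbhs_dir].
move: (cvg_comp _ _ ThF ml); apply: cvg_trans.
apply: (@near_eq_cvg _ _ (diffnbhs p x v)).
near=> q; rewrite /= /diffquot /=; congr (_ *: (m _ - _)).
by congr pair; rewrite /= scaler0 addr0.
Unshelve. all: by end_near. Qed.

Lemma ptws_cvg {I : Type} {V : topologicalType} (F : set_system (I -> V)) (f : I -> V) :
  Filter F -> (forall i, (fun g => g i) @ F --> f i) -> {ptws, F --> f}.
Proof.
move=> FF H; apply/cvg_sup => i; rewrite cvg_image; last first.
  by rewrite eqEsubset; split=> v // _; exists (cst v).
move=> W /H Q; exists (@^~ i @^-1` W) => //.
by rewrite eqEsubset; split => [j [? + <-//]|j Wj]; exists (fun _ => j).
Qed.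

Section C1.
Context {R : realType} {E F : tvsType R}.
Variables (U : set E) (f : E -> F).
Hypotheses (oU : open U) (fC1 : Ck_on 1 U f).

Lemma C1_dderiv x v : U x -> is_dderiv f x v (dderiv f x v).
Proof.
move=> Ux; rewrite /dderiv; case: xgetP => [y _ //|].
by have [l fl] := fC1.1 [::] v x isT Ux => /(_ l).
Qed.

Lemma C1_dcont x v : U x -> {for (x, v), continuous (fun q => dderiv f q.1 q.2)}.
Proof.
move=> Ux.
have nUT : nbhs (x, (fun=> v) : {ptws 'I_1 -> E}) (U `*` setT).
  by exists (U, setT) => //; split; [exact: open_nbhs_nbhs|exact: filterT].
have /= H := within_nbhsP nUT (fC1.2 1%N isT).
have [a E1] : exists a, enum 'I_1 = [:: a].
  by case: (enum 'I_1) (size_enum_ord 1) => [|a []] // _; exists a.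
rewrite E1 /= in H.
have G : (fun q : E * E => (q.1, (fun=> q.2) : {ptws 'I_1 -> E})) @ (x, v) -->
    (x, (fun=> v) : {ptws 'I_1 -> E}).
  apply: cvg_prod1; first exact: cvg_fst.
  by apply: ptws_cvg => t /=; exact: cvg_snd.
exact: (cvg_comp _ _ G H).
Qed.

(** The increment of f along h w is compared with h times the derivative at
    (x, v) by the mean value theorem on the segment from y to y + h w, which
    lies in a small neighbourhood of x. *)
Lemma C1_sdiff {P : topologicalType} (p : P) x v : U x ->
  sdiff (fun _ => f) p x v (dderiv f x v).
Proof.
move=> Ux; apply/cvg_snormP => s sn e e0.
have nU : nbhs x U by exact: open_nbhs_nbhs.
have e20 : 0 < e / 2 by lra.
have [[A B] /= [Ax Bv] AB] := cvg_snorm_lt sn e20 (@C1_dcont x v Ux).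
have [r rn rA] := nbhs_snorm (filterI Ax nU).
have core y h w : h != 0 -> B w -> r (y - x) < 1 / 2 -> r (y + h *: w - x) < 1 / 2 ->
    s (h^-1 *: (f (y + h *: w) - f y) - dderiv f x v) < e; last first.
  near=> q; apply: core; near: q.
  - exact: diffnbhs_neq0.
  - exact: (@diffnbhs_dir _ _ _ p x v).
  - by apply: cvg_snorm_lt; [exact: rn|lra|exact: diffnbhs_point].
  - by apply: cvg_snorm_lt; [exact: rn|lra|exact: diffnbhs_move].
move=> h0 Bw ry rm.
have seg t : 0 <= t <= 1 -> (A `&` U) (y + t *: (h *: w)).
  move=> /andP[t0 t1]; apply: rA => /=.
  have -> : y + t *: (h *: w) - x = t *: (y + h *: w - x) + (1 - t) *: (y - x).
    rewrite ![y + _ - x]addrAC scalerDr scalerBl scale1r.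
    by rewrite [RHS]addrC addrA subrK.
  apply: le_lt_trans (snormD rn _ _) _; rewrite !(snormZ rn) !ger0_norm ?subr_ge0//.
  have H1 := ler_wpM2l t0 (ltW rm); have t1' : 0 <= 1 - t by lra.
  by have H2 := ler_wpM2l t1' (ltW ry); lra.
have sl t : 0 <= t <= 1 ->
    s (h *: (dderiv f (y + t *: (h *: w)) w - dderiv f x v)) <= `|h| * (e / 2).
  move=> /seg[At _]; rewrite snormZ// ler_wpM2l//; apply: ltW.
  exact: (AB (y + t *: (h *: w), w)).
have cf t : 0 <= t <= 1 ->
    cder (fun t => f (y + t *: (h *: w)) - (t * h) *: dderiv f x v) t
      (h *: (dderiv f (y + t *: (h *: w)) w - dderiv f x v)).
  move=> /seg[_ Ut]; have fd := @C1_dderiv _ w Ut.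
  have H : (fun k => h *: ((k * h)^-1 *: (f (y + t *: (h *: w) + (k * h) *: w) -
      f (y + t *: (h *: w))) - dderiv f x v)) @ (0 : R)^' -->
      h *: (dderiv f (y + t *: (h *: w)) w - dderiv f x v).
    apply: tvs_cvgZ; first exact: cvg_cst.
    apply: tvs_cvgB; last exact: cvg_cst.
    exact: (cvg_comp _ _ (cvg_dnbhs0_mulr h0) fd).
  move: H; apply: cvg_trans; apply: (@near_eq_cvg _ _ (0 : R)^').
  near=> k; have k0 : k != 0 by near: k; exact: nbhs_dnbhs_neq.
  have -> : y + (t + k) *: (h *: w) = y + t *: (h *: w) + (k * h) *: w.
    by rewrite scalerDl addrA (scalerA k).
  rewrite subrACA -scalerBl [X in X *: dderiv f x v](_ : _ = k * h); last by ring.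
  rewrite !scalerBr !scalerA; congr (_ *: _ - _ *: _ - _ *: _); last by field.
  - by rewrite invfM mulrCA mulfV// mulr1.
  - by rewrite invfM mulrCA mulfV// mulr1.
have cg t : 0 <= t <= 1 -> @cder _ R^o (fun t => `|h| * (e / 2) * t) t (`|h| * (e / 2)).
  move=> _; apply: (@cvg_trans _ ((fun=> `|h| * (e / 2) : R^o) @ (0 : R)^')); last exact: cvg_cst.
  apply: near_eq_cvg; near=> k.
  have k0 : k != 0 by near: k; exact: nbhs_dnbhs_neq.
  by rewrite -mulrBr (addrC t) addrK /GRing.scale /=; field.
have := mean_value sn ler01 cf cg sl.
rewrite scale0r scale1r mul0r scale0r mul1r addr0 subr0 mulr1 mulr0 subr0.
move=> H; apply: le_lt_trans (_ : e / 2 < _); last lra.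
rewrite -(@ler_pM2l _ `|h|) ?normr_gt0// -snormZ// scalerBr scalerA mulfV// scale1r.
by rewrite addrAC.
Unshelve. all: by end_near. Qed.

End C1.

(** * Differentiability of maps of a Lie group *)

Section Charts.
Context {R : realType} {E : tvsType R} {G : topologicalType}.
Variable c : chart E G.

Lemma chart_dom_nbhs g : chart_dom c g -> nbhs g (chart_dom c).
Proof. by move=> cg; apply: open_nbhs_nbhs; split => //; exact: chart_dom_open. Qed.

Lemma chart_cod_nbhs u : chart_cod c u -> nbhs u (chart_cod c).
Proof. by move=> cg; apply: open_nbhs_nbhs; split => //; exact: chart_cod_open. Qed.

Lemma chart_cont g : chart_dom c g -> {for g, continuous c}.
Proof.
by move=> /chart_dom_nbhs cg; exact: within_nbhsP cg (@chart_fun_cont _ _ _ c).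
Qed.

Lemma chart_invc u : chart_cod c u -> {for u, continuous (chart_inv c)}.
Proof.
by move=> /chart_cod_nbhs cg; exact: within_nbhsP cg (@chart_inv_cont _ _ _ c).
Qed.

Lemma cvg_chart_inv g : chart_dom c g -> chart_inv c u @[u --> c g] --> g.
Proof.
by move=> cg; rewrite -[X in _ --> X](chart_funK cg); apply/chart_invc/chart_funP.
Qed.

End Charts.

Section GroupDifferentiability.
Context {R : realType} {E : tvsType R} {G : lieGroupType E}.
Implicit Types a b c : chart E G.

Let hE : hausdorff_space E := @model_hausdorff R E G.

Lemma cvg_mulg {T} {F : set_system T} {FF : Filter F} (f h : T -> G) (x y : G) :
  f @ F --> x -> h @ F --> y -> (fun t => (f t * h t)%g) @ F --> (x * y)%g.
Proof.
move=> fx hy; exact: (cvg_comp2 fx hy (@lie_mul_cont R E G (x, y))).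
Qed.

Lemma cvg_invg {T} {F : set_system T} {FF : Filter F} (f : T -> G) (x : G) :
  f @ F --> x -> (fun t => (f t)^-1%g) @ F --> x^-1%g.
Proof. by move=> fx; exact: (cvg_comp _ _ fx (@lie_inv_cont R E G x)). Qed.

(** Strict differentiability of maps f p : G -> G, expressed in a chart a around
    g and a chart b around f p g. *)
Definition gsdiff {P : topologicalType} a b (f : P -> G -> G) (p : P) (g : G)
    (v l : E) : Prop :=
  [/\ chart_dom a g, chart_dom b (f p g), f q.1 q.2 @[q --> (p, g)] --> f p g &
      sdiff (fun p u => b (f p (chart_inv a u))) p (a g) v l].

Lemma gsdiff_unique {P : topologicalType} a b (f : P -> G -> G) p g v l l' :
  gsdiff a b f p g v l -> gsdiff a b f p g v l' -> l = l'.
Proof. by move=> [_ _ _ fl] [_ _ _]; exact: tvs_cvg_unique. Qed.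

Lemma gsdiffD {P : topologicalType} a b (f : P -> G -> G) p g v w l m n :
  gsdiff a b f p g v l -> gsdiff a b f p g w m ->
  gsdiff a b f p g (v + w) n -> n = l + m.
Proof. by move=> [_ _ _ fl] [_ _ _ fm] [_ _ _]; exact: sdiffD. Qed.

Lemma gsdiffZ {P : topologicalType} a b (f : P -> G -> G) p g v l k n :
  gsdiff a b f p g v l -> gsdiff a b f p g (k *: v) n -> n = k *: l.
Proof. by move=> [_ _ _ fl] [_ _ _]; exact: sdiffZ. Qed.

Lemma cvg_inv_chart {P : topologicalType} a (f : P -> G -> G) (p : P) (g h : G) :
  chart_dom a g -> f q.1 q.2 @[q --> (p, g)] --> h ->
  f q.1 (chart_inv a q.2) @[q --> (p, a g)] --> h.
Proof.
move=> ag fh.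
have H : (fun q : P * E => (q.1, chart_inv a q.2)) @ (p, a g) --> (p, g).
  apply: cvg_prod1; first exact: cvg_fst.
  exact: (cvg_comp _ _ cvg_snd (cvg_chart_inv ag)).
exact: (cvg_comp _ _ H fh).
Qed.

Lemma gsdiff_comp {P : topologicalType} a b c (f f' : P -> G -> G) p g v l m :
  gsdiff a b f p g v l -> gsdiff b c f' p (f p g) l m ->
  gsdiff a c (fun p h => f' p (f p h)) p g v m.
Proof.
move=> [ag bf fc fl] [_ cf' f'c f'm]; split => //.
  have H : (fun q : P * G => (q.1, f q.1 q.2)) @ (p, g) --> (p, f p g).
    by apply: cvg_prod1; [exact: cvg_fst|exact: fc].
  exact: (cvg_comp _ _ H f'c).
have fc' := cvg_inv_chart ag fc.
have H := sdiff_comp (cvg_comp _ _ fc' (chart_cont bf)) fl f'm.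
apply: sdiff_near H; have := fc' _ (chart_dom_nbhs bf).
by apply: (@filterS _ (nbhs (p, a g))) => q /= bq; rewrite chart_funK.
Qed.

(** A change of charts is the identity of G read in two charts. *)
Lemma gsdiff_id {P : topologicalType} a b (p : P) g v :
  smooth_transition a b -> chart_dom a g -> chart_dom b g ->
  exists l, gsdiff a b (fun _ h => h) p g v l.
Proof.
move=> sab ag bg.
exists (dderiv (b \o chart_inv a) (a g) v); split => //; first exact: cvg_snd.
have oU : open (a @` (chart_dom a `&` chart_dom b)).
  rewrite openE => _ [h [ah bh] <-].
  have : nbhs (a h) (chart_cod a `&` (chart_inv a @^-1` chart_dom b)).
    apply: filterI; first by apply/chart_cod_nbhs/chart_funP.
    exact: (cvg_chart_inv ah (chart_dom_nbhs bh)).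
  apply: filterS => u [au bu]; exists (chart_inv a u); last exact: chart_invK.
  by split => //; exact: chart_invP.
apply: (C1_sdiff oU (sab 1%N)).
by exists g.
Qed.

Lemma gsdiff_id_same {P : topologicalType} a (p : P) g v : chart_dom a g ->
  gsdiff a a (fun _ h => h) p g v v.
Proof.
move=> ag; split => //; first exact: cvg_snd.
have H : sdiff (fun (_ : P) (u : E) => u) p (a g) v v.
  move: (@diffnbhs_dir _ _ _ p (a g) v); apply: cvg_trans.
  apply: (@near_eq_cvg _ _ (diffnbhs p (a g) v)); near=> q.
  have q0 : q.2.1 != 0 by near: q; exact: diffnbhs_neq0.
  by rewrite /diffquot [_ + _ *: _]addrC addrK scalerA mulVf// scale1r.
apply: sdiff_near H.
have : nbhs (a g) (chart_cod a) by apply/chart_cod_nbhs/chart_funP.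
move=> H; have : nbhs (p, a g) [set q | chart_cod a q.2] by exact: (pair_snd_cvg _ _ _ H).
by apply: (@filterS _ (nbhs (p, a g))) => q /= aq; rewrite chart_invK.
Unshelve. all: by end_near. Qed.

Lemma mul_chart_sdiff {P : topologicalType} a b c (p : P) g h v :
  atlas a -> atlas b -> atlas c -> chart_dom a g -> chart_dom b h ->
  chart_dom c (g * h)%g ->
  exists l, sdiff (fun (_ : P) (u : E * E) => c (chart_inv a u.1 * chart_inv b u.2)%g)
    p (a g, b h) v l.
Proof.
move=> aa ab ac ag bh cgh.
pose m (u : E * E) := c (chart_inv a u.1 * chart_inv b u.2)%g.
exists (dderiv m (a g, b h) v).
apply: (C1_sdiff _ (lie_mul_smooth _ _ _ aa ab ac 1%N)); last first.
  by split => /=; [exact: chart_funP|exact: chart_funP|rewrite !chart_funK].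
rewrite openE => -[u w] /= [au bu cu].
have nc : nbhs (u, w) [set q | chart_dom c (chart_inv a q.1 * chart_inv b q.2)%g].
  have H : (fun q : E * E => (chart_inv a q.1 * chart_inv b q.2)%g) @ (u, w) -->
      (chart_inv a u * chart_inv b w)%g.
    apply: cvg_mulg; first exact: (cvg_comp _ _ (pair_fst_cvg u w) (chart_invc au)).
    exact: (cvg_comp _ _ (pair_snd_cvg u w) (chart_invc bu)).
  exact: (H _ (chart_dom_nbhs cu)).
have na : nbhs (u, w) [set q | chart_cod a q.1].
  exact: (pair_fst_cvg _ _ _ (chart_cod_nbhs au)).
have nb : nbhs (u, w) [set q | chart_cod b q.2].
  exact: (pair_snd_cvg _ _ _ (chart_cod_nbhs bu)).
by apply: (@filterS3 _ (nbhs (u, w)) _ _ _ _ _ _ na nb nc) => q; split.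
Qed.

Lemma gsdiff_mulr {P : topologicalType} a c (r : P -> G) p g v :
  atlas a -> atlas c -> {for p, continuous r} -> chart_dom a g ->
  chart_dom c (g * r p)%g ->
  exists l, gsdiff a c (fun p h => h * r p)%g p g v l.
Proof.
move=> aa ac rp ag cg; pose b := chart_at (r p).
have br : chart_dom b (r p) by exact: chart_at_dom.
have [l fl] := mul_chart_sdiff p (v, 0) aa (chart_at_atlas (r p)) ac ag br cg.
exists l; split => //.
  by apply: cvg_mulg; [exact: cvg_snd|exact: (cvg_comp _ _ (pair_fst_cvg p g) rp)].
have bc : {for p, continuous (b \o r)} by exact: (cvg_comp _ _ rp (chart_cont br)).
apply: sdiff_near (sdiff_partial1 bc fl).
have := cvg_comp _ _ (pair_fst_cvg p (a g)) rp; move=> /(_ _ (chart_dom_nbhs br)).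
by apply: (@filterS _ (nbhs (p, a g))) => q /= bq; rewrite chart_funK.
Qed.

Lemma gsdiff_mull {P : topologicalType} b c (r : P -> G) p g v :
  atlas b -> atlas c -> {for p, continuous r} -> chart_dom b g ->
  chart_dom c (r p * g)%g ->
  exists l, gsdiff b c (fun p h => r p * h)%g p g v l.
Proof.
move=> ab ac rp bg cg; pose a := chart_at (r p).
have ar : chart_dom a (r p) by exact: chart_at_dom.
have [l fl] := mul_chart_sdiff p (0, v) (chart_at_atlas (r p)) ab ac ar bg cg.
exists l; split => //.
  by apply: cvg_mulg; [exact: (cvg_comp _ _ (pair_fst_cvg p g) rp)|exact: cvg_snd].
have ac' : {for p, continuous (a \o r)} by exact: (cvg_comp _ _ rp (chart_cont ar)).
apply: sdiff_near (sdiff_partial2 ac' fl).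
have := cvg_comp _ _ (pair_fst_cvg p (b g)) rp; move=> /(_ _ (chart_dom_nbhs ar)).
by apply: (@filterS _ (nbhs (p, b g))) => q /= bq; rewrite chart_funK.
Qed.

Lemma gsdiff_inv {P : topologicalType} a c (p : P) g v :
  atlas a -> atlas c -> chart_dom a g -> chart_dom c g^-1%g ->
  exists l, gsdiff a c (fun _ h => h^-1)%g p g v l.
Proof.
move=> aa ac ag cg.
exists (dderiv (fun u => c (chart_inv a u)^-1%g) (a g) v); split => //.
  by apply: cvg_invg; exact: cvg_snd.
apply: (C1_sdiff _ (lie_inv_smooth _ _ aa ac 1%N)); last first.
  by split => /=; [exact: chart_funP|rewrite !chart_funK].
rewrite openE => u [au cu].
have nc : nbhs u [set u | chart_dom c (chart_inv a u)^-1%g].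
  have H : (fun u : E => (chart_inv a u)^-1%g) @ u --> (chart_inv a u)^-1%g.
    by apply: cvg_invg; exact: chart_invc.
  exact: (H _ (chart_dom_nbhs cu)).
by apply: filterS2 (chart_cod_nbhs au) nc => w; split.
Qed.

End GroupDifferentiability.

(** * Conjugation and translation *)

Lemma cder_near {R : realType} {E : tvsType R} (f f' : R -> E) t l :
  (\forall s \near t, f s = f' s) -> cder f t l -> cder f' t l.
Proof.
move=> ff'; apply: cvg_trans; apply: near_eq_cvg.
have H : \forall h \near (0 : R)^', f (t + h) = f' (t + h).
  have : (fun h : R => t + h) @ (0 : R)^' --> t.
    rewrite -[X in _ --> X]addr0; apply: cvgD; first exact: cvg_cst.
    by apply: cvg_within_filter; exact: cvg_id.
  by move=> /(_ _ ff').
by near=> h; rewrite (near H h)// (nbhs_singleton ff').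
Unshelve. all: by end_near. Qed.

Lemma cder_pair {R : realType} {E F : tvsType R} (f : R -> E) (g : R -> F) t l m :
  cder f t l -> cder g t m -> @cder R (E * F)%type (fun s => (f s, g s)) t (l, m).
Proof. by move=> fl gm; exact: (cvg_pair fl gm). Qed.

Section ConjugateTranslation.
Context {R : realType} {E : tvsType R} {G : lieGroupType E}.

Let hE : hausdorff_space E := @model_hausdorff R E G.
Let c1 : chart E G := chart_at (1%g : G).
Let e1 : E := c1 (1%g : G).

(** One map carries all the calculus on G: conjugation by p.1^-1 followed by
    right translation by p.2, whose differential at 1 turns the logarithmic
    derivatives of two curves into the derivative of their quotient. *)
Definition conj_trans (p : G * G) (h : G) : G := (p.1^-1 * h * (p.1 * p.2))%g.

Definition dconj_trans (X : chart E G) (g n : G) (v : E) : E :=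
  dderiv (fun u => X (conj_trans (g, n) (chart_inv c1 u))) e1 v.

Lemma conj_trans1 g n : conj_trans (g, n) 1%g = n.
Proof. by rewrite /conj_trans /= mulg1 mulgA mulVg mul1g. Qed.

Section chart.
Variable X : chart E G.
Hypothesis hX : forall c, atlas c -> smooth_transition c X.

(** A left translation, a right translation and a change of charts are composed.
    The translations are read in charts of the atlas, and the change of charts
    leads to X, which is only assumed to be compatible with them. *)
Lemma dconj_trans_gsdiff g n v : chart_dom X n ->
  gsdiff c1 X conj_trans (g, n) 1%g v (dconj_trans X g n v).
Proof.
move=> Xn.
have c11 : chart_dom c1 (1%g : G) by exact: chart_at_dom.
have pc : {for (g, n), continuous (fun p : G * G => p.1^-1%g)}.
  by apply: cvg_invg; exact: pair_fst_cvg.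
have qc : {for (g, n), continuous (fun p : G * G => (p.1 * p.2)%g)}.
  by apply: cvg_mulg; [exact: pair_fst_cvg|exact: pair_snd_cvg].
pose b : chart E G := chart_at (g^-1 * 1)%g; pose d : chart E G := chart_at n.
have db : chart_dom b ((g, n).1^-1 * 1)%g by exact: chart_at_dom.
have dn : chart_dom d n by exact: chart_at_dom.
have dd : chart_dom d ((g, n).1^-1 * 1 * ((g, n).1 * (g, n).2))%g.
  by rewrite -/(conj_trans (g, n) 1%g) conj_trans1.
have [l1 H1] := @gsdiff_mull _ _ _ _ c1 b (fun p : G * G => p.1^-1%g) (g, n) 1%g v
  (chart_at_atlas _) (chart_at_atlas _) pc c11 db.
have [l2 H2] := @gsdiff_mulr _ _ _ _ b d (fun p : G * G => p.1 * p.2)%g (g, n)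
  ((g, n).1^-1 * 1)%g l1 (chart_at_atlas _) (chart_at_atlas _) qc db dd.
have dX : chart_dom X ((g, n).1^-1 * 1 * ((g, n).1 * (g, n).2))%g.
  by rewrite -/(conj_trans (g, n) 1%g) conj_trans1.
have [l3 H3] := gsdiff_id (g, n) l2 (hX (chart_at_atlas _)) dd dX.
have H := gsdiff_comp (gsdiff_comp H1 H2) H3.
have [h1 h2 h3 h4] := H.
by split => //; rewrite /dconj_trans (sdiffE hE h4).
Qed.

Lemma dconj_transD g n v w : chart_dom X n ->
  dconj_trans X g n (v + w) = dconj_trans X g n v + dconj_trans X g n w.
Proof.
move=> Xn; exact: gsdiffD (dconj_trans_gsdiff g v Xn)
  (dconj_trans_gsdiff g w Xn) (dconj_trans_gsdiff g (v + w) Xn).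
Qed.

Lemma dconj_transZ g n k v : chart_dom X n ->
  dconj_trans X g n (k *: v) = k *: dconj_trans X g n v.
Proof.
move=> Xn; exact: gsdiffZ (dconj_trans_gsdiff g v Xn)
  (dconj_trans_gsdiff g (k *: v) Xn).
Qed.

Lemma dconj_trans0 g n : chart_dom X n -> dconj_trans X g n 0 = 0.
Proof. by move=> Xn; rewrite -(scale0r 0) dconj_transZ// !scale0r. Qed.

Lemma dconj_trans_cont g n v : chart_dom X n ->
  {for ((g, n), v), continuous (fun q : (G * G) * E => dconj_trans X q.1.1 q.1.2 q.2)}.
Proof.
move=> Xn; have [_ _ _ H] := dconj_trans_gsdiff g v Xn.
apply: (sdiff_cont (L := fun p v => dconj_trans X p.1 p.2 v) hE H).
have : nbhs ((g, n), v) [set q : (G * G) * E | chart_dom X q.1.2].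
  have K := cvg_comp _ _ (pair_fst_cvg (g, n) v) (pair_snd_cvg g n).
  exact: (K _ (chart_dom_nbhs Xn)).
apply: (@filterS _ (nbhs ((g, n), v))) => -[[g' n'] v'] /= Xn'.
have [_ _ _ H'] := dconj_trans_gsdiff g' v' Xn'.
exact: sdiff_dderiv H'.
Qed.

Lemma tdiff_dconj_trans v : @tdiff _ _ _ X (1%g : G) v = dconj_trans X 1%g 1%g v.
Proof.
rewrite /tdiff /dconj_trans; congr (dderiv _ _ _); apply/funext => u /=.
by rewrite /conj_trans /= invg1 !mulg1 mul1g.
Qed.

Lemma tdiff_gsdiff {P : topologicalType} (p : P) v : chart_dom X (1%g : G) ->
  gsdiff c1 X (fun _ h => h) p (1%g : G) v (@tdiff _ _ _ X (1%g : G) v).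
Proof.
move=> X1.
have [l H] := gsdiff_id p v (hX (chart_at_atlas (1%g : G))) (chart_at_dom (1%g : G)) X1.
have [_ _ _ h4] := H.
by have -> : @tdiff _ _ _ X (1%g : G) v = l by exact: sdiffE hE h4.
Qed.

End chart.

Section chart_tdiff.
Variable X : chart E G.
Hypothesis hX : forall c, atlas c -> smooth_transition c X.

(** For n = 1 the map is conjugation by g^-1, read in X rather than in the chart
    that represents tangent vectors. *)
Lemma dconj_trans_Ad g v : chart_dom X (1%g : G) ->
  dconj_trans X g 1%g v = @tdiff _ _ _ X (1%g : G) (@Ad _ _ G g^-1%g v).
Proof.
move=> X1; have c11 : chart_dom c1 (1%g : G) by exact: chart_at_dom.
have h1 : forall c : chart E G, atlas c -> smooth_transition c c1.
  by move=> c ac; apply: atlas_smooth => //; exact: chart_at_atlas.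
have AdE : @Ad _ _ G g^-1%g v = dconj_trans c1 g 1%g v.
  rewrite /Ad /mdiff /tdiff /dconj_trans.
  rewrite (_ : g^-1 * 1 * g^-1^-1 = 1 :> G)%g; last by rewrite mulg1 mulgV.
  congr (dderiv _ _ _); apply/funext => u /=.
  by rewrite /conj_trans /= invgK mulg1.
rewrite AdE; set w := dconj_trans c1 g 1%g v.
have H1 : gsdiff c1 c1 conj_trans (g, 1%g) 1%g v w.
  exact: dconj_trans_gsdiff.
have H2 h : h = 1%g -> gsdiff c1 X (fun _ h => h) ((g, 1%g) : G * G) h w
    (@tdiff _ _ _ X (1%g : G) w) by move=> ->; exact: tdiff_gsdiff.
have {H1 H2} := gsdiff_comp H1 (H2 _ (conj_trans1 g 1%g)).
by apply: gsdiff_unique; exact: dconj_trans_gsdiff.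
Qed.

Lemma tdiffD v w : chart_dom X (1%g : G) ->
  @tdiff _ _ _ X (1%g : G) (v + w) = @tdiff _ _ _ X (1%g : G) v + @tdiff _ _ _ X (1%g : G) w.
Proof. by move=> X1; rewrite !tdiff_dconj_trans dconj_transD. Qed.

Lemma tdiffZ k v : chart_dom X (1%g : G) ->
  @tdiff _ _ _ X (1%g : G) (k *: v) = k *: @tdiff _ _ _ X (1%g : G) v.
Proof. by move=> X1; rewrite !tdiff_dconj_trans dconj_transZ. Qed.

Lemma tdiff_cont : chart_dom X (1%g : G) ->
  continuous (@tdiff _ _ _ X (1%g : G) : E -> E).
Proof.
move=> X1 v.
have -> : (@tdiff _ _ _ X (1%g : G) : E -> E) = dconj_trans X 1%g 1%g.
  by apply/funext => w; exact: tdiff_dconj_trans.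
have H : (fun w : E => (((1%g : G), (1%g : G)), w)) @ v --> (((1%g : G), (1%g : G)), v).
  by apply: cvg_prod1; [exact: cvg_cst|exact: cvg_id].
exact: (cvg_comp _ _ H (@dconj_trans_cont X hX 1%g 1%g v X1)).
Qed.

(** The inverse of the differential of X at 1, that is the differential at X 1
    of the change of charts from X to the chart that represents tangent vectors. *)
Definition tdiff_inv (w : E) : E := dderiv (c1 \o chart_inv X) (X (1%g : G)) w.

Hypothesis hX' : forall c, atlas c -> smooth_transition X c.

Lemma tdiff_inv_gsdiff {P : topologicalType} (p : P) w : chart_dom X (1%g : G) ->
  gsdiff X c1 (fun _ h => h) p (1%g : G) w (tdiff_inv w).
Proof.
move=> X1.
have [l H] := gsdiff_id p w (hX' (chart_at_atlas (1%g : G))) X1 (chart_at_dom (1%g : G)).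
have [_ _ _ h4] := H.
by have -> : tdiff_inv w = l by exact: sdiffE hE h4.
Qed.

Lemma tdiffK v : chart_dom X (1%g : G) -> tdiff_inv (@tdiff _ _ _ X (1%g : G) v) = v.
Proof.
move=> X1.
have H := gsdiff_comp (tdiff_gsdiff hX (1%g : G) v X1)
  (tdiff_inv_gsdiff (1%g : G) (@tdiff _ _ _ X (1%g : G) v) X1).
exact: gsdiff_unique H (gsdiff_id_same _ _ (chart_at_dom (1%g : G))).
Qed.

Lemma tdiff_invK v : chart_dom X (1%g : G) -> @tdiff _ _ _ X (1%g : G) (tdiff_inv v) = v.
Proof.
move=> X1.
have H := gsdiff_comp (tdiff_inv_gsdiff (1%g : G) v X1)
  (tdiff_gsdiff hX (1%g : G) (tdiff_inv v) X1).
exact: gsdiff_unique H (gsdiff_id_same _ _ X1).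
Qed.

Lemma tdiff_invD v w : chart_dom X (1%g : G) ->
  tdiff_inv (v + w) = tdiff_inv v + tdiff_inv w.
Proof.
move=> X1; rewrite -[RHS](tdiffK _ X1) tdiffD// !tdiff_invK//.
Qed.

Lemma tdiff_invZ k v : chart_dom X (1%g : G) -> tdiff_inv (k *: v) = k *: tdiff_inv v.
Proof.
move=> X1; rewrite -[RHS](tdiffK _ X1) tdiffZ// !tdiff_invK//.
Qed.

Lemma tdiff_inv_cont : chart_dom X (1%g : G) -> continuous (tdiff_inv : E -> E).
Proof.
move=> X1 v; have [_ _ _ H] := tdiff_inv_gsdiff (1%g : G) v X1.
have K : tdiff_inv q.2 @[q --> ((1%g : G), v)] --> tdiff_inv v.
  apply: (sdiff_cont (L := fun _ w => tdiff_inv w) hE H).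
  apply: (@filterS _ (nbhs ((1%g : G), v)) _ setT); last exact: filterT.
  move=> -[g w] _ /=.
  by have [_ _ _ H'] := tdiff_inv_gsdiff g w X1; exact: sdiff_dderiv H'.
have C : (fun w : E => ((1%g : G), w)) @ v --> ((1%g : G), v).
  by apply: cvg_prod1; [exact: cvg_cst|exact: cvg_id].
exact: (cvg_comp _ _ C K).
Qed.

End chart_tdiff.

(** The differential of the chart at 1 is an isomorphism of topological vector
    spaces, along which seminorms are transported: bounds on the seminorms
    dotted p are bounds on all continuous seminorms. *)
Lemma snorm_dotted (X : chart E G) (q : E -> R) :
  is_chart X -> chart_dom X (1%g : G) -> continuous_seminorm q ->
  exists2 p, continuous_seminorm p & forall v : lie_algebra G, dotted X p v = q v.
Proof.
move=> hX X1 sq; exists (q \o tdiff_inv X).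
  have hX1 c : atlas c -> smooth_transition c X by move=> /hX[].
  have hX2 c : atlas c -> smooth_transition X c by move=> /hX[].
  apply: snorm_comp => // [v w|k v|].
  - exact: (@tdiff_invD _ hX1 hX2).
  - exact: (@tdiff_invZ _ hX1 hX2).
  - exact: (@tdiff_inv_cont _ hX2).
move=> v; rewrite /dotted /= tdiffK// => c /hX[] //.
Qed.

Lemma dotted_snorm (X : chart E G) (p : E -> R) :
  is_chart X -> chart_dom X (1%g : G) -> continuous_seminorm p ->
  @continuous_seminorm R E (dotted X p : lie_algebra G -> R).
Proof.
move=> hX X1 sp.
have hX1 c : atlas c -> smooth_transition c X by move=> /hX[].
by apply: snorm_comp => // [v w|k v|]; [exact: tdiffD|exact: tdiffZ|exact: tdiff_cont].
Qed.

End ConjugateTranslation.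

(** * Logarithmic derivatives *)

Section Curves.
Context {R : realType} {E : tvsType R} {G : lieGroupType E}.

Let hE : hausdorff_space E := @model_hausdorff R E G.
Let c1 : chart E G := chart_at (1%g : G).
Let c11 : chart_dom c1 (1%g : G) := chart_at_dom (1%g : G).

(** The velocity at t of a curve that passes through 1 at that time, in the chart
    that represents tangent vectors at 1. *)
Definition unit_velocity (sigma : R -> G) (t : R) (v : E) : Prop :=
  [/\ {for t, continuous sigma}, sigma t = 1%g & cder (c1 \o sigma) t v].

(** The right logarithmic derivative, without reference to the chart at mu t;
    in this form it is visibly invariant under right translations. *)
Definition logder (mu : R -> G) (t : R) (v : E) : Prop :=
  unit_velocity (fun s => mu s * (mu t)^-1)%g t v.

Lemma logder_cont mu t v : logder mu t v -> {for t, continuous mu}.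
Proof.
move=> [mt _ _].
have : (fun s => (mu s * (mu t)^-1 * mu t)%g) @ t --> (mu t * (mu t)^-1 * mu t)%g.
  by apply: cvg_mulg => //; exact: cvg_cst.
rewrite mulgVK; apply: cvg_trans; apply: near_eq_cvg.
by near=> s; rewrite mulgVK.
Unshelve. all: by end_near. Qed.

Lemma logder_unique mu t v w : logder mu t v -> logder mu t w -> v = w.
Proof. by move=> [_ _ mv] [_ _]; exact: cder_unique. Qed.

Lemma logder_mulr mu t v g : logder mu t v -> logder (fun s => mu s * g)%g t v.
Proof.
by rewrite /logder; under [X in _ -> unit_velocity X _ _]eq_fun do
  rewrite invgM mulgA mulgK.
Qed.

(** The differential of the multiplication at (1, 1) is the addition. *)
Lemma unit_velocityM sigma tau t v w : unit_velocity sigma t v ->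
  unit_velocity tau t w -> unit_velocity (fun s => sigma s * tau s)%g t (v + w).
Proof.
move=> [sc s1 sv] [tc t1 tw]; split; [exact: cvg_mulg|by rewrite s1 t1 mulg1|].
have a1 : atlas c1 := chart_at_atlas (1%g : G).
have c111 : chart_dom c1 (1 * 1 : G)%g by rewrite mulg1.
have S u := @mul_chart_sdiff _ _ G G c1 c1 c1 1%g 1%g 1%g u a1 a1 a1 c11 c11 c111.
pose m (u : E * E) := c1 (chart_inv c1 u.1 * chart_inv c1 u.2)%g.
have near_cod (u : E) (v' : E) : c1 (1%g : G) = u ->
    \forall h \near (0 : R)^', chart_cod c1 (u + h *: v').
  move=> <-; have : (fun h : R => c1 (1%g : G) + h *: v') @ (0 : R)^' --> c1 (1%g : G).
    rewrite -[X in _ --> X]addr0 -[X in _ --> _ + X](scale0r v').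
    apply: tvs_cvgD; first exact: cvg_cst.
    apply: tvs_cvgZ; last exact: cvg_cst.
    by apply: cvg_within_filter; exact: cvg_id.
  by move=> /(_ _ (chart_cod_nbhs (chart_funP c11))).
have m1 (v' l : E) : sdiff (fun (_ : G) => m) 1%g (c1 (1%g : G), c1 (1%g : G)) (v', 0) l ->
    l = v'.
  move=> /sdiff_dderiv H; apply: (tvs_cvg_unique hE H).
  apply: (@cvg_trans _ ((fun=> v') @ (0 : R)^')); last exact: cvg_cst.
  apply: near_eq_cvg; near=> h.
  have h0 : h != 0 by near: h; exact: nbhs_dnbhs_neq.
  have ch : chart_cod c1 (c1 (1%g : G) + h *: v') by near: h; exact: near_cod.
  have -> : (c1 (1%g : G), c1 (1%g : G)) + h *: (v', 0) =
      (c1 (1%g : G) + h *: v', c1 (1%g : G)) by congr pair; rewrite /= scaler0 addr0.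
  rewrite /m /= (chart_funK c11) !mulg1 chart_invK//.
  by rewrite [_ + h *: _]addrC addrK scalerA mulVf// scale1r.
have m2 (v' l : E) : sdiff (fun (_ : G) => m) 1%g (c1 (1%g : G), c1 (1%g : G)) (0, v') l ->
    l = v'.
  move=> /sdiff_dderiv H; apply: (tvs_cvg_unique hE H).
  apply: (@cvg_trans _ ((fun=> v') @ (0 : R)^')); last exact: cvg_cst.
  apply: near_eq_cvg; near=> h.
  have h0 : h != 0 by near: h; exact: nbhs_dnbhs_neq.
  have ch : chart_cod c1 (c1 (1%g : G) + h *: v') by near: h; exact: near_cod.
  have -> : (c1 (1%g : G), c1 (1%g : G)) + h *: (0, v') =
      (c1 (1%g : G), c1 (1%g : G) + h *: v') by congr pair; rewrite /= scaler0 addr0.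
  rewrite /m /= (chart_funK c11) !mul1g chart_invK//.
  by rewrite [_ + h *: _]addrC addrK scalerA mulVf// scale1r.
have [l Hl] := S (v, 0); have [l' Hl'] := S (0, w).
have [n Hn] := S ((v, 0) + (0, w)).
have nE : n = v + w by rewrite (sdiffD hE Hl Hl' Hn) (m1 _ _ Hl) (m2 _ _ Hl').
have vw : (v, 0) + (0, w) = (v, w) :> E * E by congr pair; rewrite /= ?addr0 ?add0r.
rewrite nE vw in Hn.
have H := sdiff_curve Hn _ (cder_pair sv tw).
have {}H := H (congr2 pair (congr1 c1 s1) (congr1 c1 t1)).
apply: cder_near H.
have ns : nbhs t [set s | chart_dom c1 (sigma s)].
  by apply: sc; rewrite s1; exact: chart_dom_nbhs.
have nt : nbhs t [set s | chart_dom c1 (tau s)].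
  by apply: tc; rewrite t1; exact: chart_dom_nbhs.
by apply: filterS2 ns nt => s /= ss st; rewrite !chart_funK.
Unshelve. all: by end_near. Qed.

Lemma unit_velocity_cst t : unit_velocity (fun=> 1%g) t 0.
Proof. by split=> //; [exact: cvg_cst|exact: cder_cst]. Qed.

Lemma unit_velocity_unique sigma t v w :
  unit_velocity sigma t v -> unit_velocity sigma t w -> v = w.
Proof. by move=> [_ _ sv] [_ _]; exact: cder_unique. Qed.

(** The inverse of the curve has some velocity by the chain rule; as the product
    with the curve is constant, this velocity is - v. *)
Lemma unit_velocityV sigma t v : unit_velocity sigma t v ->
  unit_velocity (fun s => (sigma s)^-1)%g t (- v).
Proof.
move=> H; have [sc s1 sv] := H.
have c11' : chart_dom c1 (1^-1 : G)%g by rewrite invg1.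
have [l [_ _ _ Hl]] := @gsdiff_inv _ _ G G c1 c1 1%g 1%g v
  (chart_at_atlas _) (chart_at_atlas _) c11 c11'.
have H1 := sdiff_curve Hl (congr1 c1 s1) sv.
have Hinv : unit_velocity (fun s => (sigma s)^-1)%g t l.
  split; [exact: cvg_invg|by rewrite s1 invg1|].
  apply: cder_near H1.
  have ns : nbhs t [set s | chart_dom c1 (sigma s)].
    by apply: sc; rewrite s1; exact: chart_dom_nbhs.
  by apply: filterS ns => s /= ss; rewrite chart_funK.
have := unit_velocityM H Hinv.
under [X in unit_velocity X _ _]eq_fun do rewrite mulgV.
move=> /unit_velocity_unique/(_ (unit_velocity_cst t))/eqP.
by rewrite addrC addr_eq0 => /eqP <-.
Qed.

Section quotient.
Variable X : chart E G.
Hypothesis hX : forall c, atlas c -> smooth_transition c X.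

(** With rho, rho' the translates of mu, mu' by the inverses of their values at
    t, the quotient mu^-1 mu' is conj_trans (mu t, mu(t)^-1 mu'(t)) applied to
    rho^-1 rho', a curve through 1 with velocity phi' - phi. *)
Lemma logder_quot mu mu' t (phi phi' : E) :
  logder mu t phi -> logder mu' t phi' -> chart_dom X ((mu t)^-1 * mu' t)%g ->
  cder (fun s => X ((mu s)^-1 * mu' s)%g) t
    (dconj_trans X (mu t) ((mu t)^-1 * mu' t)%g (phi' - phi)).
Proof.
move=> mp mp' Xn.
have H := unit_velocityM (unit_velocityV mp) mp'; rewrite addrC in H.
have [kc k1 kv] := H.
have [_ _ _ D] := dconj_trans_gsdiff hX (mu t) (phi' - phi) Xn.
have H1 := sdiff_curve D (congr1 c1 k1) kv.
apply: cder_near H1.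
have nk : nbhs t [set s | chart_dom c1 ((mu s * (mu t)^-1)^-1 * (mu' s * (mu' t)^-1))%g].
  by apply: kc; rewrite k1; exact: chart_dom_nbhs.
apply: filterS nk => s /= ss; rewrite chart_funK//; congr (X _).
by rewrite /conj_trans /= invgM invgK !mulgA mulVg mul1g mulgK mulgVK.
Qed.

End quotient.

(** The quotient of the two curves is locally constant, since its derivative in
    charts vanishes by logder_quot. *)
Lemma logder_eq mu mu' a b (phi : R -> E) : a <= b ->
  (forall t, a <= t <= b -> logder mu t (phi t)) ->
  (forall t, a <= t <= b -> logder mu' t (phi t)) ->
  ((mu a)^-1 * mu' a = (mu b)^-1 * mu' b)%g.
Proof.
move=> ab mp mp'; pose nu s := ((mu s)^-1 * mu' s)%g.
apply: (@interval_chain _ (fun s u => nu s = nu u) a b ab) => [s t u -> //|t tab].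
pose X : chart E G := chart_at (nu t).
have hX c : atlas c -> smooth_transition c X.
  by move=> ac; apply: atlas_smooth => //; exact: chart_at_atlas.
have nuc : {for t, continuous nu}.
  apply: cvg_mulg; last exact: logder_cont (mp' _ tab).
  by apply: cvg_invg; exact: logder_cont (mp _ tab).
have [d /= d0 dX] := nuc _ (chart_dom_nbhs (chart_at_dom (nu t))).
exists d => // s u sa st tu ub ts us.
have Xr z : s <= z <= u -> chart_dom X (nu z).
  move=> /andP[sz zu]; apply: dX; rewrite /= ltr_norml; apply/andP; split; lra.
have su : s <= u by lra.
rewrite -[LHS](chart_funK (c := X)); last by apply: Xr; rewrite lexx.
rewrite -[RHS](chart_funK (c := X)); last by apply: Xr; rewrite lexx su.
congr (chart_inv X _); apply/eqP; rewrite eq_sym -subr_eq0; apply/eqP.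
apply: snorm_eq0 => // p sp; apply/eqP; rewrite eq_le snorm_ge0// andbT.
have := @mean_value _ _ p (X \o nu) (fun=> 0) (fun=> 0) (fun=> 0) s u sp su.
rewrite subrr; apply.
- move=> z sz; have zab : a <= z <= b by move: sz => /andP[? ?]; apply/andP; split; lra.
  have := logder_quot hX (mp _ zab) (mp' _ zab) (Xr _ sz).
  by rewrite subrr dconj_trans0//; exact: Xr sz.
- by move=> z _; exact: cder_cst.
- by move=> z _; rewrite snorm0.
Qed.

(** The velocity in the chart at mu t is mapped to the logarithmic derivative by
    the differential of a right translation. *)
Lemma C1_curve_logder a b (mu : R -> G) t : C1_curve a b mu -> a <= t <= b ->
  logder mu t (rlogderiv mu t).
Proof.
move=> [J [[oJ _] abJ muJ muC1]] tab.
have Jt : J t by apply: abJ; rewrite /= in_itv.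
have mut : {for t, continuous mu} by apply: within_nbhsP muJ; exact: open_nbhs_nbhs.
pose c : chart E G := chart_at (mu t).
have cm : chart_dom c (mu t) by exact: chart_at_dom.
have vel : cder (c \o mu) t (velocity mu t).
  apply/cder_dderiv; apply: (C1_dderiv (muC1 c (chart_at_atlas _))).
  by split.
have c1m : chart_dom c1 (mu t * (mu t)^-1)%g by rewrite mulgV.
have rc : {for (1%g : G), continuous (fun _ : G => (mu t)^-1%g)} by exact: cvg_cst.
have [l [_ _ _ Hl]] := @gsdiff_mulr _ _ G G c c1 (fun=> (mu t)^-1%g) 1%g (mu t)
  (velocity mu t) (chart_at_atlas _) (chart_at_atlas _) rc cm c1m.
have H := sdiff_curve Hl erefl vel.
have lE : rlogderiv mu t = l.
  rewrite /rlogderiv /mdiff /tdiff; rewrite (_ : mu t * (mu t)^-1 = 1)%g; last exact: mulgV.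
  exact: sdiffE hE Hl.
rewrite lE; split; [|by rewrite mulgV|].
- by apply: cvg_mulg => //; exact: cvg_cst.
- apply: cder_near H; have := mut _ (chart_dom_nbhs cm).
  by apply: (@filterS _ (nbhs t)) => s /= cs; rewrite chart_funK.
Qed.

End Curves.

(** * Affine reparametrization *)

Definition affine {R : realType} (al be s : R) : R := al * s + be.

Section AffineCalculus.
Context {R : realType} {E : tvsType R}.
Hypothesis hE : hausdorff_space E.
Variables al be ga : R.
Let rho := affine al be.

Lemma affine_cont : continuous (rho : R -> R).
Proof.
move=> s; apply: cvgD; last exact: cvg_cst.
by apply: cvgM; [exact: cvg_cst|exact: cvg_id].
Qed.

Lemma affineD s h : rho (s + h) = rho s + h * al.
Proof. by rewrite /rho /affine; ring. Qed.

Lemma is_dderiv_near {F : tvsType R} (f f' : F -> E) x v l :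
  (\forall y \near x, f y = f' y) -> is_dderiv f x v l -> is_dderiv f' x v l.
Proof.
move=> ff'; apply: cvg_trans; apply: near_eq_cvg.
have H : (fun h : R => x + h *: v) @ (0 : R)^' --> x.
  rewrite -[X in _ --> X]addr0 -[X in _ --> _ + X](scale0r v).
  apply: tvs_cvgD; first exact: cvg_cst.
  apply: tvs_cvgZ; last exact: cvg_cst.
  by apply: cvg_within_filter; exact: cvg_id.
have {}H : \forall h \near (0 : R)^', f (x + h *: v) = f' (x + h *: v) := H _ ff'.
by near=> h; rewrite (nbhs_singleton ff') (near H h).
Unshelve. all: by end_near. Qed.

Lemma is_dderiv_affine (f : R^o -> E) x v l :
  is_dderiv f (rho x) (al *: v : R^o) l ->
  is_dderiv (fun s : R^o => ga *: f (rho s)) x v (ga *: l).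
Proof.
move=> fl.
have H : (fun h : R => ga *: (h^-1 *: (f (rho x + h *: (al *: v : R^o)) - f (rho x)))) @
    (0 : R)^' --> ga *: l by apply: tvs_cvgZ => //; exact: cvg_cst.
move: H; apply: cvg_trans; apply: near_eq_cvg; near=> h.
rewrite (scalerA ga) [ga * _]mulrC -(scalerA h^-1) (scalerBr ga); congr (_ *: (_ *: f _ - _)).
by rewrite /GRing.scale /= /rho /affine; ring.
Unshelve. all: by end_near. Qed.

Lemma iter_dderiv_rcons {F : tvsType R} (f : F -> E) vs v x :
  iter_dderiv f (rcons vs v) x = dderiv (iter_dderiv f vs) x v.
Proof. by rewrite /iter_dderiv foldl_rcons. Qed.

Lemma scale_comp_cont {T U : topologicalType} (F : U -> E) (f : T -> U) (x : T) :
  f @ x --> f x -> F @ f x --> F (f x) -> (fun q => ga *: F (f q)) @ x --> ga *: F (f x).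
Proof. by move=> fx Ff; apply: tvs_cvgZ; [exact: cvg_cst|exact: (cvg_comp _ _ fx Ff)]. Qed.

Lemma cvg_near_eq {T U : topologicalType} (f f' : T -> U) (x : T) (y : U) :
  nbhs x [set q | f q = f' q] -> f @ x --> y -> f' @ x --> y.
Proof. by move=> ff'; apply: cvg_trans; exact: near_eq_cvg. Qed.

Section Ck.
Variables (k : nat) (U : set R^o) (f : R^o -> E).
Hypotheses (oU : open U) (fC : Ck_on k U f).
Let V : set R^o := rho @^-1` U.
Let g : R^o -> E := fun s => ga *: f (rho s).
Let scl : R^o -> R^o := fun v => al *: v.

Let oV : open V. Proof. by apply: open_comp => // s _; exact: affine_cont. Qed.

Let scl_cont : continuous scl.
Proof. by move=> v; apply: tvs_cvgZ; [exact: cvg_cst|exact: cvg_id]. Qed.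

(** The factor al is absorbed by the directions, so that the formula holds for
    al = 0 as well, where the reparametrized map is constant. *)
Lemma iter_dderiv_affine vs x : (size vs <= k)%N -> V x ->
  iter_dderiv g vs x = ga *: iter_dderiv f (map scl vs) (rho x).
Proof.
elim/last_ind: vs x => [//|vs v IH] x; rewrite size_rcons => vk Vx.
rewrite map_rcons !iter_dderiv_rcons; apply: dderivP hE _.
have [l fl] := fC.1 (map scl vs) (scl v) (rho x) (ltac:(by rewrite size_map)) Vx.
rewrite (dderivP hE fl); apply: (is_dderiv_near _ (is_dderiv_affine fl)).
have : nbhs x V by exact: open_nbhs_nbhs.
by apply: filterS => y Vy; rewrite IH// ltnW.
Qed.

Lemma Ck_on_affine : Ck_on k V g.
Proof.
split=> [vs v x vk Vx|p pk].
  have [l fl] := fC.1 (map scl vs) (scl v) (rho x) (ltac:(by rewrite size_map)) Vx.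
  exists (ga *: l); apply: (is_dderiv_near _ (is_dderiv_affine fl)).
  have : nbhs x V by exact: open_nbhs_nbhs.
  by apply: filterS => y Vy; rewrite iter_dderiv_affine// ltnW.
apply: continuous_in_subspaceT => -[x v]; rewrite inE => -[/= Vx _].
have nU : nbhs (rho x : R^o, (fun i => scl (v i)) : {ptws 'I_p -> R^o}) (U `*` setT).
  by exists (U, setT) => //; split; [exact: open_nbhs_nbhs|exact: filterT].
pose F0 (q : R^o * {ptws 'I_p -> R^o}) := iter_dderiv f [seq q.2 i | i <- enum 'I_p] q.1.
pose T (q : R^o * {ptws 'I_p -> R^o}) : R^o * {ptws 'I_p -> R^o} :=
  (rho q.1 : R^o, fun i => scl (q.2 i)).
have fc : F0 @ T (x, v) --> F0 (T (x, v)) := within_nbhsP nU (fC.2 p pk).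
have Tc : T @ (x, v) --> T (x, v).
  have T1 : (fun q : R^o * {ptws 'I_p -> R^o} => rho q.1) @ (x, v) --> rho x.
    have := pair_fst_cvg x v.
    move=> H.
    exact: (cvg_comp _ _ H (@affine_cont x)).
  pose S (q : R^o * {ptws 'I_p -> R^o}) : {ptws 'I_p -> R^o} := fun i => scl (q.2 i).
  have Si i : (fun q => S q i) @ (x, v) --> S (x, v) i.
    have vi := cvg_comp _ _ (pair_snd_cvg x v) (@proj_continuous _ (fun=> R^o) i v).
    exact: (cvg_comp _ _ vi (@scl_cont (v i))).
  have T2 : S @ nbhs (x, v) --> nbhs (S (x, v)).
    exact: (@ptws_cvg 'I_p R^o (S @ nbhs (x, v)) (S (x, v)) _ Si).
  exact: (@cvg_prod1 _ _ _ _ _ _ _ T T1 T2).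
have H : (fun q => ga *: F0 (T q)) @ (x, v) --> ga *: F0 (T (x, v)).
  exact: (scale_comp_cont Tc fc).
have eqF : forall q, V q.1 -> ga *: F0 (T q) = iter_dderiv g [seq q.2 i | i <- enum 'I_p] q.1.
  move=> q Vq; have sz : (size [seq q.2 i | i <- enum 'I_p] <= k)%N.
    by rewrite size_map size_enum_ord.
  by rewrite (iter_dderiv_affine sz Vq) -map_comp.
have nV : nbhs (x, v) [set q | V q.1].
  by apply: (pair_fst_cvg x v); exact: open_nbhs_nbhs.
rewrite /continuous_at -(eqF (x, v) Vx).
exact: (@cvg_near_eq _ _ (fun q => ga *: F0 (T q)) _ _ _ (filterS eqF nV) H).
Qed.

End Ck.

Lemma cder_affine (f : R -> E) t l : cder f (rho t) l -> cder (f \o rho) t (al *: l).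
Proof.
move=> fl; have [a0|a0] := eqVneq al 0.
  rewrite a0 scale0r; apply: (@cvg_trans _ ((fun=> 0) @ (0 : R)^')); last exact: cvg_cst.
  apply: near_eq_cvg; near=> h.
  by rewrite /= affineD a0 mulr0 addr0 subrr scaler0.
have H : (fun h : R => al *: ((h * al)^-1 *: (f (rho t + h * al) - f (rho t)))) @
    (0 : R)^' --> al *: l.
  apply: tvs_cvgZ; first exact: cvg_cst.
  exact: (cvg_comp _ _ (cvg_dnbhs0_mulr a0) fl).
move: H; apply: cvg_trans; apply: near_eq_cvg; near=> h.
by rewrite /= affineD scalerA invfM mulrCA mulfV// mulr1.
Unshelve. all: by end_near. Qed.

Lemma open_interval_affine (J : set R) : 0 <= al -> open_interval J ->
  open_interval (rho @^-1` J).
Proof.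
move=> al0 [oJ iJ]; split; first by apply: open_comp => // s _; exact: affine_cont.
move=> s t Js Jt u /andP[su ut]; apply: (iJ _ _ Js Jt).
by rewrite /rho /affine !lerD2r !ler_wpM2l.
Qed.

End AffineCalculus.

Section AffineSolutions.
Context {R : realType} {E : tvsType R} {G : lieGroupType E}.
Variable Xi : chart E G.
Hypotheses (Xi_chart : is_chart Xi) (Xi_dom : chart_dom Xi (1%g : G)).
Let hE : hausdorff_space E := @model_hausdorff R E G.

Section affine.
Variables (al be : R).
Hypothesis al0 : 0 <= al.
Let rho := affine al be.
Variables a b c d : R.
Hypothesis rhoP : forall s, a <= s <= b -> c <= rho s <= d.

Lemma Ck_curves_affine ga k (phi : R -> lie_algebra G) : Ck_curves Xi k c d phi ->
  Ck_curves Xi k a b (fun s => ga *: phi (rho s)).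
Proof.
have iab (J : set R) : `[c, d] `<=` J -> `[a, b] `<=` rho @^-1` J.
  by move=> cdJ s; rewrite /= in_itv => /rhoP ?; apply: cdJ; rewrite /= in_itv.
have eab (psi : R -> E) : (forall t, `[c, d]%classic t -> phi t = psi t) ->
    forall t, `[a, b]%classic t -> ga *: phi (rho t) = ga *: psi (rho t).
  move=> e t; rewrite /= in_itv => /rhoP tcd; congr (_ *: _); apply: e.
  by rewrite /= in_itv.
case: k => [n||] /=.
- move=> [J [psi [oJ cdJ psiC e]]].
  exists (rho @^-1` J), (fun s => ga *: psi (rho s)); split.
  + exact: open_interval_affine.
  + exact: iab.
  + by apply: (Ck_on_affine hE) => //; case: oJ.
  + exact: eab.
- move=> H p sp; have [L L0 HL] := H p sp.
  have sd := dotted_snorm Xi_chart Xi_dom sp.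
  exists (`|ga| * (L * al)); first by rewrite !mulr_ge0.
  move=> t t'; rewrite /= !in_itv => /rhoP ht /rhoP ht'.
  rewrite -scalerBr (snormZ sd) -mulrA ler_wpM2l//.
  apply: le_trans (HL _ _ _ _) _; [by rewrite /= in_itv|by rewrite /= in_itv|].
  rewrite -mulrA ler_wpM2l// (_ : rho t - rho t' = al * (t - t')).
    by rewrite normrM ger0_norm.
  by rewrite /rho /affine; ring.
- move=> [J [psi [oJ cdJ psiC e]]].
  exists (rho @^-1` J), (fun s => ga *: psi (rho s)); split.
  + exact: open_interval_affine.
  + exact: iab.
  + by move=> k; apply: (Ck_on_affine hE) => //; case: oJ.
  + exact: eab.
Qed.

Lemma C1_curve_affine (mu : R -> G) : C1_curve c d mu -> C1_curve a b (mu \o rho).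
Proof.
move=> [J [[oJ iJ] cdJ muJ muC1]].
have muc s : J s -> {for s, continuous mu}.
  by move=> Js; apply: within_nbhsP muJ; exact: open_nbhs_nbhs.
exists (rho @^-1` J); split.
- exact: open_interval_affine.
- by move=> s; rewrite /= in_itv => /rhoP ?; apply: cdJ; rewrite /= in_itv.
- apply: continuous_in_subspaceT => s; rewrite inE => Js.
  by apply: continuous_comp; [exact: affine_cont|exact: muc].
- move=> ch ach.
  have oU : open (J `&` mu @^-1` chart_dom ch : set R^o).
    rewrite openE => s [Js cs]; apply: filterI; first exact: open_nbhs_nbhs.
    exact: (muc _ Js _ (chart_dom_nbhs cs)).
  have := Ck_on_affine hE al be 1 oU (muC1 ch ach).
  by under [X in Ck_on _ _ X]eq_fun do rewrite scale1r.
Qed.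

Lemma logder_affine (mu : R -> G) t v : logder mu (rho t) v ->
  logder (mu \o rho) t (al *: v).
Proof.
move=> [mc m1 mv]; split => /=.
- exact: (cvg_comp _ _ (@affine_cont R al be t) mc).
- by rewrite mulgV.
- exact: cder_affine mv.
Qed.

Lemma solutions_affine phi (mu : R -> G) : solutions c d phi mu ->
  solutions a b (fun t => al *: phi (rho t)) (mu \o rho).
Proof.
move=> [muC mus]; have mrC := C1_curve_affine muC; split=> // t.
rewrite /= in_itv => tab; have tcd := rhoP tab.
have H := logder_affine (C1_curve_logder muC tcd).
rewrite (logder_unique (C1_curve_logder mrC tab) H) mus//.
Qed.

End affine.

Lemma solutions_logder a b phi (mu : R -> G) t : solutions a b phi mu ->
  a <= t <= b -> logder mu t (phi t).
Proof.
by move=> [muC mus] tab; rewrite mus ?/= ?in_itv//; exact: C1_curve_logder tab.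
Qed.

(** By uniqueness up to right translation, the solution that prodint selects may
    be replaced by any other one. *)
Lemma prodintE a b phi (mu : R -> G) t : solutions a b phi mu -> a <= t <= b ->
  prodint a b phi t = (mu t * (mu a)^-1)%g.
Proof.
move=> mus /andP[a_t tb]; rewrite /prodint; case: xgetP => [nu _ nus|/(_ mu)//].
have := @logder_eq _ _ G nu mu a t phi a_t.
move=> /(_ _ _)/eqP.
have H (si : R -> G) : solutions a b phi si -> forall s, a <= s <= t -> logder si s (phi s).
  move=> sis s /andP[? ?]; apply: solutions_logder sis _; apply/andP; split; lra.
move=> /(_ (H _ nus) (H _ mus))/eqP e.
have -> : mu t = (nu t * ((nu a)^-1 * mu a))%g by rewrite e mulgA mulgV mul1g.
by rewrite !mulgA mulgK.
Qed.

Lemma prodint_logder a b phi t : integrable_curves a b phi -> a <= t <= b ->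
  logder (prodint a b phi : R -> G) t (phi t).
Proof.
move=> [mu mus] tab.
have nus : solutions a b phi (xget (fun=> 1%g) (solutions a b phi)).
  by case: xgetP => [nu _ //|/(_ mu)//].
exact: logder_mulr (solutions_logder nus tab).
Qed.

Lemma prodint0 a b phi : prodint a b phi a = 1%g :> G.
Proof. by rewrite /prodint mulgV. Qed.

(** Rescaling to an initial segment: the product integral up to t is that of a
    reparametrized curve over the whole interval. *)
Lemma prodint_affine a b al phi : 0 <= al <= 1 -> a <= b ->
  integrable_curves a b phi ->
  prodint a b (fun s => al *: phi (affine al (a - al * a) s)) b =
  prodint a b phi (affine al (a - al * a) b) :> G.
Proof.
move=> /andP[al0 al1] ab [mu mus].
have rP s : a <= s <= b -> a <= affine al (a - al * a) s <= b.
  by move=> /andP[sa sb]; rewrite /affine; apply/andP; split; nra.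
rewrite (prodintE (solutions_affine al0 rP mus)); last by rewrite ab lexx.
rewrite (prodintE mus); last by apply: rP; rewrite ab lexx.
by congr (_ * (mu _)^-1)%g; rewrite /affine; ring.
Qed.

(** The curve is rescaled to [0, 1], and the solution found there is rescaled
    back to [a, b]. *)
Lemma semiregular_integrable k a b phi : semiregular Xi k -> a < b ->
  Ck_curves Xi k a b phi -> integrable_curves a b phi.
Proof.
move=> sr ab phiC.
have l0 : 0 < b - a by lra.
have rP s : 0 <= s <= 1 -> a <= affine (b - a) a s <= b.
  by move=> /andP[s0 s1]; rewrite /affine; apply/andP; split; nra.
have H := Ck_curves_affine (ltW l0) rP (b - a) phiC.
move: (H); rewrite -sr => -[[mu mus] _].
have rP' s : a <= s <= b -> 0 <= affine (b - a)^-1 (- a / (b - a)) s <= 1.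
  move=> /andP[sa sb]; rewrite /affine mulrC -mulrDl; apply/andP; split.
    by rewrite divr_ge0; lra.
  by rewrite ler_pdivrMr; lra.
have li0 : 0 <= (b - a)^-1 by rewrite invr_ge0 ltW.
exists (mu \o affine (b - a)^-1 (- a / (b - a))).
have [C e] := solutions_affine li0 rP' mus; split => // t tab; rewrite -e//.
rewrite scalerA mulVf ?gt_eqF// scale1r; congr (phi _).
by rewrite /affine; field; rewrite gt_eqF.
Qed.

End AffineSolutions.

(** * Iterated one-sided derivatives *)

Section Clamp.
Context {R : realType}.
Variables a b : R.
Hypothesis ab : a <= b.

(** A curve given on [a, b], composed with clamp, is a curve on R, so that
    continuity on [a, b] becomes continuity everywhere. *)
Definition clamp (s : R) : R := Num.max a (Num.min b s).

Lemma clamp_in s : a <= clamp s <= b.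
Proof. by rewrite /clamp le_max lexx ge_max ab ge_min lexx. Qed.

Lemma clamp_id s : a <= s <= b -> clamp s = s.
Proof. by move=> /andP[sa sb]; rewrite /clamp (min_r sb) (max_r sa). Qed.

Variant clamp_spec (s : R) : R -> Prop :=
  | ClampLow of s <= a : clamp_spec s a
  | ClampMid of a <= s & s <= b : clamp_spec s s
  | ClampHigh of b <= s : clamp_spec s b.

Lemma clampP s : clamp_spec s (clamp s).
Proof.
rewrite /clamp; have [sb|bs] := leP b s; first by rewrite max_r//; exact: ClampHigh.
by have [sa|as_] := leP a s; [exact: ClampMid (ltW bs)|exact: ClampLow (ltW as_)].
Qed.

Lemma clamp_cont : continuous clamp.
Proof.
move=> s; apply: (@continuous_max R R (fun=> a) (fun s => Num.min b s)).
  exact: cvg_cst.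
by apply: (@continuous_min R R (fun=> b) idfun); [exact: cvg_cst|exact: cvg_id].
Qed.

End Clamp.

Section OneSidedDerivatives.
Context {R : realType} {E : tvsType R} {G : lieGroupType E}.
Let hE : hausdorff_space E := @model_hausdorff R E G.
Variables a b : R.
Hypothesis ab : a < b.

(** The property by which cderiv is selected. *)
Definition wder (f : R -> lie_algebra G) (t : R) (l : E) : Prop :=
  h^-1 *: (f (t + h) - f t)
    @[h --> within [set h | `[a, b]%classic (t + h)] (0 : R)^'] --> (l : lie_algebra G).

Lemma within_itv_proper t : a <= t <= b ->
  ProperFilter (within [set h | `[a, b]%classic (t + h)] (0 : R)^').
Proof.
move=> /andP[at_ tb]; apply: Build_ProperFilter_ex => A [d /= d0 H].
have d20 : 0 < d / 2 by rewrite divr_gt0.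
have dd : d / 2 < d by rewrite ltr_pdivrMr// mulr2n mulrDr mulr1 ltrDl.
suff [h [h0 hd hab]] : exists h, [/\ h != 0, `|h| <= d / 2 & a <= t + h <= b].
  exists h; apply: H => //=.
  by rewrite sub0r normrN (le_lt_trans hd).
have [tb'|tb'] := ltP t b.
- have h0 : 0 < Num.min (d / 2) (b - t) by rewrite lt_min d20 subr_gt0.
  have hb : Num.min (d / 2) (b - t) <= b - t by rewrite ge_min lexx orbT.
  exists (Num.min (d / 2) (b - t)); split.
  + by rewrite gt_eqF.
  + by rewrite gtr0_norm// ge_min lexx.
  + by apply/andP; split; lra.
- have h0 : 0 < Num.min (d / 2) (b - a) by rewrite lt_min d20 subr_gt0.
  have hb : Num.min (d / 2) (b - a) <= b - a by rewrite ge_min lexx orbT.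
  exists (- Num.min (d / 2) (b - a)); split.
  + by rewrite oppr_eq0 gt_eqF.
  + by rewrite normrN gtr0_norm// ge_min lexx.
  + by apply/andP; split; lra.
Qed.

Lemma wderP f t l : a <= t <= b -> wder f t l -> cderiv a b f t = l.
Proof.
move=> tab fl; rewrite /cderiv; case: xgetP => [l' _ fl'|/(_ l)//].
by have ? := within_itv_proper tab; exact: (tvs_cvg_unique hE fl' fl).
Qed.

Lemma wder_eq f g t l : a <= t <= b -> (forall s, a <= s <= b -> f s = g s) ->
  wder f t l -> wder g t l.
Proof.
move=> tab fg; apply: cvg_trans; apply: near_eq_cvg.
near=> h; have : `[a, b]%classic (t + h) by near: h; exact: withinT.
by rewrite /= in_itv /= => th; rewrite !fg.
Unshelve. all: by end_near. Qed.

Lemma wderB f g t l m : wder f t l -> wder g t m ->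
  wder (fun s => f s - g s) t (l - m).
Proof.
move=> fl gm; have := tvs_cvgB fl gm => /(_ _).
apply: cvg_trans; apply: near_eq_cvg; near=> h.
rewrite -scalerBr; congr (_ *: _).
exact: subrACA.
Unshelve. all: by end_near. Qed.

Lemma cder_wder f t l : cder f t l -> wder f t l.
Proof. by move=> fl; apply: cvg_trans fl; exact: cvg_fmap2 (cvg_within _). Qed.

Lemma wder_affine al be ga f t l : 0 <= al ->
  (forall s, a <= s <= b -> a <= affine al be s <= b) ->
  wder f (affine al be t) l ->
  wder (fun s => ga *: f (affine al be s)) t (ga *: (al *: l)).
Proof.
move=> al0 rP fl.
have {}fl : (fun h => ga *: (al *: (h^-1 *: (f (affine al be t + h) - f (affine al be t)))))
    @ (within [set h | `[a, b]%classic (affine al be t + h)] (0 : R)^') --> ga *: (al *: l).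
  by do 2 (apply: tvs_cvgZ; [exact: cvg_cst|]).
have [a0|a0] := eqVneq al 0.
  rewrite a0 scale0r scaler0.
  apply: (@cvg_trans _ ((fun=> 0) @
    within [set h | `[a, b]%classic (t + h)] (0 : R)^')); last exact: cvg_cst.
  apply: near_eq_cvg; near=> h.
  by rewrite affineD mulr0 addr0 subrr scaler0.
have H : (fun h => h * al) @ within [set h | `[a, b]%classic (t + h)] (0 : R)^' -->
    within [set h | `[a, b]%classic (affine al be t + h)] (0 : R)^'.
  move=> A; rewrite /within /= => HA.
  have := cvg_dnbhs0_mulr a0 HA; rewrite /nbhs /=; apply: filterS => h /= Ah th; apply: Ah.
  by move: th; rewrite !in_itv /= => /rP; rewrite affineD.
move: (cvg_comp _ _ H fl); apply: cvg_trans.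
apply: near_eq_cvg; near=> h.
rewrite /= affineD -scalerBr !scalerA; congr (_ *: _).
by rewrite invfM (mulrC h^-1 al^-1) mulrA mulfK// mulrC.
Unshelve. all: by end_near. Qed.

Definition jet (f : R -> lie_algebra G) (i : nat) : R -> lie_algebra G :=
  iter i (cderiv a b) f.

(** Limits being unique, it is enough to guess the successive derivatives. *)
Lemma jetE f (D : nat -> R -> E) s : (forall t, a <= t <= b -> D 0%N t = f t) ->
  (forall i t, (i < s)%N -> a <= t <= b -> wder (D i) t (D i.+1 t)) ->
  forall i t, (i <= s)%N -> a <= t <= b -> jet f i t = D i t.
Proof.
move=> D0 DS; elim=> [|i IH] t si tab; first by rewrite D0.
rewrite /jet iterS; apply: wderP => //.
apply: wder_eq (DS i t si tab) => // u uab; rewrite -IH//; exact: ltnW.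
Qed.

Definition jet_diff (s : nat) (f : R -> lie_algebra G) : Prop :=
  forall i t, (i < s)%N -> a <= t <= b -> wder (jet f i) t (jet f i.+1 t).

(** Outside [a, b] the iterated derivatives have arbitrary values, hence the
    composition with clamp. *)
Definition jet_cont (s : nat) (f : R -> lie_algebra G) : Prop :=
  forall i, (i <= s)%N -> continuous (jet f i \o clamp a b : R -> E).

Lemma jetB s f g i t : jet_diff s f -> jet_diff s g -> (i <= s)%N -> a <= t <= b ->
  jet (fun u => f u - g u) i t = jet f i t - jet g i t.
Proof.
move=> fd gd; apply: (@jetE _ (fun i t => jet f i t - jet g i t)) => // j u js uab.
by apply: wderB; [exact: fd|exact: gd].
Qed.

Lemma jet_affine s f al be i t : 0 <= al ->
  (forall u, a <= u <= b -> a <= affine al be u <= b) ->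
  jet_diff s f -> (i <= s)%N -> a <= t <= b ->
  jet (fun u => al *: f (affine al be u)) i t = al ^+ i.+1 *: jet f i (affine al be t).
Proof.
move=> al0 rP fd.
apply: (@jetE _ (fun i t => al ^+ i.+1 *: jet f i (affine al be t))) => // j u js uab.
rewrite [al ^+ j.+2]exprSr -scalerA; apply: wder_affine => //.
by apply: fd => //; exact: rP.
Qed.

Variable Xi : chart E G.
Hypotheses (Xi_chart : is_chart Xi) (Xi_dom : chart_dom Xi (1%g : G)).

Lemma Ck_on_jet s J (psi f : R -> E) : open_interval J -> `[a, b] `<=` J ->
  @Ck_on R R^o (lie_algebra G) s J psi ->
  (forall t, a <= t <= b -> f t = psi t) -> jet_diff s f /\ jet_cont s f.
Proof.
move=> [oJ _] abJ psiC e.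
pose D i : R -> E := iter_dderiv (psi : R^o -> E) (nseq i (1 : R^o)).
have DS i t : D i.+1 t = dderiv (D i : R^o -> E) t 1.
  by rewrite /D -iter_dderiv_rcons -addn1 nseqD cats1.
have Jab t : a <= t <= b -> J t by move=> tab; apply: abJ; rewrite /= in_itv.
have Dd i t : (i < s)%N -> a <= t <= b -> wder (D i) t (D i.+1 t).
  move=> si tab; apply: cder_wder; apply/cder_dderiv; rewrite DS.
  have [l Hl] := psiC.1 (nseq i 1) 1 t (ltac:(by rewrite size_nseq)) (Jab _ tab).
  by rewrite (dderivP hE Hl).
have D0 t : a <= t <= b -> D 0%N t = f t by move=> tab; rewrite e.
have jD := jetE D0 Dd.
have Dc i t : (i <= s)%N -> a <= t <= b -> {for t, continuous (D i)}.
  move=> si tab.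
  have nJ : nbhs (t : R^o, (fun=> 1) : {ptws 'I_i -> R^o}) (J `*` setT).
    exists (J, setT) => //; split; last exact: filterT.
    by apply: open_nbhs_nbhs; split => //; exact: Jab.
  have H := within_nbhsP nJ (psiC.2 i si).
  pose S (u : R^o) : R^o * {ptws 'I_i -> R^o} := (u, fun=> 1).
  have S1 : (fst \o S) @ nbhs (t : R^o) --> nbhs (t : R^o) by exact: cvg_id.
  have S2 : (snd \o S) @ nbhs (t : R^o) --> nbhs ((fun=> 1) : {ptws 'I_i -> R^o}).
    exact: cvg_cst.
  have T : S @ nbhs (t : R^o) --> nbhs (S t).
    exact: (@cvg_prod1 _ _ _ _ _ _ _ S S1 S2).
  have e1 : [seq (fun=> 1 : R^o) i0 | i0 <- enum 'I_i] = nseq i (1 : R^o).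
    rewrite -[in RHS](size_enum_ord i).
    by elim: (enum 'I_i) => //= ? ? ->.
  have := cvg_comp _ _ T H; rewrite /comp /= e1; exact.
split=> [i t si tab|i si t].
- apply: wder_eq (_ : wder (D i) t _) => //.
    by move=> u uab; rewrite jD// ltnW.
  by rewrite jD//; exact: Dd.
- have -> : (jet f i \o clamp a b : R -> E) = D i \o clamp a b.
    by apply/funext => u /=; rewrite jD// clamp_in// ltW.
  apply: continuous_comp; first exact: clamp_cont.
  by apply: Dc => //; apply: clamp_in; exact: ltW.
Qed.

(** In the Lipschitz case there are no derivatives to consider: s = 0, and
    continuity is all that is claimed. *)
Lemma Ck_curves_jet k s f : Ck_curves Xi k a b f -> reg_le s k ->
  jet_diff s f /\ jet_cont s f.
Proof.
have eab (psi : R -> E) : (forall t, `[a, b]%classic t -> f t = psi t) ->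
    forall t, a <= t <= b -> f t = psi t.
  by move=> e t tab; apply: e; rewrite /= in_itv.
case: k => [n||] /=.
- move=> [J [psi [oJ abJ [psiC1 psiC2] /eab e]]] sn.
  apply: (Ck_on_jet oJ abJ _ e); split=> [vs v x vss|p ps].
    by apply: psiC1; exact: leq_trans sn.
  by apply: psiC2; exact: leq_trans sn.
- move=> fL ->; split=> [//|i]; rewrite leqn0 => /eqP -> t.
  apply/cvg_snormP => q sq e e0.
  have [p sp pq] := snorm_dotted Xi_chart Xi_dom sq.
  have [L L0 HL] := fL p sp.
  have /cvgrPdist_lt/(_ (e / (L + 1))) := @clamp_cont _ a b t.
  have eL : 0 < e / (L + 1) by rewrite divr_gt0//; lra.
  move=> /(_ eL); apply: (@filterS _ (nbhs t)) => u.
  rewrite ltr_pdivlMr; last lra.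
  move=> H /=; rewrite -pq.
  have ci v : `[a, b]%classic (clamp a b v).
    by rewrite /= in_itv /=; apply: clamp_in; exact: ltW.
  apply: le_lt_trans (HL _ _ (ci u) (ci t)) _; rewrite distrC.
  apply: le_lt_trans H; rewrite mulrC ler_wpM2l//; lra.
- move=> [J [psi [oJ abJ psiC /eab e]]] _.
  by apply: (Ck_on_jet oJ abJ _ e); exact: psiC.
Qed.

Lemma sup_seminorm_le p s f (M : R) :
  (forall i t, (i <= s)%N -> a <= t <= b -> dotted Xi p (jet f i t) <= M) ->
  (sup_seminorm Xi p s a b f <= M%:E)%E.
Proof.
move=> H; apply: ge_ereal_sup => _ [i [t [si tab ->]]]; rewrite lee_fin.
by apply: H => //; move: tab; rewrite /= in_itv.
Qed.

Lemma sup_seminorm_ge p s f i t : (i <= s)%N -> a <= t <= b ->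
  ((dotted Xi p (jet f i t))%:E <= sup_seminorm Xi p s a b f)%E.
Proof.
move=> si tab; apply: ereal_sup_ubound; exists i, t; split=> //.
Qed.

End OneSidedDerivatives.

(** * Product integrals of nearby curves *)

Section Perturbation.
Context {R : realType} {E : tvsType R} {G : lieGroupType E}.
Variable Xi : chart E G.
Hypotheses (Xi_chart : is_chart Xi) (Xi_dom : chart_dom Xi (1%g : G)).
Variable k : regularity.
Hypotheses (G_cont : k_continuous Xi k) (G_semireg : semiregular Xi k).
Variables r r' : R.
Hypothesis rr' : r < r'.
Variable I : set R.
Hypothesis I_itv : open_interval I.
Variable Phi : R -> R -> lie_algebra G.
Hypothesis Phi_Ck : forall z, I z -> Ck_curves Xi k r r' (Phi z).
Variable x : R.
Hypothesis Ix : I x.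
Hypothesis Phi_bound : forall (p : E -> R) (s : nat),
     continuous_seminorm p -> reg_le s k ->
     exists (L : R) (J : set R),
       [/\ 0 <= L, open_interval J, J `<=` I, J x &
           forall h : R, h != 0 -> J (x + h) ->
             (`|h|^-1%:E *
                sup_seminorm Xi p s r r' (fun t => (Phi (x + h) t - Phi x t)%R)
              <= L%:E)%E].

Let rr : r <= r' := ltW rr'.

Lemma near_open_interval (J : set R) : open_interval J -> J x ->
  \forall h \near (0 : R), J (x + h).
Proof.
move=> [oJ _] Jx; have H : (fun h : R => x + h) @ (0 : R) --> x.
  by rewrite -[X in _ --> X]addr0; apply: cvgD; [exact: cvg_cst|exact: cvg_id].
exact: (H _ (open_nbhs_nbhs (conj oJ Jx))).
Qed.

(** The hypothesis on the difference quotients, for each derivative at each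
    point; the case h = 0 is included. *)
Lemma jet_bound p s : continuous_seminorm p -> reg_le s k ->
  exists2 L, 0 <= L & \forall h \near (0 : R), forall i t, (i <= s)%N -> r <= t <= r' ->
    dotted Xi p (jet r r' (Phi (x + h)) i t - jet r r' (Phi x) i t) <= `|h| * L.
Proof.
move=> sp sk; have [L [J [L0 iJ JI Jx H]]] := Phi_bound sp sk.
have sd := dotted_snorm Xi_chart Xi_dom sp.
exists L => //; apply: filterS (near_open_interval iJ Jx) => h Jh i t si tr.
have [->|h0] := eqVneq h 0; first by rewrite addr0 subrr snorm0// normr0 mul0r.
have [d1 _] := Ck_curves_jet rr' Xi_chart Xi_dom (Phi_Ck (JI _ Jh)) sk.
have [d2 _] := Ck_curves_jet rr' Xi_chart Xi_dom (Phi_Ck Ix) sk.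
rewrite -(jetB rr' d1 d2)//.
have := H h h0 Jh; rewrite lee_pdivrMl ?normr_gt0// => H1.
by rewrite -lee_fin EFinM; apply: le_trans H1; exact: sup_seminorm_ge.
Qed.

Let lam (t : R) : R := (t - r) / (r' - r).
(* gam t h is the restriction of Phi (x + h) to [r, t], stretched to [r, r'];
   for t = r it is the constant curve 0. *)
Let gam (t h : R) : R -> lie_algebra G :=
  fun s => lam t *: Phi (x + h) (affine (lam t) (r - lam t * r) s).

Let lam_ge0 t : r <= t <= r' -> 0 <= lam t.
Proof. by move=> /andP[rt tr]; rewrite /lam divr_ge0// subr_ge0. Qed.

Let lam_le1 t : r <= t <= r' -> lam t <= 1.
Proof.
by move=> /andP[rt tr]; rewrite /lam ler_pdivrMr ?subr_gt0// mul1r lerB.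
Qed.

Let lam_in t : r <= t <= r' -> forall u, r <= u <= r' ->
  r <= affine (lam t) (r - lam t * r) u <= r'.
Proof.
move=> tr u /andP[ru ur]; have := lam_ge0 tr; have := lam_le1 tr.
by rewrite /affine => l1 l0; apply/andP; split; nra.
Qed.

Let lam_end t : affine (lam t) (r - lam t * r) r' = t.
Proof. by rewrite /affine /lam; field; rewrite subr_eq0 gt_eqF. Qed.

Let integrable z : I z -> integrable_curves r r' (Phi z).
Proof.
by move=> Iz; exact: (semiregular_integrable Xi_chart Xi_dom G_semireg rr' (Phi_Ck Iz)).
Qed.

Let gam_integrable t h : r <= t <= r' -> I (x + h) -> Ck_integrable Xi k r r' (gam t h).
Proof.
move=> tr Ih.
have C := Ck_curves_affine Xi_chart Xi_dom (lam_ge0 tr) (lam_in tr) (lam t) (Phi_Ck Ih).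
by split => //; exact: (semiregular_integrable Xi_chart Xi_dom G_semireg rr' C).
Qed.

Let prodint_gam t h : r <= t <= r' -> I (x + h) ->
  prodint r r' (gam t h) r' = prodint r r' (Phi (x + h)) t :> G.
Proof.
move=> tr Ih; rewrite /gam prodint_affine ?lam_end//; first by rewrite lam_ge0// lam_le1.
exact: integrable.
Qed.

(* The i-th jet of gam t 0, extended to all t and u. *)
Let jext i (q : R * R) : E := lam q.2 ^+ i.+1 *:
  (jet r r' (Phi x) i \o clamp r r') (lam q.2 * q.1 + (r - lam q.2 * r)).

Let lam_cont : continuous (lam : R -> R).
Proof.
move=> t; rewrite /lam; apply: cvgM; last exact: cvg_cst.
by apply: cvgB; [exact: cvg_id|exact: cvg_cst].
Qed.

Let jext_cont s i : reg_le s k -> (i <= s)%N -> continuous (jext i).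
Proof.
move=> sk si [u t].
have [_ jc] := Ck_curves_jet rr' Xi_chart Xi_dom (Phi_Ck Ix) sk.
have lc : (fun q : R * R => lam q.2) @ (u, t) --> lam t.
  exact: (cvg_comp _ _ (pair_snd_cvg u t) (lam_cont (x := t))).
apply: tvs_cvgZ => /=.
  have : (fun l : R => l ^+ i.+1) @ lam t --> lam t ^+ i.+1 by exact: exprn_continuous.
  exact: (cvg_comp _ _ lc).
have ac : (fun q : R * R => lam q.2 * q.1 + (r - lam q.2 * r)) @ (u, t) -->
    lam t * u + (r - lam t * r).
  apply: cvgD; first by apply: cvgM => //; exact: pair_fst_cvg.
  by apply: cvgB; [exact: cvg_cst|apply: cvgM => //; exact: cvg_cst].
exact: (cvg_comp _ _ ac (jc i si _)).
Qed.

(* The variation of the jets with t is uniform in u, as [r, r'] is compact. *)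
Let jext_unif s i p t0 e : reg_le s k -> (i <= s)%N ->
  @continuous_seminorm R E p -> 0 < e ->
  \forall t \near t0, forall u, r <= u <= r' -> p (jext i (u, t) - jext i (u, t0)) < e.
Proof.
move=> sk si sp e0.
have e20 : 0 < e / 2 by lra.
have /compact_near_coveringP cK := @segment_compact R r r'.
suff loc (u0 : R) : \forall u \near u0 & t \near t0, p (jext i (u, t) - jext i (u, t0)) < e.
  have : \forall t \near t0, `[r, r'] `<=` (fun u => p (jext i (u, t) - jext i (u, t0)) < e).
    apply: (cK _ (nbhs t0) (fun t u => p (jext i (u, t) - jext i (u, t0)) < e)).
    by move=> u0 _; exact: loc.
  by apply: (@filterS _ (nbhs t0)) => t H u ur; apply: H; rewrite /= in_itv.
have J0 : jext i @ (u0, t0) --> jext i (u0, t0) := @jext_cont s i sk si (u0, t0).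
have H1 : \forall q \near (u0, t0), p (jext i q - jext i (u0, t0)) < e / 2.
  exact: (cvg_snorm_lt sp e20 J0).
have H2 : \forall q \near (u0, t0), p (jext i (q.1, t0) - jext i (u0, t0)) < e / 2.
  have C : (fun q : R * R => (q.1, t0)) @ (u0, t0) --> (u0, t0).
    by apply: cvg_prod1; [exact: pair_fst_cvg|exact: cvg_cst].
  exact: (C _ H1).
apply: filterS2 H1 H2 => -[u t] /= H1 H2.
have := snormD sp (jext i (u, t) - jext i (u0, t0)) (jext i (u0, t0) - jext i (u, t0)).
rewrite addrA subrK (snormBC sp (jext i (u0, t0))); lra.
Qed.

Let jet_gam s t h i u : reg_le s k -> (i <= s)%N -> r <= t <= r' -> I (x + h) ->
  r <= u <= r' ->
  jet r r' (gam t h) i u =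
  lam t ^+ i.+1 *: (jet r r' (Phi (x + h)) i (affine (lam t) (r - lam t * r) u)).
Proof.
move=> sk si tr Ih ur.
have [d _] := Ck_curves_jet rr' Xi_chart Xi_dom (Phi_Ck Ih) sk.
by rewrite /gam (jet_affine rr' (lam_ge0 tr) (lam_in tr) d).
Qed.

Let I0 : I (x + 0). Proof. by rewrite addr0. Qed.

(* The distance from gam t h to gam t0 0 is at most that from Phi (x + h) to
   Phi x, as lam t <= 1, plus that from gam t 0 to gam t0 0. *)
Let gam_close p s t0 e : continuous_seminorm p -> reg_le s k -> r <= t0 <= r' -> 0 < e ->
  \forall q \near (t0, 0 : R), r <= q.1 <= r' ->
    (sup_seminorm Xi p s r r' (fun u => gam q.1 q.2 u - gam t0 0 u)%R < e%:E)%E.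
Proof.
move=> sp sk t0r e0.
have sd := dotted_snorm Xi_chart Xi_dom sp.
have [L L0 HL] := jet_bound sp sk.
have e40 : 0 < e / 4 by lra.
have Hh : \forall h \near (0 : R), `|h| * L < e / 4.
  have : (fun h : R => `|h| * L) @ (0 : R) --> (0 : R).
    have := cvgM (@norm_continuous _ R (0 : R)) (cvg_cst L).
    by rewrite normr0 mul0r => /(_ _ _); apply.
  by move=> /(_ [set z | z < e / 4]); apply; exact: lt_nbhsl.
have Ht : \forall t \near t0, forall i : 'I_s.+1, forall u, r <= u <= r' ->
    dotted Xi p (jext i (u, t) - jext i (u, t0)) < e / 4.
  apply: (@filter_forall _ 'I_s.+1 (fun i t => forall u, r <= u <= r' ->
    dotted Xi p (jext i (u, t) - jext i (u, t0)) < e / 4) (nbhs t0)) => i.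
  by apply: (@jext_unif s) => //; rewrite -ltnS.
have N1 : \forall q \near (t0, 0 : R), [/\ `|q.2| * L < e / 4, I (x + q.2) &
    forall i t, (i <= s)%N -> r <= t <= r' ->
    dotted Xi p (jet r r' (Phi (x + q.2)) i t - jet r r' (Phi x) i t) <= `|q.2| * L].
  have := pair_snd_cvg t0 (0 : R).
  move=> /(_ [set h | [/\ `|h| * L < e / 4, I (x + h) &
    forall i t, (i <= s)%N -> r <= t <= r' ->
    dotted Xi p (jet r r' (Phi (x + h)) i t - jet r r' (Phi x) i t) <= `|h| * L]]).
  by apply; apply: filterS3 Hh (near_open_interval I_itv Ix) HL => h; split.
have N2 := pair_fst_cvg t0 (0 : R) _ Ht.
apply: (@filterS2 _ (nbhs (t0, 0 : R)) _ _ _ _ _ N1 N2) => -[t h] /= [hL Ih Hj] Hc tr.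
apply: (@le_lt_trans _ _ (e / 2)%:E); last by rewrite lte_fin; lra.
have [d1 _] := Ck_curves_jet rr' Xi_chart Xi_dom (gam_integrable tr Ih).2 sk.
have [d2 _] := Ck_curves_jet rr' Xi_chart Xi_dom (gam_integrable t0r I0).2 sk.
apply: sup_seminorm_le => i u si ur.
rewrite (jetB rr' d1 d2)// (jet_gam sk)// (jet_gam sk)// addr0.
have := Hc (Ordinal (si : (i < s.+1)%N)) u ur; rewrite /jext /=.
rewrite !clamp_id//; [|exact: (lam_in t0r)|exact: (lam_in tr)].
have := Hj i _ si (lam_in tr ur).
rewrite -/(affine (lam t) (r - lam t * r) u) -/(affine (lam t0) (r - lam t0 * r) u).
set v := affine (lam t) _ u; set v0 := affine (lam t0) _ u => Hjv Hcv.
set A := jet r r' (Phi (x + h)) i v; set B := jet r r' (Phi x) i v.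
set C := jet r r' (Phi x) i v0; set l := lam t; set l0 := lam t0.
have -> : l ^+ i.+1 *: A - l0 ^+ i.+1 *: C =
    l ^+ i.+1 *: (A - B) + (l ^+ i.+1 *: B - l0 ^+ i.+1 *: C).
  by rewrite scalerBr addrA subrK.
apply: le_trans (snormD sd _ _) _; rewrite (snormZ sd).
have lp : `|l ^+ i.+1| <= 1.
  rewrite normrX ger0_norm ?lam_ge0// exprn_ile1// ?lam_ge0//; exact: lam_le1.
have ab0 : 0 <= dotted Xi p (A - B) := snorm_ge0 sd _.
have := ler_wpM2r ab0 lp; rewrite mul1r; lra.
Qed.

(** By rescaling, the product integral of Phi (x + h) up to t is one over the
    whole interval, to which k-continuity applies: the rescaled curves converge
    in the C^k-topology as (t, h) tends to (t0, 0). *)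
Lemma cvg_prodint t0 (U : set G) : r <= t0 <= r' -> nbhs (prodint r r' (Phi x) t0) U ->
  \forall q \near (t0, 0 : R), r <= q.1 <= r' -> U (prodint r r' (Phi (x + q.2)) q.1).
Proof.
move=> t0r nU.
have := @G_cont r r' rr' _ (gam_integrable t0r I0).
rewrite prodint_gam// addr0 => /(_ U nU).
rewrite /within /nbhs /= => -[n [p [s [e [sps e0 H]]]]].
have N : \forall q \near (t0, 0 : R), forall i : 'I_n, r <= q.1 <= r' ->
    (sup_seminorm Xi (p i) (s i) r r' (fun u => gam q.1 q.2 u - gam t0 0 u)%R < e%:E)%E.
  apply: (@filter_forall _ 'I_n (fun i (q : R * R) => r <= q.1 <= r' ->
    (sup_seminorm Xi (p i) (s i) r r' (fun u => gam q.1 q.2 u - gam t0 0 u)%R < e%:E)%E)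
    (nbhs (t0, 0 : R))) => i.
  by have [sp sk] := sps i; exact: gam_close.
have NI : \forall q \near (t0, 0 : R), I (x + q.2).
  exact: (pair_snd_cvg t0 (0 : R) _ (near_open_interval I_itv Ix)).
apply: (@filterS2 _ (nbhs (t0, 0 : R)) _ _ _ _ _ N NI) => -[t h] /= Hn Ih tr.
rewrite -prodint_gam//; apply: (H (gam t h)) => [i|]; first exact: Hn.
exact: gam_integrable.
Qed.

(** The local statement cvg_prodint becomes uniform by compactness of [r, r']. *)
Lemma near_quot_unif (U : set G) : nbhs (1%g : G) U ->
  \forall h \near (0 : R), forall t, r <= t <= r' ->
    U ((prodint r r' (Phi x) t)^-1 * prodint r r' (Phi (x + h)) t)%g.
Proof.
move=> nU.
have /compact_near_coveringP/near_covering_withinP cK := @segment_compact R r r'.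
pose P h t := U ((prodint r r' (Phi x) t)^-1 * prodint r r' (Phi (x + h)) t)%g.
suff loc (t0 : R) : `[r, r']%classic t0 ->
    \forall t \near t0 & h \near (0 : R), `[r, r']%classic t -> P h t.
  have : \forall h \near (0 : R), `[r, r'] `<=` P h by exact: (cK _ (nbhs (0 : R)) P).
  by apply: (@filterS _ (nbhs (0 : R))) => h H t tr; apply: H; rewrite /= in_itv.
rewrite /= in_itv /= => t0r.
set g := prodint r r' (Phi x) t0.
have M : (fun q : G * G => (q.1^-1 * q.2)%g) @ (g, g) --> (1%g : G).
  rewrite -[X in _ --> X](mulVg g); apply: cvg_mulg; last exact: pair_snd_cvg.
  by apply: cvg_invg; exact: pair_fst_cvg.
have [[A B] /= [nA nB] AB] := M U nU.
have gc : {for t0, continuous (prodint r r' (Phi x) : R -> G)}.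
  exact: logder_cont (prodint_logder (integrable Ix) t0r).
have N1 := pair_fst_cvg t0 (0 : R) _ (gc _ nA).
have N2 := cvg_prodint t0r nB.
apply: (@filterS2 _ (nbhs (t0, 0 : R)) _ _ _ _ _ N1 N2) => -[t h] /= At Bt tr.
by apply: (AB (_, _)); split => //=; apply: Bt; move: tr; rewrite in_itv.
Qed.

End Perturbation.

(** * Riemann integrals in completions *)

Section RiemannSums.
Context {R : realType}.
Variables a b : R.
Hypothesis ab : a <= b.

Definition subdivision (d : R) (n : nat) (s tau : nat -> R) : Prop :=
  [/\ s 0%N = a, s n = b & forall i, (i < n)%N ->
    [/\ s i <= tau i, tau i <= s i.+1 & s i.+1 - s i < d]].

Definition riemann_sum {V : lmodType R} (f : R -> V) n (s tau : nat -> R) : V :=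
  \sum_(i < n) (s i.+1 - s i) *: f (tau i).

Lemma subdivision_le d n s tau i j :
  subdivision d n s tau -> (i <= j)%N -> (j <= n)%N -> s i <= s j.
Proof.
move=> [_ _ H]; elim: j => [|j IH]; first by rewrite leqn0 => /eqP ->.
rewrite leq_eqVlt => /predU1P[-> //|]; rewrite ltnS => ij jn.
by have [h1 h2 _] := H j jn; apply: (le_trans (IH ij (ltnW jn))); exact: le_trans h2.
Qed.

Lemma subdivision_in d n s tau i : subdivision d n s tau -> (i <= n)%N -> a <= s i <= b.
Proof.
move=> H ni; have [s0 sn _] := H.
by rewrite -{1}s0 -sn (subdivision_le H)// (subdivision_le H).
Qed.

Lemma subdivision_tag d n s tau i : subdivision d n s tau -> (i < n)%N -> a <= tau i <= b.
Proof.
move=> H ni; have [_ _ /(_ i ni)[h1 h2 _]] := H.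
have /andP[? _] := subdivision_in H (ltnW ni); have /andP[_ ?] := subdivision_in H ni.
by apply/andP; split; [exact: le_trans h1|exact: le_trans h2 _].
Qed.

Lemma subdivision_exists d : 0 < d -> exists n s, subdivision d n s s.
Proof.
move=> d0; have := archi_boundP (_ : 0 <= (b - a) / d).
rewrite divr_ge0 ?subr_ge0 ?(ltW d0)// => /(_ isT).
set n := Num.bound _ => nd.
have n0 : 0 < n%:R :> R by apply: le_lt_trans nd; rewrite divr_ge0 ?subr_ge0 ?(ltW d0).
exists n, (fun i => a + (b - a) / n%:R * i%:R); split.
- by rewrite mulr0 addr0.
- by rewrite mulfVK ?gt_eqF// addrC subrK.
- move=> i ni; split => //.
    by rewrite lerD2l ler_wpM2l ?divr_ge0 ?subr_ge0 ?ler_nat// ltW.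
  rewrite opprD addrACA subrr add0r -mulrBr -natrB// subSnn mulr1.
  by rewrite ltr_pdivrMr// mulrC -ltr_pdivrMr.
Qed.

(** The length of the intersection of [u, v] and [s, t]. *)
Definition overlap (u v s t : R) : R := clamp u v t - clamp u v s.

Lemma overlapC u v s t : u <= v -> s <= t -> overlap u v s t = overlap s t u v.
Proof.
move=> uv st; rewrite /overlap.
have [?|? ?|?] := clampP uv t; have [?|? ?|?] := clampP uv s;
have [?|? ?|?] := clampP st u; have [?|? ?|?] := clampP st v;
lra.
Qed.

Lemma overlap_ge0 u v s t : u <= v -> s <= t -> 0 <= overlap u v s t.
Proof.
move=> uv st; rewrite /overlap.
have [?|? ?|?] := clampP uv t; have [?|? ?|?] := clampP uv s;
lra.
Qed.

Lemma overlap_eq0 u v s t : u <= v -> s <= t -> v <= s \/ t <= u -> overlap u v s t = 0.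
Proof.
move=> uv st H; rewrite /overlap.
have [?|? ?|?] := clampP uv t; have [?|? ?|?] := clampP uv s;
case: H => H; lra.
Qed.

Lemma sum_overlap d n s tau u v : subdivision d n s tau -> a <= u -> u <= v -> v <= b ->
  \sum_(i < n) overlap u v (s i) (s i.+1) = v - u.
Proof.
move=> [s0 sn _] au uv vb; rewrite /overlap.
rewrite -(big_mkord xpredT (fun i => clamp u v (s i.+1) - clamp u v (s i))).
rewrite telescope_sumr// sn s0.
have [?|? ?|?] := clampP uv a; have [?|? ?|?] := clampP uv b;
lra.
Qed.

(** Both sums are written over the intersections of the intervals of the two
    subdivisions, where the two tags are close to one another. *)
Lemma riemann_sum_close {V : tvsType R} (p : V -> R) (f : R -> V) d e n s tau n' s' tau' :
  continuous_seminorm p -> 0 <= e ->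
  (forall t t', a <= t <= b -> a <= t' <= b -> `|t - t'| < d + d -> p (f t - f t') <= e) ->
  subdivision d n s tau -> subdivision d n' s' tau' ->
  p (riemann_sum f n s tau - riemann_sum f n' s' tau') <= e * (b - a).
Proof.
move=> sp e0 fu T T'.
pose o (i j : nat) := overlap (s i) (s i.+1) (s' j) (s' j.+1).
have si i : (i < n)%N -> s i <= s i.+1 by move=> ni; exact: (subdivision_le T).
have sj j : (j < n')%N -> s' j <= s' j.+1 by move=> nj; exact: (subdivision_le T').
have oi i : (i < n)%N -> \sum_(j < n') o i j = s i.+1 - s i.
  move=> ni; apply: (sum_overlap T') => //; last by have /andP[] := subdivision_in T ni.
    by have /andP[] := subdivision_in T (ltnW ni).
  exact: si.
have oj j : (j < n')%N -> \sum_(i < n) o i j = s' j.+1 - s' j.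
  move=> nj; under eq_bigr => i _ do rewrite /o overlapC ?si ?sj//.
  apply: (sum_overlap T) => //; last by have /andP[] := subdivision_in T' nj.
    by have /andP[] := subdivision_in T' (ltnW nj).
  exact: sj.
have -> : riemann_sum f n s tau - riemann_sum f n' s' tau' =
    \sum_(i < n) \sum_(j < n') o i j *: (f (tau i) - f (tau' j)).
  rewrite /riemann_sum.
  under eq_bigr => i _ do rewrite -oi// scaler_suml.
  under [X in _ - X]eq_bigr => j _ do rewrite -oj// scaler_suml.
  rewrite [X in _ - X]exchange_big /= -sumrB; apply: eq_bigr => i _.
  by rewrite -sumrB; apply: eq_bigr => j _; rewrite scalerBr.
have -> : e * (b - a) = \sum_(i < n) \sum_(j < n') o i j * e.
  under eq_bigr => i _ do rewrite -mulr_suml oi//.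
  rewrite -mulr_suml mulrC; congr (_ * _).
  have [s0 sn _] := T.
  by rewrite -(big_mkord xpredT (fun i => s i.+1 - s i)) telescope_sumr// sn s0.
pose Fi i : V := \sum_(j < n') o i j *: (f (tau i) - f (tau' j)).
apply: le_trans (snorm_sum sp n Fi) _; apply: ler_sum => i _; rewrite /Fi.
pose Fj j : V := o i j *: (f (tau i) - f (tau' j)).
apply: le_trans (snorm_sum sp n' Fj) _; apply: ler_sum => j _; rewrite /Fj.
have ni := ltn_ord i; have nj := ltn_ord j.
have o0 : 0 <= o i j by rewrite overlap_ge0 ?si ?sj.
rewrite snormZ// ger0_norm//.
have [h|h] := leP (s i.+1) (s' j).
  by rewrite /o overlap_eq0 ?mul0r ?si ?sj//; left.
have [h'|h'] := leP (s' j.+1) (s i).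
  by rewrite /o overlap_eq0 ?mul0r ?si ?sj//; right.
rewrite ler_wpM2l// fu//; [exact: (subdivision_tag T)|exact: (subdivision_tag T')|].
have [_ _ /(_ i ni)[h1 h2 h3]] := T; have [_ _ /(_ j nj)[h4 h5 h6]] := T'.
by rewrite ltr_norml; apply/andP; split; lra.
Qed.

Lemma unif_continuous_itv {V : tvsType R} (p : V -> R) (f : R -> V) e :
  continuous_seminorm p -> continuous (f \o clamp a b) -> 0 < e ->
  exists2 d, 0 < d & forall t t', a <= t <= b -> a <= t' <= b -> `|t - t'| < d ->
    p (f t - f t') <= e.
Proof.
move=> sp fc e0; have e20 : 0 < e / 2 by lra.
pose P (d : R) (t : R) := forall t', a <= t' <= b -> `|t - t'| < d ->
  p ((f \o clamp a b) t - (f \o clamp a b) t') <= e.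
have /compact_near_coveringP cK := @segment_compact R a b.
suff loc (t0 : R) : \forall t \near t0 & d \near (0 : R)^'+, P d t.
  have : \forall d \near (0 : R)^'+, `[a, b] `<=` P d by apply: (cK _ _ P) => t _; exact: loc.
  move=> H; have [d [d0 Hd]] : exists d : R, 0 < d /\ `[a, b] `<=` P d.
    have d0 : \forall d \near (0 : R)^'+, 0 < d by exact: nbhs_right_gt.
    exact: (filter_ex (filterI d0 H)).
  exists d => // t t' tab tab' tt'.
  have := Hd t _ t' tab' tt'; rewrite /= !clamp_id//; apply.
  by rewrite in_itv.
have [c /= c0 Hc] := cvg_snorm_lt sp e20 (fc t0).
exists (ball t0 (c / 2), [set d | d < c / 2]).
  split; first by apply: nbhsx_ballx; lra.
  by apply: nbhs_right_lt; lra.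
move=> [t d] /= [tc dc] t' _ tt'.
have H1 := Hc t; have H2 := Hc t'.
have := snormD sp ((f \o clamp a b) t - (f \o clamp a b) t0)
  ((f \o clamp a b) t0 - (f \o clamp a b) t').
rewrite addrA subrK (snormBC sp ((f \o clamp a b) t0)).
have {}H1 : p ((f \o clamp a b) t - (f \o clamp a b) t0) < e / 2.
  by apply: H1; apply: lt_le_trans tc _; lra.
have {}H2 : p ((f \o clamp a b) t' - (f \o clamp a b) t0) < e / 2.
  apply: H2; rewrite /ball /= (_ : t0 - t' = (t0 - t) + (t - t')); last by ring.
  by apply: le_lt_trans (ler_normD _ _) _; move: tc; rewrite /ball /=; lra.
lra.
Qed.

(** The Riemann sums of the subdivisions of small mesh form a Cauchy filter. *)
Lemma Riemann_integral_exists (V : tvsType R) (f : R -> V) :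
  (forall A : set_system V, ProperFilter A -> tvs_cauchy A -> exists l : V, A --> l) ->
  continuous (f \o clamp a b) -> exists Z, is_Riemann_integral f a b Z.
Proof.
move=> complV fc.
pose base d := [set z | exists n s tau, subdivision d n s tau /\ z = riemann_sum f n s tau].
pose A : set_system V := filter_from [set d : R | 0 < d] base.
have AP : ProperFilter A.
  apply: filter_from_proper; last first.
    move=> d /= d0; have [n [s T]] := subdivision_exists d0.
    by exists (riemann_sum f n s s), n, s, s.
  apply: filter_from_filter; first by exists 1 => /=.
  move=> d d' /= d0 d0'; exists (Num.min d d'); first by rewrite /= lt_min d0.
  move=> z [n [s [tau [[s0 sn H] ->]]]]; split; exists n, s, tau; split => //; split => // i ni.
    by have [h1 h2 h3] := H i ni; split => //; apply: lt_le_trans h3 _; rewrite ge_min lexx.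
  by have [h1 h2 h3] := H i ni; split => //; apply: lt_le_trans h3 _; rewrite ge_min lexx orbT.
have [|Z AZ] := complV A AP.
  move=> U /nbhs0_snorm[p sp pU].
  have ba0 : 0 < b - a + 1 by rewrite ltr_wpDl// subr_ge0.
  have e0 : 0 < (b - a + 1)^-1 by rewrite invr_gt0.
  have [d d0 Hd] := unif_continuous_itv sp fc e0.
  exists (base (d / 2)); first by exists (d / 2) => //=; lra.
  move=> _ _ [n [s [tau [T ->]]]] [n' [s' [tau' [T' ->]]]].
  apply: pU => /=; apply: le_lt_trans (riemann_sum_close sp (ltW e0) _ T T') _.
    by move=> t t' ht ht' htt'; apply: Hd => //; lra.
  by rewrite mulrC ltr_pdivrMr// mul1r; lra.
exists Z => U /AZ[d /= d0 H]; exists d => // n s tau s0 sn T.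
by apply: H; exists n, s, tau; split.
Qed.

End RiemannSums.

Section Completions.
Context {R : realType} {E F : tvsType R}.
Variables (cE : completion E) (cF : completion F).

Lemma compl_inj_cont : continuous (compl_inj cE).
Proof. by move=> v B Bv; apply/compl_embedding; exists B. Qed.

Lemma compl_inj_snorm (p : cE -> R) : continuous_seminorm p ->
  continuous_seminorm (p \o compl_inj cE).
Proof.
move=> sp; apply: snorm_comp => //; last exact: compl_inj_cont.
- by move=> v w; rewrite linearD.
- by move=> k v; rewrite linearZ.
Qed.

Lemma compl_filter_proper (Z : cE) :
  ProperFilter (filter_from (nbhs Z) (fun B => compl_inj cE @^-1` B)).
Proof.
apply: filter_from_proper; last first.
  move=> B; rewrite nbhsE => -[C [oC CZ] CB].
  have [] := @compl_dense _ _ cE C _ oC; first by exists Z.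
  by move=> z [Cz [v _ vz]]; exists v; apply: CB; rewrite /= vz.
apply: filter_from_filter; first by exists setT; exact: filterT.
by move=> B C BZ CZ; exists (B `&` C) => //; exact: filterI.
Qed.

Variable f : E -> F.
Hypotheses (fD : forall v w, f (v + w) = f v + f w)
  (fZ : forall (k : R) v, f (k *: v) = k *: f v) (fc : continuous f).

(** Z is a limit of points of E, whose images under f form a Cauchy filter. *)
Lemma compl_ext_cvg (Z : cE) :
  compl_inj cF (f v) @[v --> filter_from (nbhs Z) (fun B => compl_inj cE @^-1` B)]
    --> compl_ext cF f Z.
Proof.
have FP := compl_filter_proper Z.
set A := fmap _ _.
suff [W HW] : exists W : cF, A --> W.
  by rewrite /compl_ext; case: xgetP => [W' _ //|/(_ W)].
apply: compl_complete => U U0.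
have [p sp pU] := nbhs0_snorm U0.
have sq : continuous_seminorm ((p \o compl_inj cF) \o f).
  apply: snorm_comp => //; apply: snorm_comp => //; last 1 first.
  - by move=> v B Bv; apply/compl_embedding; exists B.
  - by move=> v w; rewrite linearD.
  - by move=> k v; rewrite linearZ.
have /(compl_embedding cE)[B] := nbhs_snorm_lt sq ltr01.
rewrite linear0 => nB Bq.
have : (fun z : cE * cE => z.1 - z.2) @ (Z, Z) --> (0 : cE).
  by rewrite -(subrr Z); apply: tvs_cvgB; [exact: pair_fst_cvg|exact: pair_snd_cvg].
move=> /(_ _ nB)[[M N] /= [nM nN] MN].
exists (compl_inj cF @` (f @` (compl_inj cE @^-1` (M `&` N)))).
  exists (M `&` N); first exact: filterI.
  by move=> v Mv; exists (f v) => //; exists v.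
move=> _ _ [_ [v [Mv Nv] <-] <-] [_ [w [Mw Nw] <-] <-].
apply: pU; rewrite /= -linearB.
have -> : f v - f w = f (v - w) by rewrite fD -[in RHS]scaleN1r fZ scaleN1r.
apply: Bq; rewrite /= linearB.
exact: (MN (_, _)).
Qed.

Lemma compl_ext_Riemann_integral (g : R -> E) a b (Z : cE) :
  is_Riemann_integral (fun s => compl_inj cE (g s)) a b Z ->
  is_Riemann_integral (fun s => compl_inj cF (f (g s))) a b (compl_ext cF f Z).
Proof.
move=> gZ U /compl_ext_cvg[B nB BU].
have [d d0 H] := gZ B nB; exists d => // n s tau s0 sn T.
have f0 : f 0 = 0 by rewrite -(scale0r 0) fZ scale0r.
have -> : \sum_(i < n) (s i.+1 - s i) *: compl_inj cF (f (g (tau i))) =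
    compl_inj cF (f (\sum_(i < n) (s i.+1 - s i) *: g (tau i))).
  rewrite (big_morph f fD f0) linear_sum; apply: eq_bigr => i _.
  by rewrite fZ linearZ.
apply: BU; rewrite /= linear_sum.
under eq_bigr do rewrite linearZ.
exact: H.
Qed.

End Completions.

(** * Bounded convergence *)

Section BoundedConvergence.
Context {R : realType}.
Let mu := @lebesgue_measure R.

Lemma continuous_integrable_itv (g : R -> R) (a b : R) : continuous g ->
  mu.-integrable `[a, b] (EFin \o g).
Proof.
move=> gc; apply: continuous_compact_integrable; first exact: segment_compact.
exact: continuous_subspaceT.
Qed.

Lemma cder_primitive (g : R -> R) (c t : R) : continuous g -> c < t ->
  @cder R R^o (fun u => \int[mu]_(s in `[c, u]) g s)%R t (g t).
Proof.
move=> gc ct; have tu : t < t + 1 by lra.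
have [gd <-] := continuous_FTC1_closed tu (continuous_integrable_itv c (t + 1) gc) ct (gc t).
set F := (fun u => _) in gd *.
rewrite /derive1 /cder.
have -> : (fun h : R => h^-1 *: ((F : R -> R^o) (t + h) - F t)) =
    (fun h => h^-1 *: (F (h + t) - F t)) by apply/funext => h; rewrite (addrC t).
move: gd; rewrite /derivable.
have -> : (fun h : R => h^-1 *: (((F : R -> R^o) \o shift t) (h *: (1 : R^o)) - F t)) =
    (fun h => h^-1 *: (F (h + t) - F t)).
  by apply/funext => h; rewrite /= [h *: _](mulr1 h).
exact.
Qed.

Lemma cvg_integral0 (g : R -> R -> R) (a b M : R) :
  (forall h, continuous (g h)) -> (forall h s, 0 <= g h s <= M) ->
  (forall s, g h s @[h --> (0 : R)^'] --> (0 : R)) ->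
  (\int[mu]_(s in `[a, b]) g h s)%R @[h --> (0 : R)^'] --> (0 : R).
Proof.
move=> gc gM g0; apply/cvgr_dnbhsP => u [u0 uc].
have mD : measurable (`[a, b] : set (measurableTypeR R)) by exact: measurable_itv.
have [] := @dominated_convergence _ _ _ mu `[a, b] mD (fun n => EFin \o g (u n))
  (cst 0%E) (cst M%:E).
- by move=> n; apply: measurable_int (continuous_integrable_itv a b (gc (u n))).
- exact: measurable_cst.
- apply: aeW => s _; apply/cvg_EFin; first by near=> n.
  by have /cvgr_dnbhsP := g0 s; apply.
- exact: continuous_integrable_itv (fun s => cvg_cst M).
- apply: aeW => s n _ /=; rewrite lee_fin ger0_norm; by have /andP[] := gM (u n) s.
move=> _ _; rewrite integral_cst// mul0e => H.
exact: fine_cvg.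
Unshelve. all: by end_near. Qed.

End BoundedConvergence.

(** * The derivative of the product integral *)

(** An increment compared with a Riemann sum: the mean value inequality is
    applied on each interval of the subdivision to eta - t k(tau_i). *)
Lemma increment_riemann_sum {R : realType} {E : tvsType R} (q : E -> R)
    (eta eta' k : R -> E) (g Gp : R -> R) (a b d e : R) (n : nat) (s tau : nat -> R) :
  a <= b -> continuous_seminorm q ->
  (forall t, a <= t <= b -> cder eta t (eta' t)) ->
  (forall t, a <= t <= b -> @cder R R^o Gp t (g t)) ->
  (forall t, a <= t <= b -> q (eta' t - k t) <= g t) ->
  (forall t t', a <= t <= b -> a <= t' <= b -> `|t - t'| < d -> q (k t - k t') <= e) ->
  subdivision a b d n s tau ->
  q (eta b - eta a - riemann_sum k n s tau) <= Gp b - Gp a + e * (b - a).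
Proof.
move=> ab sq etad Gd bnd ku T; have [s0 sn H] := T.
pose Fi i : E := eta (s i.+1) - eta (s i) - (s i.+1 - s i) *: k (tau i).
have -> : eta b - eta a - riemann_sum k n s tau = \sum_(i < n) Fi i.
  rewrite sumrB; congr (_ - _).
  by rewrite -(big_mkord xpredT (fun i => eta (s i.+1) - eta (s i))) telescope_sumr// sn s0.
have -> : Gp b - Gp a + e * (b - a) =
    \sum_(i < n) (Gp (s i.+1) - Gp (s i) + e * (s i.+1 - s i)).
  rewrite big_split /= -mulr_sumr.
  rewrite -(big_mkord xpredT (fun i => Gp (s i.+1) - Gp (s i))) telescope_sumr//.
  by rewrite -(big_mkord xpredT (fun i => s i.+1 - s i)) telescope_sumr// sn s0.
apply: le_trans (snorm_sum sq n Fi) _; apply: ler_sum => i _; rewrite /Fi.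
have ni := ltn_ord i; have [h1 h2 h3] := H i ni.
have si : s i <= s i.+1 by exact: le_trans h2.
have /andP[asi _] := subdivision_in T (ltnW ni); have /andP[_ sib] := subdivision_in T ni.
have inab t : s i <= t <= s i.+1 -> a <= t <= b.
  by move=> /andP[? ?]; apply/andP; split; lra.
have lin (V : tvsType R) (c : V) t : cder (fun t => t *: c) t c.
  have -> : (fun t => t *: c) = (fun t => 0 + t *: c) by apply/funext => u; rewrite add0r.
  exact: cder_line.
have := @mean_value _ _ q (fun t => eta t - t *: k (tau i)) (fun t => eta' t - k (tau i))
  (fun t => Gp t + t * e) (fun t => g t + e) (s i) (s i.+1) sq si _ _ _.
rewrite (_ : eta (s i.+1) - s i.+1 *: k (tau i) - (eta (s i) - s i *: k (tau i)) =
  eta (s i.+1) - eta (s i) - (s i.+1 - s i) *: k (tau i)); last first.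
  by rewrite scalerBl; exact: subrACA.
rewrite (_ : Gp (s i.+1) + s i.+1 * e - (Gp (s i) + s i * e) =
  Gp (s i.+1) - Gp (s i) + e * (s i.+1 - s i)); last by ring.
apply.
- by move=> t /inab tab; apply: cderB; [exact: etad|exact: lin].
- by move=> t /inab tab; apply: (@cderD R R^o); [exact: Gd|exact: (@lin R^o)].
- move=> t ti; have tab := inab _ ti.
  rewrite (_ : eta' t - k (tau i) = (eta' t - k t) + (k t - k (tau i))); last first.
    by rewrite addrA subrK.
  apply: le_trans (snormD sq _ _) _; apply: lerD; first exact: bnd.
  apply: ku => //; first exact: (subdivision_tag T).
  by move: ti => /andP[? ?]; rewrite ltr_norml; apply/andP; split; lra.
Qed.

Section Differentiation.
Context {R : realType} {E : tvsType R} {G : lieGroupType E}.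
Variable Xi : chart E G.
Hypotheses (Xi_chart : is_chart Xi) (Xi_dom : chart_dom Xi (1%g : G)).
Hypothesis Xi_unit : Xi (1%g : G) = 0.
Variable k : regularity.
Hypotheses (G_cont : k_continuous Xi k) (G_semireg : semiregular Xi k).
Variables r r' : R.
Hypothesis rr' : r < r'.
Variable I : set R.
Hypothesis I_itv : open_interval I.
Variable Phi : R -> R -> lie_algebra G.
Hypothesis Phi_Ck : forall z, I z -> Ck_curves Xi k r r' (Phi z).
Variable x : R.
Hypothesis Ix : I x.
Variable dPhi : R -> lie_algebra G.
Hypothesis dPhi_deriv : forall t, `[r, r']%classic t ->
     @is_dderiv R R^o (lie_algebra G) (Phi ^~ t) x 1 (dPhi t).
Hypothesis dPhi_Ck : Ck_curves Xi k r r' dPhi.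
Hypothesis Phi_bound : forall (p : E -> R) (s : nat),
     continuous_seminorm p -> reg_le s k ->
     exists (L : R) (J : set R),
       [/\ 0 <= L, open_interval J, J `<=` I, J x &
           forall h : R, h != 0 -> J (x + h) ->
             (`|h|^-1%:E *
                sup_seminorm Xi p s r r' (fun t => (Phi (x + h) t - Phi x t)%R)
              <= L%:E)%E].

Let rr : r <= r' := ltW rr'.
Let hX c : atlas c -> smooth_transition c Xi. Proof. by move=> /Xi_chart[]. Qed.
Let c_ (s : R) : R := clamp r r' s.
Let c_in s : r <= c_ s <= r' := clamp_in rr s.

Let mu (t : R) : G := prodint r r' (Phi x) t.
Let nu (h t : R) : G := ((mu t)^-1 * prodint r r' (Phi (x + h)) t)%g.
Let K : G -> G -> E -> E := dconj_trans Xi.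
Let nu' (h t : R) : E := K (mu t) (nu h t) (Phi (x + h) t - Phi x t).
Let integrand (t : R) : E := K (mu t) 1%g (dPhi t).

(* For small h the whole curve nu h lies in the domain of the chart. *)
Let good (h : R) : Prop := I (x + h) /\ forall t, r <= t <= r' -> chart_dom Xi (nu h t).

Let reg0 : reg_le 0 k. Proof. by case: k. Qed.

Let integrable z : I z -> integrable_curves r r' (Phi z).
Proof.
by move=> Iz; exact: (semiregular_integrable Xi_chart Xi_dom G_semireg rr' (Phi_Ck Iz)).
Qed.

Let Ck_clamp_cont f : Ck_curves Xi k r r' f -> continuous (f \o c_ : R -> E).
Proof. by move=> /(Ck_curves_jet rr' Xi_chart Xi_dom)/(_ reg0)[_ /(_ 0%N isT)]. Qed.

Let mu_logder z t : I z -> r <= t <= r' ->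
  logder (prodint r r' (Phi z) : R -> G) t (Phi z t).
Proof. by move=> Iz tr; exact: prodint_logder (integrable Iz) tr. Qed.

Let prodint_clamp_cont z : I z -> continuous ((prodint r r' (Phi z) : R -> G) \o c_).
Proof.
move=> Iz s; apply: continuous_comp; first exact: clamp_cont.
exact: logder_cont (mu_logder Iz (c_in s)).
Qed.

Let near_nu (U : set G) : nbhs (1%g : G) U ->
  \forall h \near (0 : R), forall t, r <= t <= r' -> U (nu h t).
Proof.
exact: (near_quot_unif Xi_chart Xi_dom G_cont G_semireg rr' I_itv Phi_Ck Ix Phi_bound).
Qed.

Let near_good : \forall h \near (0 : R), good h.
Proof.
have N1 := near_open_interval I_itv Ix.
have N2 := near_nu (chart_dom_nbhs Xi_dom).
by apply: filterS2 N1 N2 => h Ih Ch; split.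
Qed.

Let nu_cder h t : good h -> r <= t <= r' -> cder (Xi \o nu h) t (nu' h t).
Proof.
move=> [Ih Ch] tr; exact: (logder_quot hX (mu_logder Ix tr) (mu_logder Ih tr) (Ch _ tr)).
Qed.

Let K_cont (g n : R -> G) (v : R -> E) : continuous g -> continuous n -> continuous v ->
  (forall s, chart_dom Xi (n s)) -> continuous (fun s => K (g s) (n s) (v s)).
Proof.
move=> gc nc vc nX s.
pose T (s : R) : (G * G) * E := ((g s, n s), v s).
have Tc : T @ s --> T s.
  apply: cvg_prod1; last exact: vc.
  by apply: cvg_prod1; [exact: gc|exact: nc].
exact: (cvg_comp _ _ Tc (@dconj_trans_cont _ _ _ Xi hX (g s) (n s) (v s) (nX s))).
Qed.

Let nu'_cont h : good h -> continuous (nu' h \o c_).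
Proof.
move=> [Ih Ch]; apply: K_cont.
- exact: (prodint_clamp_cont Ix).
- move=> s; apply: cvg_mulg; last exact: (prodint_clamp_cont Ih).
  by apply: cvg_invg; exact: (prodint_clamp_cont Ix).
- move=> s; apply: tvs_cvgB; first exact: (Ck_clamp_cont (Phi_Ck Ih)).
  exact: (Ck_clamp_cont (Phi_Ck Ix)).
- by move=> s; apply: Ch; exact: c_in.
Qed.

Let integrand_cont : continuous (integrand \o c_).
Proof.
apply: K_cont => //; first exact: (prodint_clamp_cont Ix).
  by move=> s; exact: cvg_cst.
exact: Ck_clamp_cont.
Qed.

Section estimate.
Variable q : E -> R.
Hypothesis sq : continuous_seminorm q.

Let gap (h t : R) : R := q (h^-1 *: nu' h t - integrand t).

Let nu'_scale h t : good h -> r <= t <= r' ->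
  h^-1 *: nu' h t = K (mu t) (nu h t) (h^-1 *: (Phi (x + h) t - Phi x t) : E).
Proof. by move=> [_ Ch] tr; rewrite /K (dconj_transZ hX)//; exact: Ch. Qed.

Let gap_cvg t : r <= t <= r' -> gap h t @[h --> (0 : R)^'] --> (0 : R).
Proof.
move=> tr; apply/cvgrPdist_lt => e e0.
have D : (fun h : R => h^-1 *: (Phi (x + h) t - Phi x t) : E) @ (0 : R)^' --> (dPhi t : E).
  have := dPhi_deriv (_ : `[r, r']%classic t); rewrite /= in_itv => /(_ tr).
  by move=> /cder_dderiv.
have N : nu h t @[h --> (0 : R)^'] --> (1%g : G).
  move=> U /near_nu nU; have H0 : \forall h \near (0 : R), U (nu h t).
    by apply: filterS nU => h; exact.
  exact: (cvg_within _ H0).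
pose T (h : R) : (G * G) * E := ((mu t, nu h t), h^-1 *: (Phi (x + h) t - Phi x t) : E).
have Tc : T @ (0 : R)^' --> nbhs ((mu t, 1%g : G), dPhi t : E).
  apply: cvg_prod1; last exact: D.
  by apply: cvg_prod1; [exact: cvg_cst|exact: N].
have KT := cvg_comp _ _ Tc (@dconj_trans_cont _ _ _ Xi hX (mu t) 1%g (dPhi t) Xi_dom).
have H : \forall h \near (0 : R)^',
    q (K (mu t) (nu h t) (h^-1 *: (Phi (x + h) t - Phi x t) : E) - integrand t) < e.
  exact: (cvg_snorm_lt sq e0 KT).
have G' : \forall h \near (0 : R)^', good h by exact: (cvg_within _ near_good).
apply: (@filterS2 _ (0 : R)^' _ _ _ _ _ H G') => h {}H gh.
by rewrite sub0r normrN ger0_norm ?(snorm_ge0 sq)// /gap nu'_scale.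
Qed.

(** The quotients (Phi (x + h) - Phi x) / h need not converge uniformly, but
    they stay bounded in every seminorm, and so do their images under
    dconj_trans, which is bounded near the compact set of the points (mu t, 1). *)
Let gap_bound : exists M : R, \forall h \near (0 : R)^', forall t, r <= t <= r' ->
  gap h t <= M.
Proof.
have /compact_near_coveringP/near_covering_withinP cK := @segment_compact R r r'.
pose P (i : R * R) (t : R) := gap i.1 t <= i.2.
pose F := filter_prod (0 : R)^' (nbhs (+oo%R : set_system R)).
suff loc (t0 : R) : `[r, r']%classic t0 ->
    \forall t \near t0 & i \near F, `[r, r']%classic t -> P i t.
  have [[A B] /= [nA nB] AB] : \forall i \near F, `[r, r'] `<=` P i by exact: (cK _ F P).
  have [M BM] := filter_ex nB.
  exists M; apply: filterS nA => h Ah t tr.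
  by apply: (AB (h, M)) => //=; rewrite in_itv.
rewrite /= in_itv /= => t0r.
(* near (mu t0, 1, 0) the differential takes values of q-length less than 1 *)
have K0 : dconj_trans Xi (mu t0) 1%g 0 = 0 by exact: (dconj_trans0 hX).
have H1 : \forall w \near ((mu t0, 1%g : G), 0 : E),
    q (K w.1.1 w.1.2 w.2 - K (mu t0) 1%g 0) < 1.
  exact: (cvg_snorm_lt sq ltr01 (@dconj_trans_cont _ _ _ Xi hX (mu t0) 1%g 0 Xi_dom)).
rewrite /K K0 in H1.
have [[A B] /= [[[A1 A2] /= [nA1 nA2] A12] nB] AB] := H1.
have [p0 sp0 p0B] := nbhs0_snorm nB.
have [p sp pE] := snorm_dotted Xi_chart Xi_dom sp0.
have [L L0 HL] := jet_bound Xi_chart Xi_dom rr' Phi_Ck Ix Phi_bound sp reg0.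
have muc : {for t0, continuous mu} by exact: logder_cont (mu_logder Ix t0r).
have Nt1 : \forall t \near t0, A1 (mu t) by exact: muc.
have Nt2 : \forall t \near t0, q ((integrand \o c_) t - (integrand \o c_) t0) < 1.
  exact: (cvg_snorm_lt sq ltr01 (integrand_cont (x := t0))).
have Nh : \forall h \near (0 : R)^', [/\ h != 0, good h,
    forall t, r <= t <= r' -> A2 (nu h t) &
    forall i t, (i <= 0)%N -> r <= t <= r' ->
    dotted Xi p (jet r r' (Phi (x + h)) i t - jet r r' (Phi x) i t) <= `|h| * L].
  have Nh0 : \forall h \near (0 : R)^', h != 0 by exact: nbhs_dnbhs_neq.
  have Nh1 : \forall h \near (0 : R)^', good h by exact: (cvg_within _ near_good).
  have Nh2 : \forall h \near (0 : R)^', forall t, r <= t <= r' -> A2 (nu h t).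
    exact: (cvg_within _ (near_nu nA2)).
  have Nh3 : \forall h \near (0 : R)^', forall i t, (i <= 0)%N -> r <= t <= r' ->
    dotted Xi p (jet r r' (Phi (x + h)) i t - jet r r' (Phi x) i t) <= `|h| * L.
    exact: (cvg_within _ HL).
  have Nh01 : \forall h \near (0 : R)^', h != 0 /\ good h by exact: filterI.
  by apply: (@filterS3 _ (0 : R)^' _ _ _ _ _ _ Nh01 Nh2 Nh3) => h [h0 gh] h2 h3; split.
have NM : \forall M \near (+oo%R : set_system R), L + 1 + (q ((integrand \o c_) t0) + 1) <= M.
  by apply: nbhs_pinfty_ge; exact: num_real.
exists ([set t | A1 (mu t) /\ q ((integrand \o c_) t - (integrand \o c_) t0) < 1],
  [set i : R * R | [/\ i.1 != 0, good i.1, forall t, r <= t <= r' -> A2 (nu i.1 t) &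
    forall j t, (j <= 0)%N -> r <= t <= r' ->
    dotted Xi p (jet r r' (Phi (x + i.1)) j t - jet r r' (Phi x) j t) <= `|i.1| * L] /\
    L + 1 + (q ((integrand \o c_) t0) + 1) <= i.2]).
  split; first exact: filterI.
  exists ([set h | [/\ h != 0, good h, forall t, r <= t <= r' -> A2 (nu h t) &
    forall j t, (j <= 0)%N -> r <= t <= r' ->
    dotted Xi p (jet r r' (Phi (x + h)) j t - jet r r' (Phi x) j t) <= `|h| * L]],
    [set M | L + 1 + (q ((integrand \o c_) t0) + 1) <= M]) => //.
move=> [t [h M]] /= [[At qt] [[h0 gh hA2 hL] hM]] tr'.
have tr : r <= t <= r' by move: tr'; rewrite in_itv.
rewrite /P /gap /=.
have L1 : 0 < L + 1 by lra.
set X : E := h^-1 *: (Phi (x + h) t - Phi x t).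
have pX : p0 X <= L.
  rewrite /X snormZ// normfV ler_pdivrMl ?normr_gt0// -pE.
  exact: (hL 0%N t isT tr).
have qX : q (K (mu t) (nu h t) X) <= L + 1.
  have -> : X = (L + 1) *: ((L + 1)^-1 *: X) by rewrite scalerA mulfV ?gt_eqF// scale1r.
  rewrite /K (dconj_transZ hX); last by case: gh => _; exact.
  rewrite snormZ// gtr0_norm// -[leRHS]mulr1 ler_pM2l//; apply: ltW.
  have := AB ((mu t, nu h t), (L + 1)^-1 *: X); rewrite /= subr0; apply; split => /=.
    by apply: A12; split => //=; exact: hA2.
  apply: p0B; rewrite /= snormZ// gtr0_norm ?invr_gt0// ltr_pdivrMl// mulr1; lra.
rewrite nu'_scale//; apply: le_trans (snormB sq _ _) _; apply: le_trans hM.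
apply: lerD; first exact: qX.
have ct : c_ t = t by exact: clamp_id.
move: qt; rewrite /= ct => qt.
have := snormD sq (integrand t - integrand (c_ t0)) (integrand (c_ t0)); rewrite subrK; lra.
Qed.

(** Bounded convergence turns the pointwise convergence of the integrands into
    that of the primitives. *)
Let gap_primitive : exists Gp : R -> R -> R,
  (\forall h \near (0 : R)^', forall t, r <= t <= r' ->
     @cder R R^o (Gp h) t (gap h t)) /\
  (fun h => Gp h r' - Gp h r) @ (0 : R)^' --> (0 : R).
Proof.
have [M0 HM0] := gap_bound.
pose M := Num.max 0 M0.
pose ok h := good h /\ forall t, r <= t <= r' -> gap h t <= M.
pose g (h s : R) : R := if `[< ok h >] then gap h (c_ s) else 0.
have nok : \forall h \near (0 : R)^', ok h.
  have Nh1 : \forall h \near (0 : R)^', good h by exact: (cvg_within _ near_good).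
  apply: (@filterS2 _ (0 : R)^' _ _ _ _ _ Nh1 HM0) => h gh Hh; split => // t tr.
  by rewrite /M le_max Hh// orbT.
have gc h : continuous (g h).
  rewrite /g; case: asboolP => [[gh _]|_] s; last exact: cvg_cst.
  have H : (fun s => h^-1 *: (nu' h \o c_) s - (integrand \o c_) s) @ s -->
      h^-1 *: (nu' h \o c_) s - (integrand \o c_) s.
    apply: tvs_cvgB; last exact: integrand_cont.
    by apply: tvs_cvgZ; [exact: cvg_cst|exact: nu'_cont].
  exact: (cvg_comp _ _ H (@snorm_cont _ _ q sq _)).
have gM h s : 0 <= g h s <= M.
  rewrite /g; case: asboolP => [[_ okh]|_]; last by rewrite lexx/= /M le_max lexx.
  apply/andP; split; first exact: (snorm_ge0 sq).
  by apply: okh; exact: c_in.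
have g0 s : g h s @[h --> (0 : R)^'] --> (0 : R).
  move: (gap_cvg (c_in s)); apply: cvg_trans; apply: (@near_eq_cvg _ _ (0 : R)^').
  by apply: filterS nok => h okh; rewrite /g asboolT.
exists (fun h t => \int[@lebesgue_measure R]_(s in `[r - 1, t]) g h s)%R; split.
  apply: filterS nok => h okh t tr.
  have -> : gap h t = g h t by rewrite /g asboolT// /c_ clamp_id.
  apply: cder_primitive => //; move: tr => /andP[? _]; lra.
rewrite -[X in _ --> X](subr0 0); apply: cvgB; exact: (@cvg_integral0 _ g _ _ M gc gM g0).
Qed.

Lemma increment_close d e n s tau : 0 < e ->
  (forall t t', r <= t <= r' -> r <= t' <= r' -> `|t - t'| < d ->
    q (integrand t - integrand t') <= e) ->
  subdivision r r' d n s tau ->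
  \forall h \near (0 : R)^',
    q (h^-1 *: Xi (nu h r') - riemann_sum integrand n s tau) < e + e * (r' - r).
Proof.
move=> e0 ku T; have [Gp [Gd G0]] := gap_primitive.
have Nh1 : \forall h \near (0 : R)^', good h by exact: (cvg_within _ near_good).
have NG : \forall h \near (0 : R)^', Gp h r' - Gp h r < e.
  by apply: (G0 [set z | z < e]); exact: lt_nbhsl.
apply: (@filterS3 _ (0 : R)^' _ _ _ _ _ _ Nh1 Gd NG) => h gh Gdh NGh.
have ed t : r <= t <= r' -> cder (fun t => h^-1 *: Xi (nu h t)) t (h^-1 *: nu' h t).
  by move=> tr; apply: cderZ; exact: nu_cder.
have := increment_riemann_sum rr sq ed Gdh (fun t _ => lexx _) ku T.
have -> : nu h r = 1%g by rewrite /nu /mu !prodint0 invg1 mulg1.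
rewrite Xi_unit scaler0 subr0; lra.
Qed.

End estimate.

(** A Riemann sum that is close to W in the completion is close to
    Xi (nu h r') / h for small h, by increment_close. *)
Lemma cvg_increment (cE : completion E) (W : cE) :
  is_Riemann_integral (fun s => compl_inj cE (integrand s)) r r' W ->
  h^-1 *: compl_inj cE (Xi (nu h r')) @[h --> (0 : R)^'] --> W.
Proof.
move=> HW; apply/cvg_snormP => p sp e0 e0_gt0.
have sq := compl_inj_snorm sp.
have rr0 : 0 < r' - r by rewrite subr_gt0.
pose e := e0 / 2 / (1 + (r' - r)).
have e_gt0 : 0 < e by rewrite !divr_gt0// ltr_pwDl// ltW.
have ee : e + e * (r' - r) = e0 / 2.
  by rewrite /e; field; rewrite gt_eqF// ltr_pwDl// ltW.
have [d d0 Hd] := unif_continuous_itv sq integrand_cont e_gt0.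
have nW : nbhs W [set z | p (z - W) < e0 / 2].
  by apply: (cvg_snorm_lt sp _ (@cvg_id _ (nbhs W))); rewrite divr_gt0.
have [d' d'0 Hd'] := HW _ nW.
have dm : 0 < Num.min d d' by rewrite lt_min d0.
have [n [s T]] := subdivision_exists rr dm.
have [s0 sn HT] := T.
have Td : subdivision r r' d n s s.
  split => // i ni; have [h1 h2 h3] := HT i ni; split => //.
  by apply: lt_le_trans h3 _; rewrite ge_min lexx.
have HR : p (compl_inj cE (riemann_sum integrand n s s) - W) < e0 / 2.
  rewrite /riemann_sum linear_sum; under eq_bigr do rewrite linearZ.
  apply: Hd' => // i ni; have [h1 h2 h3] := HT i ni; split => //.
  by apply: lt_le_trans h3 _; rewrite ge_min lexx orbT.
apply: filterS (increment_close sq e_gt0 Hd Td) => h; rewrite ee => Hh.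
have := snormD sp (compl_inj cE (h^-1 *: Xi (nu h r') - riemann_sum integrand n s s))
  (compl_inj cE (riemann_sum integrand n s s) - W).
rewrite linearB linearZ addrA subrK.
by move: Hh; rewrite /= linearB linearZ => Hh; lra.
Qed.

Lemma derivative_prodint (cE : completion E) (cg : completion (lie_algebra G)) :
  exists Z : cg,
    is_Riemann_integral
      (fun s => compl_inj cg (Ad (prodint r r' (Phi x) s)^-1%g (dPhi s)))
      r r' Z /\
    is_deriv_at_unit Xi cE
      (fun h => ((prodint r r' (Phi x) r')^-1 * prodint r r' (Phi (x + h)%R) r')%g)
      Z.
Proof.
have hX' c : atlas c -> smooth_transition Xi c by move=> /Xi_chart[].
pose f s : lie_algebra G := Ad (prodint r r' (Phi x) s)^-1%g (dPhi s).
have integrandE s : integrand s = @tdiff _ _ _ Xi (1%g : G) (f s).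
  exact: (dconj_trans_Ad hX).
have fE s : f s = tdiff_inv Xi (integrand s) by rewrite integrandE (tdiffK hX hX').
have fc : continuous (f \o clamp r r' : R -> E).
  have -> : (f \o clamp r r' : R -> E) = tdiff_inv Xi \o (integrand \o c_).
    by apply/funext => s; exact: fE.
  move=> s; apply: continuous_comp; first exact: integrand_cont.
  exact: (tdiff_inv_cont hX').
have ifc : continuous ((fun s => compl_inj cg (f s)) \o clamp r r').
  by move=> s; exact: (cvg_comp _ _ (fc s) (@compl_inj_cont _ _ cg _)).
have [Z HZ] := Riemann_integral_exists rr (@compl_complete _ _ cg) ifc.
exists Z; split => //; split.
  have := near_good; apply: filterS => h [_ H]; apply: H.
  by rewrite rr lexx.
apply: cvg_increment.
have := @compl_ext_Riemann_integral _ _ _ cg cE _ (fun v w => tdiffD hX v w Xi_dom)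
  (fun a v => tdiffZ hX a v Xi_dom) (tdiff_cont hX Xi_dom) _ _ _ _ HZ.
by under eq_fun do rewrite -integrandE.
Qed.

End Differentiation.

Theorem mainTheorem4 (R : realType) (E : tvsType R) (G : lieGroupType E)
  (cE : completion E) (cg : completion (lie_algebra G))
  (Xi : chart E G) (Xi_chart : is_chart Xi) (Xi_dom : chart_dom Xi 1%g)
  (Xi_unit : Xi 1%g = 0) (Xi_convex : convex_set (chart_cod Xi))
  (k : regularity) (G_cont : k_continuous Xi k) (G_semireg : semiregular Xi k)
  (r r' : R) (rr' : r < r') (I : set R) (I_itv : open_interval I)
  (Phi : R -> R -> lie_algebra G)
  (Phi_Ck : forall z, I z -> Ck_curves Xi k r r' (Phi z))
  (x : R) (Ix : I x)
  (dPhi : R -> lie_algebra G)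
  (dPhi_deriv : forall t, `[r, r']%classic t ->
     @is_dderiv R R^o (lie_algebra G) (Phi ^~ t) x 1 (dPhi t))
  (dPhi_Ck : Ck_curves Xi k r r' dPhi)
  (Phi_bound : forall (p : E -> R) (s : nat),
     continuous_seminorm p -> reg_le s k ->
     exists (L : R) (J : set R),
       [/\ 0 <= L, open_interval J, J `<=` I, J x &
           forall h : R, h != 0 -> J (x + h) ->
             (`|h|^-1%:E *
                sup_seminorm Xi p s r r' (fun t => (Phi (x + h) t - Phi x t)%R)
              <= L%:E)%E]) :
  exists Z : cg,
    is_Riemann_integral
      (fun s => compl_inj cg (Ad (prodint r r' (Phi x) s)^-1%g (dPhi s)))
      r r' Z /\
    is_deriv_at_unit Xi cE
      (fun h => ((prodint r r' (Phi x) r')^-1 * prodint r r' (Phi (x + h)%R) r')%g)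
      Z.
Proof.
exact: (derivative_prodint Xi_chart Xi_dom Xi_unit G_cont G_semireg rr' I_itv
  Phi_Ck Ix dPhi_deriv dPhi_Ck Phi_bound).
Qed.
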